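(* Let $\phi$ be the random dynamical system generated by $\frac{du}{dt}+Au=F(u,\theta_t\omega)$, $u(0)=x$, on the rigged Hilbert space $V\subset H\subset V'$, satisfying the standing assumptions listed in the context. Let ${\cal L}=\{l_j: j=1,\dots,k\}$ be a set of linear continuous and linearly independent functionals on $V$, and let $\varepsilon_{\cal L}=\varepsilon_{\cal L}(V,H)$ be its completeness defect with respect to the pair $V,H$. Assume that the forward absorbing and forward invariant random set $B$ in $V$ is such that $\sup_{x\in B(\omega)}\|x\|_V^2$ is bounded by a tempered random variable and $t\mapsto \sup_{x\in B(\theta_t\omega)}\|x\|_V^2$ is locally integrable. Suppose there exist a constant $c>0$ and a measurable function $l=l(x_1,x_2,\omega)\ge 0$ such that for $x_1(\omega),x_2(\omega)\in B(\omega)$ $$\langle -A(x_1-x_2)+F(x_1,\omega)-F(x_2,\omega),\,x_1-x_2\rangle\le -c\|x_1-x_2\|_V^2+l(x_1,x_2,\omega)\|x_1-x_2\|_H^2 .$$ Assume that for some $m>0$ $$\frac1m\,\mathbb{E}\left\{\sup_{x_1,x_2\in B(\omega)}\int_0^m l(\phi(t,\omega,x_1),\phi(t,\omega,x_2),\theta_t\omega)\,dt\right\}<c\,\varepsilon_{\cal L}^{-2}.$$ Then ${\cal L}$ is a set of asymptotically determining functionals in probability for the random dynamical system $(\theta,\phi)$.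
   Context: Metric dynamical system: $(\Omega,{\cal F},\mathbb{P},\theta)$, where $(\Omega,{\cal F},\mathbb{P})$ is a probability space and $\theta:\mathbb{R}\times\Omega\to\Omega$ is a measurable flow ($\theta_0=\mathrm{id}$, $\theta_{t+\tau}=\theta_t\theta_\tau$), and $\mathbb{P}$ is ergodic with respect to $\theta$. A random dynamical system (RDS) over it with separable metric phase space $H$ is a ${\cal B}(\mathbb{R}^+)\otimes{\cal F}\otimes{\cal B}(H),{\cal B}(H)$-measurable mapping $\phi:\mathbb{R}^+\times\Omega\times H\to H$ with the cocycle property $\phi(t+\tau,\omega,x)=\phi(t,\theta_\tau\omega,\phi(\tau,\omega,x))$, $\phi(0,\omega,x)=x$. Setting: $V\subset H\subset V'$ is a rigged Hilbert space with compact embedding $V\subset H$ and duality mapping $\langle\cdot,\cdot\rangle$; $A$ is a positive self-adjoint operator in $H$ with $D(A^{1/2})=V$ and $\|\cdot\|_V=\|A^{1/2}\cdot\|_H$. The nonlinear mapping $F:V\times\Omega\to H$ is such that $F(u,\omega)$ is measurable for any fixed $u\in V$. The solution $u(t,\omega)$ of $\frac{du}{dt}+Au=F(u,\theta_t\omega)$, $u(0)=x\in H$, is assumed to be unique and to depend measurably on $(t,\omega,x)$, so that $\phi(t,\omega,x):=u(t,\omega)$ defines an RDS; it is assumed continuous, i.e. $x\mapsto\phi(t,\omega,x)$ is continuous for all $(t,\omega)$, with trajectories in $L_{2,loc}(0,\infty;V)\cap C([0,\infty);H)$. Tempered: a random variable $x\ge0$ is tempered if $\lim_{t\to\pm\infty}\log^+x(\theta_t\omega)/|t|=0$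 a.s.; a random set $B$ is tempered if $\omega\mapsto\sup_{x\in B(\omega)}\|x\|_H$ is tempered. Standing assumption: $\phi$ is dissipative, i.e. there is a compact random set $B\subset V$ which is forward invariant, $\phi(t,\omega,B(\omega))\subset B(\theta_t\omega)$ for $t>0$, and (forward) absorbing: for any $\varepsilon>0$ and any random variable $x(\omega)\in H$ there is $t_{\varepsilon,x}>0$ such that for $t\ge t_{\varepsilon,x}$ one has $\phi(t,\omega,x(\omega))\in B(\theta_t\omega)$ with probability (at least) $1-\varepsilon$. Moreover $B$ is tempered. Asymptotically determining in probability: a set ${\cal L}=\{l_j,\ j=1,\dots,k\}$ of linear continuous and linearly independent functionals on $V$ is called asymptotically determining in probability if for two initial conditions $x_1,x_2\in H$ the convergence $$\int_t^{t+1}\max_j|l_j(\phi(\tau,\omega,x_1)-\phi(\tau,\omega,x_2))|^2d\tau\to0\quad\text{in probability as }t\to\infty$$ implies $\|\phi(t,\omega,x_1)-\phi(t,\omega,x_2)\|_H\to0$ in probability as $t\to\infty$. Completeness defect: for Banach spaces $X$ continuously and densely embedded into $Y$ and a finite set ${\cal L}$ of linearly independent continuous linear functionals on $X$, $\varepsilon_{\cal L}(X,Y)=\sup\{\|w\|_Y: w\in X,\ l_j(w)=0\ \forall\, l_j\in{\cal L},\ \|w\|_X\le1\}$. *)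

(* Defs.v *)
From HB Require Import structures.
From mathcomp Require Import all_boot all_order all_algebra.
From mathcomp Require Import all_classical all_reals all_analysis measurable_realfun.

Set Implicit Arguments.
Unset Strict Implicit.
Unset Printing Implicit Defensive.

Import Order.TTheory GRing.Theory Num.Theory.
Import numFieldNormedType.Exports.

Local Open Scope classical_set_scope.
Local Open Scope ring_scope.

Notation borel X := (g_sigma_algebraType (@open X)).

Definition hilbert_norm (R : realType) (H : normedModType R)
    (dot : {dot H for idfun}) : Prop :=
  forall x : H, dot x x = `|x| ^+ 2.

Definition separable (X : topologicalType) : Prop :=
  exists2 D : set X, countable D & dense D.

(* An unbounded operator; the values of [op_fun] off [op_dom] are irrelevant. *)
Record operator (X : Type) := Operator {
  op_dom : set X ;
  op_fun :> X -> X }.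

Definition densely_defined_linear (R : realType) (H : normedModType R)
    (A : operator H) : Prop :=
  dense (op_dom A) /\
  forall (a : R) (x y : H), op_dom A x -> op_dom A y ->
    op_dom A (a *: x + y) /\ A (a *: x + y) = a *: A x + A y.

(* The left-hand side of the equivalence says that (y, z) is in the graph of
   the adjoint operator. *)
Definition self_adjoint (R : realType) (H : normedModType R)
    (dot : {dot H for idfun}) (A : operator H) : Prop :=
  densely_defined_linear A /\
  forall y z : H, (forall x, op_dom A x -> dot (A x) y = dot x z) <->
                  (op_dom A y /\ A y = z).

(* Non-strict positivity; for the operator A of [rigged] below, strict
   positivity follows because x |-> |A^{1/2} x| is a norm on V. *)
Definition positive_op (R : realType) (H : normedModType R)
    (dot : {dot H for idfun}) (A : operator H) : Prop :=
  forall x, op_dom A x -> 0 <= dot (A x) x.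

Definition is_sqrt_op (R : realType) (H : normedModType R)
    (dot : {dot H for idfun}) (A S : operator H) : Prop :=
  [/\ self_adjoint dot S, positive_op dot S,
      op_dom A = [set x | op_dom S x /\ op_dom S (S x)] &
      forall x, op_dom A x -> A x = S (S x)].

(* V is a type of its own, with the inclusion V ⊂ H given by [emb]. *)
Record rigged (R : realType) (H V : completeNormedModType R)
    (dot : {dot H for idfun}) (emb : {linear V -> H}) (A sqrtA : operator H)
  : Prop := {
  rigged_hilbert : hilbert_norm dot ;
  rigged_separable : separable H ;
  rigged_inj : injective emb ;
  rigged_dense : dense (range emb) ;
  rigged_continuous : continuous emb ;
  rigged_compact : precompact (emb @` [set v : V | `|v| <= 1]) ;
  rigged_self_adjoint : self_adjoint dot A ;
  rigged_positive : positive_op dot A ;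
  rigged_sqrt : is_sqrt_op dot A sqrtA ;
  rigged_dom : op_dom sqrtA = range emb ;
  rigged_norm : forall v : V, `|v| = `|sqrtA (emb v)| }.

Section rigged_space.
Context {R : realType} {H V : completeNormedModType R}.
Variables (dot : {dot H for idfun}) (emb : {linear V -> H}).

(* An element of V ⊂ H viewed in V (and 0 for elements of H \ V). *)
Definition toV (h : H) : V := xget 0 [set v | emb v = h].

(* Elements of V' are represented by functions V -> R, the duality <f, v> being
   f v.  [dualH h] is the image of h under H ⊂ V', and [dualA S u] is A u for
   the extension A : V -> V' of the operator with square root S. *)
Definition dualH (h : H) : V -> R := fun v => dot h (emb v).

Definition dualA (S : operator H) (u : V) : V -> R :=
  fun v => dot (S (emb u)) (S (emb v)).

Definition dual_norm (f : V -> R) : R :=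
  sup [set `|f v| | v in [set v : V | `|v| <= 1]].

End rigged_space.

Section dynamical_systems.
Context {R : realType} {d : measure_display} {Omega : measurableType d}.
Variables (P : probability Omega R) (theta : R -> Omega -> Omega).

Record ergodic_mds : Prop := {
  mds_measurable : measurable_fun setT (fun p : R * Omega => theta p.1 p.2) ;
  mds_0 : forall w, theta 0 w = w ;
  mds_add : forall s t w, theta (t + s) w = theta t (theta s w) ;
  mds_invariant : forall t E, measurable E -> P (theta t @^-1` E) = P E ;
  mds_ergodic : forall E, measurable E -> (forall t, theta t @^-1` E = E) ->
    P E = 0%E \/ P E = 1%E }.

Definition log_plus (y : R) : R := Num.max 0 (ln y).

Definition tempered (x : Omega -> R) : Prop :=
  [/\ measurable_fun setT x, (forall w, 0 <= x w) &
      {ae P, forall w,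
        (log_plus (x (theta t w)) / `|t| @[t --> +oo] --> 0) /\
        (log_plus (x (theta t w)) / `|t| @[t --> -oo] --> 0)}].

Definition cvg_in_probability0 (X : R -> Omega -> \bar R) : Prop :=
  forall delta : R, 0 < delta ->
    P [set w | (delta%:E <= `|X t w|)%E] @[t --> +oo] --> 0%E.

Variable H : completeNormedModType R.

Definition tempered_set (C : Omega -> set H) : Prop :=
  tempered (fun w => sup [set `|x| | x in C w]).

Definition random_compact_set (C : Omega -> set H) : Prop :=
  [/\ forall w, C w !=set0, forall w, compact (C w) &
      forall x : H, measurable_fun setT (fun w => inf [set `|x - y| | y in C w])].

Variable phi : R -> Omega -> H -> H.

(* The time set of [phi] is [0, +oo[; its values at negative times play no
   role. *)
Record continuous_rds : Prop := {
  rds_measurable :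
    measurable_fun [set p : R * Omega * borel H | 0 <= p.1.1]
      (fun p => phi p.1.1 p.1.2 p.2 : borel H) ;
  rds_0 : forall w x, phi 0 w x = x ;
  rds_cocycle : forall s t w x, 0 <= s -> 0 <= t ->
    phi (t + s) w x = phi t (theta s w) (phi s w x) ;
  rds_continuous : forall t w, 0 <= t -> continuous (phi t w) }.

Definition forward_invariant (C : Omega -> set H) : Prop :=
  forall t w, 0 < t -> phi t w @` C w `<=` C (theta t w).

Definition forward_absorbing (C : Omega -> set H) : Prop :=
  forall (e : R) (x : Omega -> H), 0 < e ->
    measurable_fun setT (x : Omega -> borel H) ->
    exists2 t0 : R, 0 < t0 &
      forall t, t0 <= t ->
        ((1 - e)%:E <= P [set w | C (theta t w) (phi t w (x w))])%E.

(* Compactness is in the phase space H, which is weaker than compactness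
   in V. *)
Record dissipative (V : completeNormedModType R) (emb : {linear V -> H})
    (B : Omega -> set V) : Prop := {
  diss_random : random_compact_set (fun w => emb @` B w) ;
  diss_invariant : forward_invariant (fun w => emb @` B w) ;
  diss_absorbing : forward_absorbing (fun w => emb @` B w) ;
  diss_tempered : tempered_set (fun w => emb @` B w) }.

End dynamical_systems.

Section evolution_equation.
Context {R : realType} {H V : completeNormedModType R}.
Context {d : measure_display} {Omega : measurableType d}.
Variables (dot : {dot H for idfun}) (emb : {linear V -> H}) (sqrtA : operator H).
Variables (theta : R -> Omega -> Omega) (F : V -> Omega -> H).

Local Notation leb := (@lebesgue_measure R).

(* F(u, theta_t w) - A u as an element of V', where u is a point of V ⊂ H. *)
Definition rhs (w : Omega) (t : R) (u : H) : V -> R :=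
  fun v => dualH dot emb (F (toV emb u) (theta t w)) v
           - dualA dot emb sqrtA (toV emb u) v.

(* u is in C([0,oo); H) and L_{2,loc}(0,oo; V), and du/dt = F - A u in
   L_{2,loc}(0,oo; V'): g is the derivative of u as a V'-valued function.  As V
   is separable, Borel measurability in V and weak measurability in V' are
   strong measurability. *)
Record is_solution (w : Omega) (x : H) (u : R -> H) : Prop := {
  sol_init : u 0 = x ;
  sol_continuous : {within `[0, +oo[, continuous u} ;
  sol_V : {ae leb, forall t, 0 < t -> range emb (u t)} ;
  sol_V_measurable : measurable_fun (`]0, +oo[%classic : set R)
    ((fun t => toV emb (u t)) : R -> borel V) ;
  sol_V_L2loc : locally_integrable `]0, +oo[ (fun t => `|toV emb (u t)| ^+ 2) ;
  sol_eq : exists g : R -> V -> R,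
    [/\ forall v : V,
          measurable_fun (`]0, +oo[%classic : set R) (fun t => g t v),
        locally_integrable `]0, +oo[ (fun t => dual_norm (g t) ^+ 2),
        forall (a b : R) (v : V), 0 < a -> a <= b ->
          dot (u b) (emb v) - dot (u a) (emb v) = \int[leb]_(t in `[a, b]) g t v &
        {ae leb, forall t, 0 < t -> g t = rhs w t (u t)}] }.

Record generated_by_equation (phi : R -> Omega -> H -> H) : Prop := {
  gen_F_measurable : forall u : V, measurable_fun setT (F u : Omega -> borel H) ;
  gen_solution : forall w x, is_solution w x (fun t => phi t w x) ;
  gen_unique : forall w x u, is_solution w x u ->
    forall t, 0 <= t -> u t = phi t w x }.

End evolution_equation.

Definition lin_independent (R : realType) (X : lmodType R) (k : nat)
    (L : 'I_k -> X -> R) : Prop :=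
  forall a : 'I_k -> R, (forall v, \sum_(j < k) a j * L j v = 0) ->
    forall j, a j = 0.

(* X is regarded as a subspace of Y through [i]. *)
Definition completeness_defect (R : realType) (X Y : completeNormedModType R)
    (i : X -> Y) (k : nat) (L : 'I_k -> X -> R) : \bar R :=
  ereal_sup [set `|i v|%:E | v in
    [set v : X | (forall j, L j v = 0) /\ `|v| <= 1]].

Definition determining_in_probability (R : realType)
    (H V : completeNormedModType R) (emb : {linear V -> H})
    (d : measure_display) (Omega : measurableType d) (P : probability Omega R)
    (phi : R -> Omega -> H -> H) (k : nat) (L : 'I_k -> V -> R) : Prop :=
  forall x1 x2 : H,
    cvg_in_probability0 P (fun t w =>
      \int[lebesgue_measure]_(tau in `[t, (t + 1)%R])
        (\big[Num.max/0]_(j < k)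
           `|L j (toV emb (phi tau w x1 - phi tau w x2))| ^+ 2)%:E)%E ->
    cvg_in_probability0 P (fun t w => `|(phi t w x1 - phi t w x2)%R|%:E).

Definition sup_integral (R : realType) (H V : completeNormedModType R)
    (emb : {linear V -> H}) (Omega : Type) (theta : R -> Omega -> Omega)
    (phi : R -> Omega -> H -> H) (B : Omega -> set V) (l : V -> V -> Omega -> R)
    (m : R) (w : Omega) : \bar R :=
  ereal_sup [set (\int[lebesgue_measure]_(t in `[0%R, m])
      (l (toV emb (phi t w (emb x.1))) (toV emb (phi t w (emb x.2)))
         (theta t w))%:E)%E | x in B w `*` B w].

(* Measurability with respect to the P-completion: a supremum over a random
   set need not be measurable before completion, and the integral of a
   nonnegative function with no measurability is only a lower integral. *)
Definition ae_measurable (R : realType) (d : measure_display)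
    (Omega : measurableType d) (P : probability Omega R)
    (X : Omega -> \bar R) : Prop :=
  exists2 Y : Omega -> \bar R, measurable_fun setT Y & {ae P, forall w, X w = Y w}.

(* Main.v *)
Require Import Defs.
From HB Require Import structures.
From mathcomp Require Import all_boot all_order all_algebra.
From mathcomp Require Import all_classical all_reals all_analysis measurable_realfun.
From mathcomp Require Import ring lra.

Set Implicit Arguments.
Unset Strict Implicit.
Unset Printing Implicit Defensive.

Import Order.TTheory GRing.Theory Num.Theory.
Import numFieldNormedType.Exports.

Local Open Scope classical_set_scope.
Local Open Scope ring_scope.

(* Let u be the difference of two trajectories that have entered B.  Testing
   the equation for u against u, in the limit of the resolvents (1 + A/n)^-1 u,
   gives d|u|_H^2/dt <= 2 (- c |u|_V^2 + l |u|_H^2).  For c' eps_L^2 < c the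
   completeness defect bounds - c |u|_V^2 by - c' |u|_H^2 plus a multiple of
   max_j |l_j(u)|^2, and Gronwall's inequality bounds |u(t)|_H^2 by an initial
   term and an integral of max_j |l_j(u)|^2, both weighted by
   exp (2 \int_r^t (l - c')).

   As B is invariant, the integral of l over a window of length m is at most the
   supremum Y in the hypothesis on the mean, taken at the start of the window;
   averaging over the windows, \int_r^t l is controlled by the orbit integral of
   Y over [r - m, t].  Seen from theta_t w this is an integral over
   [r - m - t, 0], which the maximal ergodic theorem bounds by
   kappa (t - r) + C with kappa < c' m, where C does not depend on r or t outside
   an event of small probability, the same for all t because P is invariant.  So
   the weights decay exponentially in t - r.  The contribution of r < t - M is
   then small because B is tempered, and that of the M last unit intervals
   because the functionals tend to 0 in probability. *)

(** * Completeness defect *)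

(** The equation holds only in V' and for almost every [t], and its integrated form is tested
    against fixed vectors of V, so [|u|^2] cannot be differentiated directly. The resolvents,
    continuous from H to V, turn [u t] into an admissible test vector. As the rates are merely
    integrable, telescoping over fine partitions ([increment_le]) takes the place of derivatives. A
    forward bound on [\int_0^t l] would say nothing uniform about [\int_r^t l]; the backward bound
    controls all [r] with one constant [C]. It is one-sided, so the maximal theorem suffices in
    place of Birkhoff's. The price is an exceptional event that moves with [t], whence convergence
    in probability. The strict mean hypothesis is spent twice: the mean of [Y] is below
    [kappa < c' m], which makes the rate [g = c' - kappa / m] positive, and [c' eps_L^2 < c] leaves
    room for Young's inequality. The supremum in that hypothesis is measurable only up to a null
    set, so it is replaced by a measurable majorant [Y] with no larger mean, valid at every point
    because it is evaluated along orbits. *)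

Section functionals.
Context {R : realType} {V : completeNormedModType R}.

Lemma linear_bounded (W : normedModType R) (f : {linear V -> W}) :
  continuous f -> exists2 M : R, 0 <= M & forall v, `|f v| <= M * `|v|.
Proof.
move=> fc; have /linear_boundedP [M [_ hM]] : bounded_near f (nbhs (0 : V)).
  by apply/linear_bounded_continuous.
exists (`|M| + 1); first by rewrite addr_ge0.
by move=> v; apply: hM; rewrite (le_lt_trans (ler_norm _))// ltrDl.
Qed.

(** Induction on [k]: the map for the last [k] functionals is corrected along a vector [e'] of their
    common kernel, normalized by [L ord0 e' = 1]. If no such vector exists, [L ord0] vanishes on
    that kernel and the old map serves unchanged. *)
Lemma kernel_projection (k : nat) (L : 'I_k -> {linear V -> R^o}) :
  (forall j, continuous (L j)) ->
  exists (p : V -> V) (C : R), [/\ 0 <= C, forall v j, L j (v - p v) = 0 &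
    forall v, `|p v| <= C * \big[Num.max/0]_(j < k) `|L j v|].
Proof.
elim: k L => [|k IH] L Lc.
  exists (fun _ => 0), 0; split=> // [v [] //|v].
  by rewrite normr0 mul0r.
have [|p [C [C0 hp hC]]] := IH (fun j => L (lift ord0 j)); first by move=> j; exact: Lc.
pose m v : R := \big[Num.max/0]_(j < k.+1) `|L j v|.
have mj j v : `|L j v| <= m v.
  by rewrite /m; apply: le_bigmax.
have ms v : \big[Num.max/0]_(j < k) `|L (lift ord0 j) v| <= m v.
  apply/bigmax_leP; split; last by move=> j _; exact: mj.
  by apply: (le_trans _ (mj ord0 v)).
have [[e he he0]|hno] := pselect (exists2 e, (forall j, L (lift ord0 j) e = 0) & L ord0 e <> 0).
  have [M M0 hM] := linear_bounded (Lc ord0).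
  pose e' := (L ord0 e)^-1 *: e.
  have e'0 : L ord0 e' = 1.
    by rewrite linearZ/= [LHS]mulVf//; apply/eqP.
  have e'j j : L (lift ord0 j) e' = 0 by rewrite linearZ/= he scaler0.
  exists (fun v => p v + L ord0 (v - p v) *: e'), (C + (1 + M * C) * `|e'|); split.
  - by rewrite !(addr_ge0, mulr_ge0).
  - move=> v j; rewrite opprD addrA linearB linearZ/=.
    have [->|[i ->]] : j = ord0 \/ exists i, j = lift ord0 i.
      by case: (unliftP ord0 j) => [i ->|->]; [right; exists i|left].
      by rewrite e'0 [X in _ - X]mulr1 subrr.
    by rewrite hp e'j scaler0 subr0.
  - move=> v; apply: (le_trans (ler_normD _ _)); rewrite mulrDl lerD//.
      by apply: (le_trans (hC v)); apply: ler_wpM2l.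
    rewrite normrZ mulrAC ler_wpM2r// linearB.
    apply: (le_trans (ler_normB _ _)); rewrite mulrDl mul1r lerD ?mj//.
    apply: (le_trans (hM _)); rewrite -mulrA ler_wpM2l//.
    by apply: (le_trans (hC v)); apply: ler_wpM2l.
exists p, C; split=> //.
  move=> v j; case: (unliftP ord0 j) => [i ->|->]; first exact: hp.
  apply: contrapT => h; apply: hno; exists (v - p v) => // i; exact: hp.
by move=> v; apply: (le_trans (hC v)); apply: ler_wpM2l.
Qed.

(** The continuity bound of [i] keeps the supremum finite, so the defect can be handled as a real;
    homogeneity removes the restriction to the unit ball. *)
Lemma completeness_defect_fin (H : completeNormedModType R) (i : {linear V -> H})
    (k : nat) (L : 'I_k -> {linear V -> R^o}) : continuous i ->
  exists e : R, [/\ 0 <= e, completeness_defect i L = e%:E &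
    forall v, (forall j, L j v = 0) -> `|i v| <= e * `|v|].
Proof.
move=> ic; have [M M0 hM] := linear_bounded ic.
set D := completeness_defect i L.
have D0 : (0 <= D)%E.
  apply: ereal_sup_ubound; exists 0; last by rewrite linear0 normr0.
  by split=> [j|]; rewrite ?linear0 ?normr0.
have DM : (D <= M%:E)%E.
  apply: ub_ereal_sup => _ [v [_ v1] <-]; rewrite lee_fin.
  by apply: (le_trans (hM v)); rewrite ler_piMr.
have Dfin : D \is a fin_num by rewrite ge0_fin_numE// (le_lt_trans DM)// ltry.
exists (fine D); split; first exact: fine_ge0.
  by rewrite fineK.
move=> v Lv; have [->|v0] := eqVneq v 0; first by rewrite linear0 !normr0 mulr0.
have vp : 0 < `|v| by rewrite normr_gt0.
rewrite -ler_pdivrMr// -lee_fin fineK//; apply: ereal_sup_ubound.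
exists (`|v|^-1 *: v).
  split=> [j|]; first by rewrite linearZ/= Lv scaler0.
  by rewrite normrZ ger0_norm ?invr_ge0// mulVf ?gt_eqF.
by rewrite linearZ/= normrZ ger0_norm ?invr_ge0// mulrC.
Qed.

(** The vector is cut into [v - p v], in the common kernel, where the defect applies, and [p v],
    controlled by the functionals. The strict inequality leaves room to absorb the cross term. *)
Lemma defect_inequality (H : completeNormedModType R) (i : {linear V -> H})
    (k : nat) (L : 'I_k -> {linear V -> R^o}) (e c c' : R) : continuous i ->
  (forall j, continuous (L j)) -> 0 <= e -> 0 < c' ->
  (forall v, (forall j, L j v = 0) -> `|i v| <= e * `|v|) ->
  c' * e ^+ 2 < c ->
  exists2 C : R, 0 <= C & forall v,
    c' * `|i v| ^+ 2 <= c * `|v| ^+ 2 + C * \big[Num.max/0]_(j < k) `|L j v| ^+ 2.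
Proof.
move=> ic Lc e0 c'0 he hc.
have [M M0 hM] := linear_bounded ic.
have [p [C [C0 hp hC]]] := kernel_projection Lc.
(* With [x = c' e^2] this gives [x (1 + eta) <= c]; the denominator [x + 1] instead of [x] covers
   [e = 0]. *)
pose eta := (c - c' * e ^+ 2) / (c' * e ^+ 2 + 1).
have ce0 : 0 <= c' * e ^+ 2 by rewrite mulr_ge0 ?sqr_ge0// ltW.
have eta0 : 0 < eta by rewrite divr_gt0 ?subr_gt0// ltr_wpDl.
have hce : c' * e ^+ 2 * (1 + eta) <= c.
  rewrite /eta; set x := c' * e ^+ 2 in ce0 hc *.
  have x1 : 0 < x + 1 by rewrite ltr_wpDl.
  have : x * ((c - x) / (x + 1)) <= c - x.
    rewrite mulrCA ger_pMr ?subr_gt0// ler_pdivrMr// mul1r.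
    by lra.
  lra.
pose K := (M + e) * C.
have K0 : 0 <= K by rewrite mulr_ge0 ?addr_ge0.
exists (c' * (1 + eta^-1) * K ^+ 2).
  by rewrite !mulr_ge0 ?sqr_ge0// ?addr_ge0 ?invr_ge0// ltW.
move=> v; set N := \big[Num.max/0]_(j < k) `|L j v| ^+ 2.
pose s : R := \big[Num.max/0]_(j < k) `|L j v|.
have s0 : 0 <= s by exact: bigmax_ge_id.
have sN : s ^+ 2 <= N.
  have : s <= Num.sqrt N.
    apply/bigmax_leP; split; first exact: sqrtr_ge0.
    move=> j _; rewrite -[leLHS]ger0_norm// -sqrtr_sqr ler_wsqrtr//.
    by rewrite /N; apply: (le_bigmax _ (fun j => `|L j v| ^+ 2)).
  rewrite -(@ler_pXn2r _ 2) ?nnegrE ?sqrtr_ge0// sqr_sqrtr//.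
  exact: bigmax_ge_id.
have hv : `|i v| <= e * `|v| + K * s.
  have -> : v = (v - p v) + p v by rewrite subrK.
  rewrite linearD; apply: (le_trans (ler_normD _ _)); rewrite [X in e * `|X|]subrK.
  have h1 : `|i (v - p v)| <= e * `|v| + e * (C * s).
    apply: (le_trans (he _ (hp v))); rewrite -mulrDr ler_wpM2l//.
    by apply: (le_trans (ler_normB _ _)); rewrite lerD2l hC.
  have h2 : `|i (p v)| <= M * (C * s).
    by apply: (le_trans (hM _)); rewrite ler_wpM2l// hC.
  rewrite /K; nra.
have nv0 : 0 <= `|v| by [].
have : `|i v| ^+ 2 <= (1 + eta) * (e * `|v|) ^+ 2 + (1 + eta^-1) * (K * s) ^+ 2.
  apply: (@le_trans _ _ ((e * `|v| + K * s) ^+ 2)).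
    by rewrite ler_pXn2r ?nnegrE// addr_ge0// mulr_ge0.
  set x := e * _; set y := K * s.
  (* Young's inequality [2 x y <= eta x^2 + y^2 / eta], as a completed square. *)
  have : 0 <= eta^-1 * (eta * x - y) ^+ 2 by rewrite mulr_ge0 ?sqr_ge0// invr_ge0 ltW.
  have -> : eta^-1 * (eta * x - y) ^+ 2 = eta * x ^+ 2 - x * y *+ 2 + eta^-1 * y ^+ 2.
    by field; rewrite gt_eqF.
  lra.
move=> h; apply: (le_trans (ler_wpM2l (ltW c'0) h)).
rewrite mulrDr lerD//.
  rewrite exprMn; have := ler_wpM2r (sqr_ge0 `|v|) hce; lra.
rewrite exprMn mulrA mulrA -[leRHS]mulrA mulrA ler_wpM2l//.
by rewrite !mulr_ge0 ?sqr_ge0// ?addr_ge0 ?invr_ge0// ltW.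
Qed.

End functionals.

(** * The resolvent of A *)

Section riesz.
Context {R : realType}.

Lemma cauchy_seq_cvg (W : completeNormedModType R) (v : nat -> W) :
  (forall e, 0 < e -> exists N, forall m n, (N <= m)%N -> (N <= n)%N ->
     `|v m - v n| <= e) -> cvgn v.
Proof.
move=> h; apply/cauchy_cvgP/cauchyP => e e0.
have [N hN] := h _ (divr_gt0 e0 (ltr0n R 2)); exists (v N).
exists N => //= n Nn; rewrite /= -ball_normE/=.
by rewrite (le_lt_trans (hN _ _ _ _))// gtr_pMr// invf_lt1// ltr1n.
Qed.

Lemma invS_small (e : R) : 0 < e -> exists N, forall n, (N <= n)%N -> n.+1%:R^-1 <= e.
Proof.
move=> e0; have [N _ hN] := near_infty_natSinv_lt (PosNum e0).
by exists N => n Nn; apply/ltW/hN.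
Qed.

(** The energy [Phi v = q v v - 2 f v] is bounded below by coercivity; a minimizing sequence is
    Cauchy by comparison with midpoints, and the vanishing first variation at its limit is the
    equation. The norm is only comparable with [q], as for the form in [resolventE], which mixes the
    inner products of H and V. *)
Lemma riesz_form (W : completeNormedModType R) (q : W -> W -> R) (f : W -> R)
    (al be M : R) : 0 < al -> 0 <= be -> 0 <= M ->
  (forall v w, q v w = q w v) ->
  (forall t u v w, q (t *: u + v) w = t * q u w + q v w) ->
  (forall v, al * `|v| ^+ 2 <= q v v) ->
  (forall v w, `|q v w| <= be * (`|v| * `|w|)) ->
  (forall t v w, f (t *: v + w) = t * f v + f w) ->
  (forall v, `|f v| <= M * `|v|) ->
  exists v, forall w, q v w = f w.
Proof.
move=> al0 be0 M0 qC qP qal qbe fP fM.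
have qPr t u v w : q w (t *: u + v) = t * q w u + q w v by rewrite qC qP !(qC w).
pose Phi v := q v v - 2 * f v.
have PhiP t v w : Phi (t *: w + v) = Phi v + t ^+ 2 * q w w + 2 * t * (q v w - f w).
  by rewrite /Phi qP !qPr fP (qC w v); ring.
have hlb : has_lbound (range Phi).
  exists (- (M ^+ 2 / al)) => _ [v _ <-]; rewrite /Phi.
  have h1 := qal v; have h2 := le_trans (ler_norm _) (fM v).
  have h3 : 0 <= al^-1 * (al * `|v| - M) ^+ 2.
    by rewrite mulr_ge0 ?sqr_ge0// invr_ge0 ltW.
  have h4 : al^-1 * (al * `|v| - M) ^+ 2 = al * `|v| ^+ 2 - 2 * (M * `|v|) + M ^+ 2 / al.
    by field; rewrite gt_eqF.
  lra.
have hinf : has_inf (range Phi) by split=> //; exists (Phi 0); exists 0.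
have /choice[v hv] : forall n : nat, exists v, Phi v < inf (range Phi) + n.+1%:R^-1.
  move=> n; have n0 : 0 < n.+1%:R^-1 :> R by rewrite invr_gt0.
  have [_ [v _ <-] hv] := inf_adherent n0 hinf.
  by exists v.
have Phiv w n : Phi (v n) <= Phi w + n.+1%:R^-1.
  by apply: (le_trans (ltW (hv n))); rewrite lerD2r; apply: ge_inf => //; exists w.
have vcvg : cvgn v.
  apply: cauchy_seq_cvg => e e0.
  (* The energy at the midpoint is lower than the mean of the two energies by [q d d / 4], while
     both are within this tolerance of the infimum; hence [al |d|^2 <= al e^2]. *)
  have [|N hN] := invS_small (_ : 0 < al * e ^+ 2 / 4).
    by rewrite !mulr_gt0 ?exprn_gt0// invr_gt0.
  exists N => m n /hN hm /hN hn.
  rewrite -(@ler_pXn2r _ 2) ?nnegrE ?(ltW e0)//.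
  set d := v m - v n.
  have E : v m = 1 *: d + v n by rewrite scale1r /d subrK.
  have h0 := qal d.
  have h1 := PhiP 1 (v n) d; rewrite -E in h1.
  have h2 := PhiP 2^-1 (v n) d.
  have h3 := Phiv (2^-1 *: d + v n) m.
  have h4 := Phiv (2^-1 *: d + v n) n.
  have : al * `|d| ^+ 2 <= al * e ^+ 2.
    rewrite h2 in h3 h4; rewrite h1 in h3.
    have E4 : (2^-1 : R) ^+ 2 = 4^-1 by field.
    rewrite E4 in h3 h4.
    move: hm hn h3 h4; set X := q d d in h0 *; set Y := q _ _ - _; set Z := Phi _.
    have e1 : 2 * 2^-1 = 1 :> R by field.
    rewrite e1; set i1 := _^-1; set i2 := n.+1%:R^-1 => *; lra.
  by rewrite ler_pM2l.
exists (limn v) => w; apply/eqP; rewrite -subr_eq0 -normr_le0.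
apply/ler_addgt0Pl => e e0; rewrite addr0.
pose Q := be * (`|w| * `|w|) + 1.
have Q0 : 0 < Q by rewrite ltr_wpDl// !mulr_ge0.
have r2 n : (q (v n) w - f w) ^+ 2 <= Q * n.+1%:R^-1.
  (* This step along [w] minimizes [t^2 Q + 2 t r], with minimum [- r^2 / Q], so near-minimality of
     [v n] bounds the residual [r]. The [1] in [Q] keeps it positive. *)
  set r := q _ _ - _; pose t := - r / Q.
  have := Phiv (t *: w + v n) n; rewrite PhiP -/r => h.
  have qQ : q w w <= Q by apply: (le_trans (ler_norm _)); rewrite (le_trans (qbe _ _))// lerDl.
  have h1 : t ^+ 2 * q w w <= t ^+ 2 * Q by rewrite ler_wpM2l ?sqr_ge0.
  have h2 : t ^+ 2 * Q + 2 * t * r = - (r ^+ 2 / Q) by rewrite /t; field; rewrite gt_eqF.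
  have h3 : r ^+ 2 / Q <= n.+1%:R^-1.
    rewrite -[leLHS]opprK -h2; move: h h1; clear h2; clearbody t r.
    by set i := n.+1%:R^-1 => *; lra.
  by rewrite mulrC -ler_pdivrMr.
have [|N hN] := invS_small (_ : 0 < (e / 2) ^+ 2 / Q).
  by rewrite divr_gt0 ?exprn_gt0 ?divr_gt0.
have e2 : 0 < e / 2 / (be * `|w| + 1) by rewrite !divr_gt0// ltr_wpDl// mulr_ge0.
have /cvgrPdist_le/(_ _ e2)[N' _ hN'] := vcvg.
pose n := maxn N N'.
have hn1 : `|q (v n) w - f w| <= e / 2.
  rewrite -(@ler_pXn2r _ 2) ?nnegrE ?divr_ge0 ?(ltW e0)// real_normK ?num_real//.
  apply: (le_trans (r2 n)); rewrite mulrC -ler_pdivlMr//.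
  by apply: hN; rewrite leq_maxl.
have -> : q (limn v) w - f w = q (limn v - v n) w + (q (v n) w - f w).
  have : q (1 *: (limn v - v n) + v n) w = q (limn v) w by rewrite scale1r subrK.
  by rewrite qP => <-; ring.
rewrite (le_trans (ler_normD _ _))// [leRHS](splitr e) lerD//.
have /hN' /= := leq_maxr N N'; rewrite -/n => h.
apply: (le_trans (qbe _ _)).
have bw : 0 < be * `|w| + 1 by rewrite ltr_wpDl// mulr_ge0.
rewrite ler_pdivlMr// in h.
apply: le_trans h; have := normr_ge0 (limn v - v n); nra.
Qed.

End riesz.

Section forms.
Context {R : realType}.

Lemma form_schwarz (W : normedModType R) (q : W -> W -> R) :
  (forall v w, q v w = q w v) ->
  (forall t u v w, q (t *: u + v) w = t * q u w + q v w) ->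
  (forall v, q v v = `|v| ^+ 2) ->
  forall v w, `|q v w| <= `|v| * `|w|.
Proof.
move=> qC qP qE v w.
have qPr t u x y : q y (t *: u + x) = t * q y u + q y x by rewrite qC qP !(qC y).
have q0 x : q 0 x = 0.
  have := qP 1 0 0 x; rewrite scaler0 addr0; lra.
have [->|w0] := eqVneq w 0; first by rewrite qC q0 !normr0 mulr0.
have wp : 0 < `|w| ^+ 2 by rewrite exprn_gt0// normr_gt0.
(* [|w|^2] times the component of [v] orthogonal to [w]. *)
pose z := (- q v w) *: w + `|w| ^+ 2 *: v.
have : 0 <= q z z by rewrite qE sqr_ge0.
have q1 t x y : q (t *: x) y = t * q x y.
  by have := qP t x 0 y; rewrite addr0 q0 addr0.
have q1r t x y : q y (t *: x) = t * q y x by rewrite qC q1 qC.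
rewrite /z qP !q1 !qPr !q1r (qC w v) !qE.
move=> h0.
have : 0 <= `|w| ^+ 2 * (`|w| ^+ 2 * `|v| ^+ 2 - q v w ^+ 2).
  by move: h0; congr (0 <= _); ring.
rewrite pmulr_rge0// subr_ge0 -exprMn => h.
rewrite -(@ler_pXn2r _ 2) ?nnegrE ?mulr_ge0// real_normK ?num_real//.
by rewrite mulrC.
Qed.

End forms.

Section resolvent.
Context {R : realType} {H V : completeNormedModType R}.
Variables (dot : {dot H for idfun}) (emb : {linear V -> H}) (S : operator H).

(** Weak form of [(1 + A / (n+1)) v = h]. In a rigged space a solution always exists ([resolventE]),
    so the default [0] of [xget] is never taken. *)
Definition resolvent (n : nat) (h : H) : V :=
  xget 0 [set v | forall w, dot (emb v) (emb w) + n.+1%:R^-1 * dualA dot emb S v w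
                            = dot h (emb w)].

End resolvent.

Section rigged_resolvent.
Context {R : realType} {H V : completeNormedModType R}.
Context {dot : {dot H for idfun}} {emb : {linear V -> H}} {A S : operator H}.
Hypothesis hr : rigged dot emb A S.
Local Notation a := (dualA dot emb S).
Local Notation J := (resolvent dot emb S).

(* [lra] does not treat [n.+1%:R^-1] as an atom, whence this alias. *)
Let la (n : nat) : R := n.+1%:R^-1.

Let posS n : 0 < la n. Proof. by rewrite /la invr_gt0. Qed.

Lemma dotC x y : dot x y = dot y x.
Proof. by rewrite hermC expr0 mul1r. Qed.

Lemma dotPl t x y z : dot (t *: x + y) z = t * dot x z + dot y z.
Proof. by rewrite linearDl/= linearZl_LR. Qed.

Lemma dotPr t x y z : dot z (t *: x + y) = t * dot z x + dot z y.
Proof. by rewrite dotC dotPl !(dotC z). Qed.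

Lemma dotBl x y z : dot (x - y) z = dot x z - dot y z.
Proof. by rewrite addrC -scaleN1r dotPl; ring. Qed.

Lemma dotBr x y z : dot z (x - y) = dot z x - dot z y.
Proof. by rewrite dotC dotBl !(dotC z). Qed.

Lemma dotxx x : dot x x = `|x| ^+ 2. Proof. exact: rigged_hilbert hr x. Qed.

Lemma dot_schwarz x y : `|dot x y| <= `|x| * `|y|.
Proof. by apply: form_schwarz; [exact: dotC|exact: dotPl|exact: dotxx]. Qed.

Lemma sqrt_domain v : op_dom S (emb v).
Proof. by rewrite (rigged_dom hr); exists v. Qed.

Lemma sqrt_emb t v w : S (emb (t *: v + w)) = t *: S (emb v) + S (emb w).
Proof.
have [[[_ hS] _] _ _ _] := rigged_sqrt hr.
by rewrite linearP; have [_ ->] := hS t (emb v) (emb w) (sqrt_domain v) (sqrt_domain w).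
Qed.

Lemma ipVC v w : a v w = a w v. Proof. exact: dotC. Qed.

Lemma ipVPl t u v w : a (t *: u + v) w = t * a u w + a v w.
Proof. by rewrite /dualA sqrt_emb dotPl. Qed.

Lemma ipVPr t u v w : a w (t *: u + v) = t * a w u + a w v.
Proof. by rewrite ipVC ipVPl !(ipVC w). Qed.

Lemma ipVxx v : a v v = `|v| ^+ 2.
Proof. by rewrite /dualA dotxx (rigged_norm hr). Qed.

Lemma ipV_schwarz v w : `|a v w| <= `|v| * `|w|.
Proof. by apply: form_schwarz; [exact: ipVC|exact: ipVPl|exact: ipVxx]. Qed.

Lemma emb_bounded : exists2 M : R, 0 <= M & forall v, `|emb v| <= M * `|v|.
Proof. exact/linear_bounded/(rigged_continuous hr). Qed.

Lemma resolventE n h w :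
  dot (emb (J n h)) (emb w) + la n * a (J n h) w = dot h (emb w).
Proof.
move: w; rewrite /resolvent; case: xgetP => [v _ //|hno w]; exfalso.
have [M M0 hM] := emb_bounded.
have la0 := posS n.
have [] := @riesz_form R V (fun v w => dot (emb v) (emb w) + la n * a v w)
  (fun w => dot h (emb w)) (la n) (M ^+ 2 + la n) (`|h| * M) la0.
- by rewrite addr_ge0 ?sqr_ge0// ltW.
- by rewrite mulr_ge0.
- by move=> v x; rewrite dotC ipVC.
- by move=> t u v x; rewrite linearP dotPl ipVPl; ring.
- by move=> v; rewrite ipVxx dotxx lerDr sqr_ge0.
- move=> v x; apply: (le_trans (ler_normD _ _)); rewrite mulrDl lerD//.
    apply: (le_trans (dot_schwarz _ _)); rewrite expr2 mulrACA.
    by apply: ler_pM.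
  by rewrite normrM (gtr0_norm la0) ler_wpM2l ?ipV_schwarz// ltW.
- by move=> t v x; rewrite linearP dotPr.
- move=> v; apply: (le_trans (dot_schwarz _ _)).
  by rewrite -mulrA ler_wpM2l.
- by move=> v hv; apply: (hno v).
Qed.

Lemma resolvent_unique n h v :
  (forall w, dot (emb v) (emb w) + la n * a v w = dot h (emb w)) ->
  v = J n h.
Proof.
move=> hv; apply/eqP; rewrite -subr_eq0 -normr_eq0 -sqrf_eq0 -ipVxx.
have := hv (v - J n h); rewrite -(resolventE n h).
have E : v = 1 *: (v - J n h) + J n h by rewrite scale1r subrK.
have E' : emb v = 1 *: emb (v - J n h) + emb (J n h) by rewrite -linearP -E.
set d := v - J n h in E E' *.
rewrite E' [X in a X _]E dotPl ipVPl dotxx => /eqP; rewrite -subr_eq0 => /eqP h1.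
have lan := posS n; have := sqr_ge0 `|emb d|.
have h2 : 0 <= a d d by rewrite ipVxx sqr_ge0.
rewrite eq_le h2 andbT -(pmulr_rle0 _ lan) => h3; lra.
Qed.

Lemma resolventP n t x y : J n (t *: x + y) = t *: J n x + J n y.
Proof.
apply/esym/resolvent_unique => w; rewrite linearP dotPl ipVPl dotPl.
by rewrite -(resolventE n x) -(resolventE n y); ring.
Qed.

Lemma resolventB n x y : J n (x - y) = J n x - J n y.
Proof. by rewrite addrC -scaleN1r resolventP scaleN1r addrC. Qed.

Lemma resolvent_normH n h : `|emb (J n h)| <= `|h|.
Proof.
set v := J n h; have := resolventE n h v; rewrite -/v dotxx ipVxx => E.
have h1 := le_trans (ler_norm _) (dot_schwarz h (emb v)).
have [->|v0] := eqVneq (`|emb v|) 0; first by [].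
have vp : 0 < `|emb v| by rewrite lt_neqAle eq_sym v0/=.
rewrite -(ler_pM2r vp) -expr2.
have := mulr_ge0 (ltW (posS n)) (sqr_ge0 `|v|); lra.
Qed.

(** The constant degenerates with [n], but for fixed [n] it makes [J n] continuous from H to V, so
    that a path continuous in H yields test vectors continuous in V. *)
Lemma resolvent_bound n h : `|J n h| <= n.+1%:R * `|h|.
Proof.
set v := J n h; have := resolventE n h v; rewrite -/v dotxx ipVxx => E.
have h1 := le_trans (ler_norm _) (dot_schwarz h (emb v)).
have h2 : la n * `|v| ^+ 2 <= `|h| ^+ 2.
  have h3 := sqr_ge0 `|emb v|.
  have h4 : `|h| * `|emb v| <= `|h| * `|h| by rewrite ler_wpM2l// resolvent_normH.
  lra.
rewrite -(@ler_pXn2r _ 2) ?nnegrE ?mulr_ge0// exprMn.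
rewrite /la mulrC ler_pdivrMr// in h2; apply: (le_trans h2).
by rewrite mulrC ler_wpM2r ?sqr_ge0// expr2 ler_peMl// ler1n.
Qed.

Lemma resolvent_continuous n : continuous (J n).
Proof.
move=> x; apply/cvgrPdist_le => e e0.
have e1 : 0 < e / n.+1%:R by rewrite divr_gt0.
near=> y; rewrite -resolventB; apply: (le_trans (resolvent_bound _ _)).
rewrite mulrC -ler_pdivlMr//; near: y.
Unshelve. all: by end_near. Qed.

Lemma resolvent_sym n h k : dot h (emb (J n k)) = dot k (emb (J n h)).
Proof. by rewrite -(resolventE n h) -(resolventE n k) dotC ipVC. Qed.

Lemma resolvent_pos n h : 0 <= dot h (emb (J n h)).
Proof. by rewrite -(resolventE n h) dotxx ipVxx addr_ge0 ?mulr_ge0 ?sqr_ge0// ltW. Qed.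

Let resolvent_diff n x w :
  dot (emb (J n (emb x) - x)) (emb w) = - (la n * a (J n (emb x)) w).
Proof.
have := resolventE n (emb x) w; rewrite addrC linearB -scaleN1r.
rewrite (addrC (emb _)) dotPl => *; lra.
Qed.

Let ipVBr x y z : a z (x - y) = a z x - a z y.
Proof. by rewrite addrC -scaleN1r ipVPr; lra. Qed.

Let ipVBl x y z : a (x - y) z = a x z - a y z.
Proof. by rewrite ipVC ipVBr !(ipVC z). Qed.

(** Testing the equation of [v = J n (emb x)] against [v - x] gives [a v (v - x) <= 0]. *)
Lemma resolvent_normV n x : `|J n (emb x)| <= `|x|.
Proof.
set v := J n _; have := resolvent_diff n x (v - x).
rewrite -/v dotxx ipVBr ipVxx => E.
have h1 := le_trans (ler_norm _) (ipV_schwarz v x).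
have h2 : `|v| ^+ 2 - a v x <= 0.
  rewrite -(pmulr_rle0 _ (posS n)); have := sqr_ge0 `|emb (v - x)|; lra.
have [->|v0] := eqVneq (`|v|) 0; first by [].
have vp : 0 < `|v| by rewrite lt_neqAle eq_sym v0/=.
by rewrite -(ler_pM2l vp) -expr2; lra.
Qed.

Let resolvent_cvgH_V n x : `|emb (J n (emb x)) - emb x| ^+ 2 <= la n * `|x| ^+ 2.
Proof.
rewrite -linearB -dotxx resolvent_diff ipVBr ipVxx.
set v := J n _.
have h1 := le_trans (ler_norm _) (ipV_schwarz v x).
rewrite -mulrN ler_pM2l//.
have h2 : `|v| * `|x| <= `|x| * `|x| by rewrite ler_wpM2r// resolvent_normV.
have := sqr_ge0 `|v|; rewrite (expr2 `|x|); lra.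
Qed.

(** Density of V and the contraction property in H reduce the claim to [emb x], where the squared
    error is at most [|x|^2 / (n+1)]. *)
Lemma resolvent_cvgH h : emb (J n h) @[n --> \oo] --> h.
Proof.
apply/cvgrPdist_le => e e0.
have e3 : 0 < e / 3 by rewrite divr_gt0.
have [z [/= hz [x _ xz]]] : exists z, [set z | `|h - z| < e / 3] z /\ range emb z.
  apply: (rigged_dense hr); first by exists h; rewrite /= subrr normr0.
  rewrite (_ : mkset _ = ball h (e / 3)); first exact: ball_open.
  by rewrite -ball_normE.
rewrite -xz in hz.
have [|N hN] := invS_small (_ : 0 < (e / 3) ^+ 2 / (`|x| ^+ 2 + 1)).
  by rewrite divr_gt0 ?exprn_gt0// ltr_wpDl// sqr_ge0.
exists N => // n /hN hn.
have -> : h - emb (J n h) = (h - emb x) + (emb x - emb (J n (emb x))) + emb (J n (emb x - h)).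
  by rewrite resolventB linearB !addrA subrK subrK.
rewrite (le_trans (ler_normD _ _))//.
have h1 : `|emb (J n (emb x - h))| <= e / 3.
  by rewrite (le_trans (resolvent_normH _ _))// distrC ltW.
have h2 : `|emb x - emb (J n (emb x))| <= e / 3.
  rewrite -(@ler_pXn2r _ 2) ?nnegrE ?(ltW e3)// distrC.
  apply: (le_trans (resolvent_cvgH_V _ _)).
  apply: (le_trans (ler_wpM2r (sqr_ge0 _) hn)).
  rewrite -mulrA ger_pMr ?exprn_gt0// mulrC ler_pdivrMr ?mul1r ?lerDl//.
have h3 := ler_normD (h - emb x) (emb x - emb (J n (emb x))).
lra.
Qed.

(** Subtracting the two equations and testing with [x - y] yields [a x y >= |y|^2]. The V-norms thus
    increase with the index, and their increments control the distances. *)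
Lemma resolvent_dist n m h : (n <= m)%N ->
  `|J m h - J n h| ^+ 2 <= `|J m h| ^+ 2 - `|J n h| ^+ 2.
Proof.
move=> nm; have [->|/eqP nm'] := eqVneq n m; first by rewrite !subrr normr0 expr0n.
set x := J m h; set y := J n h.
have E1 := resolventE m h (x - y); have E2 := resolventE n h (x - y).
rewrite -/x -/y in E1 E2.
have E3 : dot (emb x) (emb (x - y)) - dot (emb y) (emb (x - y)) = `|emb (x - y)| ^+ 2.
  have E : emb (x - y) = -1 *: emb y + emb x by rewrite linearB addrC scaleN1r.
  rewrite -dotxx [X in _ = dot X _]E dotPl; lra.
rewrite !ipVBr !ipVxx (ipVC y x) in E1 E2.
have h0 := sqr_ge0 `|emb (x - y)|.
have lt_la : la m < la n :> R.
  rewrite /la ltf_pV2 ?posrE// ltr_nat; move: nm; rewrite leq_eqVlt => /orP[/eqP//|].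
  by rewrite ltnS.
have E4 : `|x - y| ^+ 2 = `|x| ^+ 2 - 2 * a x y + `|y| ^+ 2.
  by rewrite -!ipVxx ipVBr !ipVBl (ipVC y x); ring.
have h1 := sqr_ge0 `|x - y|.
have lm := posS m; have ln := posS n.
have h2 : 0 <= a x y - `|y| ^+ 2.
  have h3 : (la n - la m) * (a x y - `|y| ^+ 2) >= la m * `|x - y| ^+ 2.
    rewrite E4;
    nra.
  rewrite -(@pmulr_rge0 _ (la n - la m)) ?subr_gt0//.
  by apply: le_trans h3; rewrite mulr_ge0// ltW.
lra.
Qed.

(** An increasing bounded sequence of norms converges, and [resolvent_dist] turns this into the
    Cauchy property. With [resolvent_cvg_range] it recognizes the elements of V among those of H. *)
Lemma bounded_resolvent_cvg h M : (forall n, `|J n h| <= M) -> cvgn (J ^~ h).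
Proof.
move=> hM; apply: cauchy_seq_cvg => e e0.
have mono n m : (n <= m)%N -> `|J n h| ^+ 2 <= `|J m h| ^+ 2.
  by move=> /(@resolvent_dist _ _ h); have := sqr_ge0 `|J m h - J n h|; lra.
pose E := range (fun n => `|J n h| ^+ 2).
have hsup : has_sup E.
  split; first by exists (`|J 0 h| ^+ 2); exists 0%N.
  exists (M ^+ 2) => _ [n _ <-]; rewrite ler_pXn2r ?nnegrE//.
  by apply: le_trans (hM n).
have [_ [N _ <-] hN] := sup_adherent (exprn_gt0 2 e0) hsup.
have key n m : (N <= n)%N -> (n <= m)%N -> `|J m h - J n h| <= e.
  move=> Nn nm; rewrite -(@ler_pXn2r _ 2) ?nnegrE ?(ltW e0)//.
  apply: (le_trans (resolvent_dist _ nm)).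
  have h1 := mono _ _ Nn.
  have h2 : `|J m h| ^+ 2 <= sup E by apply: sup_ubound; [case: hsup|exists m].
  lra.
exists N => m n Nm Nn; case/orP: (leq_total n m) => nm; first exact: key.
by rewrite distrC; exact: key.
Qed.

Lemma resolvent_cvg_range h v : J n h @[n --> \oo] --> v -> emb v = h.
Proof.
move=> hv; apply: (@cvg_unique _ (@norm_hausdorff _ H) (emb (J n h) @[n --> \oo])).
  by apply: continuous_cvg => //; exact: rigged_continuous hr v.
exact: resolvent_cvgH.
Qed.

Lemma resolvent_cvgV x : J n (emb x) @[n --> \oo] --> x.
Proof.
have cv := @bounded_resolvent_cvg (emb x) `|x| (fun n => resolvent_normV n x).
by have /(rigged_inj hr) E := resolvent_cvg_range cv; rewrite -[X in _ --> X]E.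
Qed.

Lemma toV_emb v : toV emb (emb v) = v.
Proof.
rewrite /toV; case: xgetP => [w _ /= /(rigged_inj hr)//|hno].
by exfalso; apply: (hno v).
Qed.

Lemma toV_out h : ~ range emb h -> toV emb h = 0.
Proof.
move=> hno; rewrite /toV; case: xgetP => [w _ /= E|//].
by exfalso; apply: hno; exists w.
Qed.

End rigged_resolvent.

(** * Borel measurability in H and V *)

Section borel.
Context {R : realType}.

Lemma measurable_borel {d} {T : measurableType d} {X : ptopologicalType}
    (D : set T) (f : T -> X) :
  (forall U, open U -> measurable (D `&` f @^-1` U)) ->
  measurable_fun D (f : T -> borel X).
Proof.
move=> h; apply: (@measurability _ _ _ (borel X) D f (@open X)) => //.
by move=> _ [U oU <-]; exact: h.
Qed.

Lemma measurable_lt_cst {d} {T : measurableType d} (D : set T) (f : T -> R) r :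
  measurable D -> measurable_fun D f -> measurable (D `&` [set t | f t < r]).
Proof. by move=> mD mf; rewrite -preimage_itvNyo; exact: mf. Qed.

Lemma measurable_le_cst {d} {T : measurableType d} (D : set T) (f : T -> R) r :
  measurable D -> measurable_fun D f -> measurable (D `&` [set t | f t <= r]).
Proof. by move=> mD mf; rewrite -preimage_itvNyc; exact: mf. Qed.

Lemma open_borel {X : ptopologicalType} (U : set X) : open U -> measurable (U : set (borel X)).
Proof. by move=> oU; exact: sub_sigma_algebra. Qed.

Lemma closed_borel {X : ptopologicalType} (U : set X) : closed U -> measurable (U : set (borel X)).
Proof. by move=> cU; rewrite -[U]setCK; apply: measurableC; apply: open_borel; exact: closed_openC. Qed.

Lemma continuous_borel {X Y : ptopologicalType} (f : X -> Y) : continuous f ->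
  measurable_fun setT (f : borel X -> borel Y).
Proof.
move=> /continuousP fc; apply: measurable_borel => U oU.
by rewrite setTI; apply: open_borel; exact: fc.
Qed.

Lemma continuous_borel_real {X : ptopologicalType} (f : X -> R) : continuous f ->
  measurable_fun setT (f : borel X -> R).
Proof.
move=> /continuousP fc; apply: (measurability (@RGenOpens.G R)).
  exact: RGenOpens.measurableE.
by move=> _ [_ [a [b ->]] <-]; rewrite setTI; apply: open_borel; apply: fc; exact: interval_open.
Qed.

Lemma dense_sequence {X : ptopologicalType} : separable X ->
  exists e : nat -> X, forall U : set X, open U -> U !=set0 -> exists i, U (e i).
Proof.
move=> [D /countable_injP[f /= finj] dD].
exists (fun n => xget point [set x | D x /\ f x = n]) => U oU U0.
have [x [Ux Dx]] := dD _ U0 oU; exists (f x).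
case: xgetP => [y -> [Dy fy]|/(_ x)]; last by case.
by rewrite (finj _ x (mem_set Dy) (mem_set Dx) fy).
Qed.

Lemma dense_sequence_norm {X : completeNormedModType R} : separable X ->
  exists e : nat -> X, forall (x : X) r, 0 < r -> exists i, `|x - e i| < r.
Proof.
move=> /dense_sequence[e he]; exists e => x r r0.
have [|i] := he _ (@ball_open _ X x r); first by exists x; exact: ballxx.
by rewrite -ball_normE; exists i.
Qed.

Let nat_small (r : R) : 0 < r -> exists n, n.+1%:R^-1 <= r.
Proof. by move=> /invS_small[N hN]; exists N; exact: hN. Qed.

Let posS n : 0 < n.+1%:R^-1 :> R. Proof. by rewrite invr_gt0. Qed.

Lemma open_ball_sub {X : completeNormedModType R} (U : set X) x : open U -> U x ->
  exists2 r, 0 < r & forall y, `|x - y| < r -> U y.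
Proof.
move=> oU Ux; have /nbhs_ballP[r r0 hr] : nbhs x U by exact: open_nbhs_nbhs.
by exists r => // y xy; apply: hr; rewrite -ball_normE.
Qed.

Lemma measurable_ball {d} {T : measurableType d} {X : completeNormedModType R}
    (D : set T) (f : T -> borel X) (x : X) r : measurable D ->
  measurable_fun D f -> measurable (D `&` [set t | `|x - f t| < r]).
Proof.
move=> mD mf; have := mf mD _ (open_borel (@ball_open _ X x r)).
by rewrite -ball_normE.
Qed.

(** By separability, countably many pairs of small balls suffice: the preimage of [U] is a union
    over the pairs of balls whose differences all lie in [U]. *)
Lemma measurable_borelB {d} {T : measurableType d} {X : completeNormedModType R}
    (D : set T) (f g : T -> X) : separable X -> measurable D ->
  measurable_fun D (f : T -> borel X) -> measurable_fun D (g : T -> borel X) ->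
  measurable_fun D ((fun t => f t - g t) : T -> borel X).
Proof.
move=> /dense_sequence_norm[e he] mD mf mg; apply: measurable_borel => U oU.
pose B (x : X) n := [set y : X | `|x - y| < n.+1%:R^-1].
pose G (p : nat * nat * nat) : set T :=
  [set t | (D t /\ B (e p.1.1) p.2 (f t)) /\ (D t /\ B (e p.1.2) p.2 (g t)) /\
  forall a b, B (e p.1.1) p.2 a -> B (e p.1.2) p.2 b -> U (a - b)].
have -> : D `&` (fun t => f t - g t) @^-1` U = \bigcup_p G p.
  apply/seteqP; split => [t [Dt Ut]|t [[[i j] n] _ [[Dt hf] [[_ hg] hU]]]]; last first.
    by split=> //; exact: hU.
  have [r r0 hr] := open_ball_sub oU Ut.
  (* Four displacements of size [1/(n+1)] separate [f t - g t] from [a - b]. *)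
  have [n hn] := nat_small (divr_gt0 r0 (ltr0n R 4)).
  have [i hi] := he (f t) _ (posS n); have [j hj] := he (g t) _ (posS n).
  exists (i, j, n) => //; split; [|split].
  - by split=> //=; rewrite /B/= distrC.
  - by split=> //=; rewrite /B/= distrC.
  - move=> a b /=; rewrite /B/= => ha hb; apply: hr.
    have -> : f t - g t - (a - b) = (f t - e i) + (e i - a) - ((g t - e j) + (e j - b)).
      by rewrite addrA subrK (addrA (g t - e j)) subrK !opprB addrACA [RHS]addrACA (addrC (- a)).
    have h1 := ler_normB ((f t - e i) + (e i - a)) ((g t - e j) + (e j - b)).
    have h2 := ler_normD (f t - e i) (e i - a).
    have h3 := ler_normD (g t - e j) (e j - b).
    set q := n.+1%:R^-1 in hn hi hj ha hb; lra.
apply: countable_bigcupT_measurable => // -[[i j] n].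
have [hU|hU] := pselect (forall a b, B (e i) n a -> B (e j) n b -> U (a - b)); last first.
  rewrite (_ : G _ = set0)//; apply/seteqP; split=> // t [_ [_ h]].
  by exfalso; exact: hU.
rewrite (_ : G _ = (D `&` [set t | `|e i - f t| < n.+1%:R^-1]) `&`
                   (D `&` [set t | `|e j - g t| < n.+1%:R^-1])).
  by apply: measurableI; exact: measurable_ball.
by apply/seteqP; split => [t [h1 [h2 h3]]|t [h1 h2]].
Qed.

(** The closed sets [K k], of the points with a ball of radius [1/(k+1)] inside [U], exhaust [U];
    the limit lies in [U] exactly when the sequence eventually stays in one of them. *)
Lemma measurable_borel_cvg {d} {T : measurableType d} {X : completeNormedModType R}
    (D : set T) (f_ : nat -> T -> X) (f : T -> X) : measurable D ->
  (forall n, measurable_fun D (f_ n : T -> borel X)) ->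
  (forall t, D t -> f_ n t @[n --> \oo] --> f t) ->
  measurable_fun D (f : T -> borel X).
Proof.
move=> mD mf cf; apply: measurable_borel => U oU.
pose K n := [set x : X | forall y, `|x - y| < n.+1%:R^-1 -> U y].
have cK n : closed (K n).
  rewrite -[K n]setCK; apply: open_closedC.
  rewrite (_ : ~` K n = \bigcup_(y in ~` U) ball y n.+1%:R^-1).
    by apply: bigcup_open => y _; exact: ball_open.
  apply/seteqP; split => [x /existsNP[y /not_implyP[xy Uy]]|x [y Uy]].
    by exists y => //; rewrite -ball_normE/= distrC.
  by rewrite -ball_normE/= distrC => xy h; apply/Uy/h.
have -> : D `&` f @^-1` U =
    \bigcup_k \bigcup_N \bigcap_(n in [set n | (N <= n)%N]) (D `&` f_ n @^-1` K k).
  apply/seteqP; split => [t [Dt Ut]|t [k _ [N _ h]]].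
    have [r r0 hr] := open_ball_sub oU Ut.
    have [k hk] := nat_small (divr_gt0 r0 (ltr0n R 2)).
    have /cvgrPdist_lt/(_ _ (posS k))[N _ hN] := cf t Dt.
    exists k => //; exists N => // n Nn; split => // y hy; apply: hr.
    have := hN n Nn => /= h1; have h2 := ler_distD (f_ n t) (f t) y.
    set q := k.+1%:R^-1 in hk hy h1; lra.
  have Dt : D t by have [] := h N (leqnn N).
  split => //; have /cvgrPdist_lt/(_ _ (posS k))[N' _ hN] := cf t Dt.
  have [_ hK] := h _ (leq_maxl N N'); apply: hK; rewrite distrC.
  by apply: hN; exact: leq_maxr.
apply: bigcupT_measurable => k; apply: bigcupT_measurable => N.
apply: bigcap_measurable; first by exists N => /=.
by move=> n _; apply: mf => //; exact: closed_borel.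
Qed.

(** The distance to [C t] is known to be measurable from fixed points only; a dense sequence
    supplies points close to both [f t] and [C t]. *)
Lemma measurable_random_closed {d} {T : measurableType d} {X : completeNormedModType R}
    (C : T -> set X) (f : T -> X) : separable X ->
  (forall t, C t !=set0) -> (forall t, closed (C t)) ->
  (forall x, measurable_fun setT (fun t => inf [set `|x - y| | y in C t])) ->
  measurable_fun setT (f : T -> borel X) ->
  measurable [set t | C t (f t)].
Proof.
move=> /dense_sequence_norm[e he] C0 Cc mC mf.
pose G i n : set T := [set t | `|e i - f t| < n.+1%:R^-1] `&`
    [set t | inf [set `|e i - y| | y in C t] < n.+1%:R^-1].
have lb x t : has_inf [set `|x - y| | y in C t].
  split; first by have [y Cy] := C0 t; exists `|x - y|; exists y.
  by exists 0 => _ [y _ <-].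
have -> : [set t | C t (f t)] = \bigcap_n \bigcup_i G i n.
  apply/seteqP; split => [t /= Ct n _|t h /=].
    have [i hi] := he (f t) _ (posS n); exists i => //; split; rewrite /= 1?distrC//.
    apply: le_lt_trans hi; rewrite distrC; apply: ge_inf; first by case: (lb (e i) t).
    by exists (f t).
  rewrite ((closure_id _).1 (Cc t)); move=> U /nbhs_ballP[r r0 hr].
  have [n hn] := nat_small (divr_gt0 r0 (ltr0n R 2)).
  have [i _ [/= h1 h2]] := h n I.
  have h2' : 0 < n.+1%:R^-1 - inf [set `|e i - y| | y in C t] by rewrite subr_gt0.
  have [_ [y Cy <-] hy] := inf_adherent h2' (lb (e i) t); rewrite subrKC in hy.
  exists y; split => //; apply: hr; rewrite -ball_normE/=.
  have h3 := ler_distD (e i) (f t) y; rewrite distrC in h1.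
  set q := n.+1%:R^-1 in hn h1 hy; lra.
apply: bigcapT_measurable => n; apply: bigcupT_measurable => i; apply: measurableI.
  by rewrite -[X in measurable X]setTI; exact: measurable_ball.
by rewrite -[X in measurable X]setTI; apply: measurable_lt_cst => //; exact: mC.
Qed.

End borel.

(** * Borel measurability of V inside H *)

Section rigged_borel.
Context {R : realType} {H V : completeNormedModType R}.
Context {dot : {dot H for idfun}} {emb : {linear V -> H}} {A S : operator H}.
Hypothesis hr : rigged dot emb A S.
Local Notation J := (resolvent dot emb S).

Lemma measurable_resolvent n : measurable_fun setT (J n : borel H -> borel V).
Proof. apply: continuous_borel; exact: (resolvent_continuous hr). Qed.

Lemma measurable_norm (X : completeNormedModType R) :
  measurable_fun setT ((fun x => `|x|) : borel X -> R).
Proof. by apply: continuous_borel_real => x; exact: norm_continuous. Qed.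

(** Boundedness of the resolvents in V characterizes membership in V. These are countably many
    conditions continuous in [h], so V is a Borel subset of H. *)
Lemma range_emb_resolvent : range emb =
  \bigcup_(M : nat) \bigcap_n [set h | `|J n h| <= M%:R].
Proof.
apply/seteqP; split => [_ [v _ <-]|h [M _ hM]].
  have [N _ hN] := nbhs_infty_ger `|v|.
  exists N => // n _ /=; apply: (le_trans (resolvent_normV hr n v)).
  by apply: hN => /=.
have cv : cvgn (J ^~ h).
  by apply: (bounded_resolvent_cvg hr (M := M%:R)) => n; exact: hM.
by exists (limn (J ^~ h)) => //; exact: (resolvent_cvg_range hr).
Qed.

Lemma measurable_range_emb : measurable (range emb : set (borel H)).
Proof.
rewrite range_emb_resolvent; apply: bigcupT_measurable => M.
apply: bigcapT_measurable => n; rewrite -[X in measurable X]setTI.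
apply: measurable_le_cst => //.
exact: (measurableT_comp (@measurable_norm V) (measurable_resolvent n)).
Qed.

(** On the Borel set [range emb] the map is the pointwise limit in V of the continuous maps [J n];
    off it, it is the constant [0]. *)
Lemma measurable_toV : measurable_fun setT (toV emb : borel H -> borel V).
Proof.
rewrite -(setvU (range emb)) setUC; apply/measurable_funU.
- exact: measurable_range_emb.
- by apply: measurableC; exact: measurable_range_emb.
split.
  apply: (@measurable_borel_cvg R _ (borel H) V (range emb) J (toV emb)) => //; first exact: measurable_range_emb.
    by move=> n; exact: measurable_funTS (measurable_resolvent n).
  by move=> _ [v _ <-]; rewrite (toV_emb hr); exact: (resolvent_cvgV hr).
apply: (eq_measurable_fun (fun=> 0 : borel V)); last exact: measurable_cst.
by move=> h; rewrite inE => /(toV_out (emb := emb)) ->.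
Qed.

Lemma measurable_functionals (k : nat) (L : 'I_k -> {linear V -> R^o}) :
  (forall j, continuous (L j)) ->
  measurable_fun setT ((fun v => \big[Num.max/0]_(j < k) `|L j v| ^+ 2) : borel V -> R).
Proof.
elim: k L => [|k IH] L Lc.
  by under eq_fun do rewrite big_ord0; exact: measurable_cst.
under eq_fun do rewrite big_ord_recl; apply: measurable_maxr; last exact: (IH (fun j => L (lift ord0 j))).
apply: measurable_funX; apply: continuous_borel_real => x.
by apply: (continuous_comp (f := L ord0) (g := fun y : R => `|y|)); [exact: Lc|exact: norm_continuous].
Qed.

End rigged_borel.

(** * Gronwall's inequality *)

Section real_analysis.
Context {R : realType}.
Local Notation leb := (@lebesgue_measure R).

Lemma within_uniform (W : normedModType R) (f : R -> W) a b :
  {within `[a, b], continuous f} -> forall e, 0 < e ->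
  exists2 rho, 0 < rho & forall s t, a <= s <= b -> a <= t <= b -> `|s - t| <= rho ->
    `|f s - f t| <= e.
Proof.
move=> /subspace_continuousP fc e e0.
have h := (compact_near_coveringP _).1 (@segment_compact R a b) R (0^'+)
  (fun rho s => s \in `[a, b] -> forall t, t \in `[a, b] ->
   `|s - t| <= rho -> `|f s - f t| <= e) _.
have {h} : \forall rho \near 0^'+, `[a, b] `<=` (fun s => s \in `[a, b] -> forall t, t \in `[a, b] ->
   `|s - t| <= rho -> `|f s - f t| <= e).
  apply: h => x xab.
  have /cvgrPdist_le/(_ _ (divr_gt0 e0 (ltr0n R 2))) := fc x xab.
  rewrite near_withinE => /nbhs_ballP[r /= r0 hr].
  have r2 : 0 < r / 2 by rewrite divr_gt0.
  exists (ball x (r / 2), [set rho | rho < r / 2]).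
    split; first exact: nbhsx_ballx.
    exact: nbhs_right_lt.
  move=> [s rho]/= [] ; rewrite -ball_normE/= => xs rhor sab t tab st.
  have h1 : `|f x - f s| <= e / 2.
    by apply: hr => //; rewrite -ball_normE/=; lra.
  have h2 : `|f x - f t| <= e / 2.
    apply: hr => //; rewrite -ball_normE/=.
    have := ler_distD s x t; lra.
  rewrite -(subrKA (f x)) (le_trans (ler_normD _ _))// distrC; lra.
move=> [r /= r0 hr]; exists (r / 2); first by rewrite divr_gt0.
move=> s t sab tab st; apply: (hr (r / 2)) => //=; rewrite ?divr_gt0//.
by rewrite sub0r normrN gtr0_norm ?divr_gt0// ltr_pdivrMr// ltr_pMr// ltr1n.
Qed.

(* Telescoping over a fine uniform partition. *)
Lemma increment_le (z K M : R -> R) a b : a <= b ->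
  (forall eta, 0 < eta -> exists2 rho, 0 < rho & forall s t, a <= s -> s <= t ->
     t <= b -> t - s <= rho -> z t - z s <= K t - K s + eta * (M t - M s)) ->
  z b - z a <= K b - K a.
Proof.
move=> ab h; apply/ler_addgt0Pl => e e0.
(* Scaled so that the total error [eta * (M b - M a)] is at most [e]. *)
pose eta := e / (`|M b - M a| + 1).
have d0 : 0 < `|M b - M a| + 1 by rewrite ltr_wpDl.
have [rho rho0 hrho] := h eta (divr_gt0 e0 d0).
have [n hn] : exists n : nat, (b - a) / rho <= n.+1%:R.
  have [n _ hn] := nbhs_infty_ger ((b - a) / rho).
  by exists n; apply: (le_trans (hn n (leqnn n))); rewrite ler_nat.
pose st := (b - a) / n.+1%:R; pose p i := a + st * i%:R.
have st0 : 0 <= st by rewrite divr_ge0// subr_ge0.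
have strho : st <= rho.
  by rewrite /st ler_pdivrMr// mulrC -ler_pdivrMr.
have pE : p n.+1 = b by rewrite /p /st divfK// addrC subrK.
have pb i : (i <= n.+1)%N -> p i <= b.
  by move=> ile; rewrite -pE /p lerD2l ler_wpM2l// ler_nat.
have key i : (i <= n.+1)%N -> z (p i) - z a <= K (p i) - K a + eta * (M (p i) - M a).
  elim: i => [_|i IH ile]; first by rewrite /p mulr0 addr0 !subrr mulr0 addr0.
  have h1 := IH (ltnW ile).
  have pS : p i.+1 - p i = st by rewrite /p -natr1; ring.
  have := hrho (p i) (p i.+1) _ _ (pb _ ile) _; rewrite pS.
  have -> : a <= p i by rewrite /p lerDl mulr_ge0.
  have -> : p i <= p i.+1 by rewrite -subr_ge0 pS.
  move=> /(_ isT isT strho); lra.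
have := key n.+1 (leqnn _); rewrite pE => /le_trans; apply.
rewrite addrC lerD2r /eta mulrAC ler_pdivrMr// ler_wpM2l ?(ltW e0)//.
by rewrite (le_trans (ler_norm _))// lerDl.
Qed.

Lemma integrable_sub (f : R -> R) a b s t : a <= s -> t <= b ->
  leb.-integrable `[a, b] (EFin \o f) -> leb.-integrable `[s, t] (EFin \o f).
Proof.
move=> as_ tb; apply: integrableS => //; apply: subset_itv; rewrite bnd_simp//.
Qed.

Lemma integrable_addR (f g : R -> R) a b : leb.-integrable `[a, b] (EFin \o f) ->
  leb.-integrable `[a, b] (EFin \o g) -> leb.-integrable `[a, b] (EFin \o (fun x => f x + g x)).
Proof. by move=> fi gi; have := integrableD _ fi gi; apply; exact: measurable_itv. Qed.

Lemma integrable_scaleR (f : R -> R) a b k : leb.-integrable `[a, b] (EFin \o f) ->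
  leb.-integrable `[a, b] (EFin \o (fun x => k * f x)).
Proof. by move=> fi; have := integrableZl _ k fi; apply; exact: measurable_itv. Qed.

Lemma integrable_subR (f g : R -> R) a b : leb.-integrable `[a, b] (EFin \o f) ->
  leb.-integrable `[a, b] (EFin \o g) -> leb.-integrable `[a, b] (EFin \o (fun x => f x - g x)).
Proof. by move=> fi gi; have := integrableB _ fi gi; apply; exact: measurable_itv. Qed.

Lemma integrable_absR (f : R -> R) a b : leb.-integrable `[a, b] (EFin \o f) ->
  leb.-integrable `[a, b] (EFin \o (fun x => `|f x|)).
Proof. by move=> fi; exact: (integrable_norm fi). Qed.

Lemma Rintegral_increment (f : R -> R) a b s t : a <= s -> s <= t -> t <= b ->
  leb.-integrable `[a, b] (EFin \o f) ->
  \int[leb]_(x in `[a, t]) f x - \int[leb]_(x in `[a, s]) f x =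
  \int[leb]_(x in `[s, t]) f x.
Proof.
move=> as_ st tb fi.
have fat := integrable_sub (lexx a) tb fi.
rewrite Rintegral_itvB// ?bnd_simp//.
apply: Rintegral_itv_obnd_cbnd; apply: integrableS fat => //.
by apply: subset_itv; rewrite bnd_simp.
Qed.

Lemma Rintegral_itv1 (f : R -> R) a : \int[leb]_(x in `[a, a]) f x = 0.
Proof. by rewrite set_itv1 Rintegral_set1. Qed.

Lemma integrable_bounded_mul (f g : R -> R) a b M :
  leb.-integrable `[a, b] (EFin \o f) -> measurable_fun `[a, b] g ->
  (forall x, a <= x <= b -> `|g x| <= M) ->
  leb.-integrable `[a, b] (EFin \o (fun x => g x * f x)).
Proof.
move=> fi mg gM.
have mf : measurable_fun `[a, b] f by apply/measurable_EFinP; exact: measurable_int fi.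
apply: (le_integrable (f := _) _ _ _ (integrableZl _ `|M| fi)) => //.
  by apply/measurable_EFinP; exact: measurable_funM.
move=> x /= xab; rewrite lee_fin !normrM normr_id ler_wpM2r//.
by apply: (le_trans (gM x _)); [move: xab; rewrite in_itv|exact: ler_norm].
Qed.

(** The coefficient [al] is merely integrable, hence the integrated hypothesis and the proof by
    increments. The kernel enters through a continuous majorant [psi], because only upper bounds of
    the integrals of [al] will be available. *)
Lemma gronwall (y al n psi : R -> R) a b : a <= b ->
  {within `[a, b], continuous y} -> (forall x, 0 <= y x) ->
  leb.-integrable `[a, b] (EFin \o al) -> leb.-integrable `[a, b] (EFin \o n) ->
  (forall x, 0 <= n x) -> {within `[a, b], continuous psi} ->
  (forall s, a <= s <= b -> expR (\int[leb]_(r in `[s, b]) al r) <= psi s) ->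
  (forall s t, a <= s -> s <= t -> t <= b ->
     y t - y s <= \int[leb]_(r in `[s, t]) (al r * y r + n r)) ->
  y b <= psi a * y a + \int[leb]_(r in `[a, b]) (psi r * n r).
Proof.
move=> ab yc y0 ali ni n0 psic hpsi hy.
have aab : a <= a <= b by rewrite lexx.
have [M psiM] : exists M, forall s, a <= s <= b -> `|psi s| <= M.
  have [rho rho0 h] := within_uniform psic ltr01.
  have /compact_bounded[M [_ hM]] := continuous_compact psic (@segment_compact R a b).
  exists (`|M| + 1) => s sab; apply: (hM (`|M| + 1)); last by exists s.
  by rewrite (le_lt_trans (ler_norm _))// ltrDl.
have mc (f : R -> R) : {within `[a, b], continuous f} -> measurable_fun `[a, b] f.
  by move=> fc; exact: subspace_continuous_measurable_fun.
have psin : leb.-integrable `[a, b] (EFin \o (fun r => psi r * n r)).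
  exact: integrable_bounded_mul (mc _ psic) psiM.
have [Y hY] : exists Y, forall s, a <= s <= b -> `|y s| <= Y.
  have /compact_bounded[Y [_ hY]] := continuous_compact yc (@segment_compact R a b).
  exists (`|Y| + 1) => s sab; apply: (hY (`|Y| + 1)); last by exists s.
  by rewrite (le_lt_trans (ler_norm _))// ltrDl.
have yal : leb.-integrable `[a, b] (EFin \o (fun r => y r * al r)).
  exact: integrable_bounded_mul (mc _ yc) hY.
have aln := integrable_absR ali.
have M0 : 0 <= M by apply: le_trans (psiM a aab).
pose be s := \int[leb]_(r in `[s, b]) al r.
(* The integrating factor is anchored at [b], so that [z b = y b] and [z a <= psi a * y a]. *)
pose z s := expR (be s) * y s.
pose K t := \int[leb]_(r in `[a, t]) (psi r * n r).
(* The error budget: [M |al|] pays for freezing [y] at the left end of a step, [n] for freezing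
   [psi] at the right end. *)
pose MM t := \int[leb]_(r in `[a, t]) (M * `|al r| + n r).
have MMi := integrable_addR (integrable_scaleR M aln) ni.
have : z b - z a <= K b - K a.
  apply: (increment_le (M := MM)) => // eta eta0.
  have [r1 r10 h1] := within_uniform yc eta0.
  have [r2 r20 h2] := within_uniform psic eta0.
  exists (Num.min r1 r2); first by rewrite lt_min r10.
  move=> s t as_ st tb; rewrite le_min => /andP[ts1 ts2].
  have sab : a <= s <= b by rewrite as_ (le_trans st).
  have tab : a <= t <= b by rewrite tb (le_trans as_).
  rewrite (Rintegral_increment as_ st tb psin) (Rintegral_increment as_ st tb MMi).
  have beE : be s - be t = \int[leb]_(r in `[s, t]) al r.
    rewrite /be -[X in _ - X](Rintegral_increment (a := s) (b := b) st tb (lexx b)).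
      by ring.
    exact: integrable_sub ali.
  have isub f : leb.-integrable `[a, b] (EFin \o f) -> leb.-integrable `[s, t] (EFin \o f).
    exact: integrable_sub.
  have e1 : z t - z s <= expR (be t) *
      (\int[leb]_(r in `[s, t]) (y r * al r + n r) - y s * \int[leb]_(r in `[s, t]) al r).
    (* Convexity, [1 + x <= exp x]; multiplied by [y s >= 0] it replaces the derivative of the
       integrating factor. *)
    have E1 : expR (be t) * (1 + (be s - be t)) <= expR (be s).
      have -> : be s = be t + (be s - be t) by rewrite addrC subrK.
      by rewrite expRD ler_wpM2l ?expR_ge0// [X in _ + (X - _)]addrC subrK expR_ge1Dx.
    have E2 := hy s t as_ st tb.
    under eq_Rintegral do rewrite mulrC.
    rewrite -beE /z.
    have E3 := ler_wpM2l (expR_ge0 (be t)) E2.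
    have E4 := ler_wpM2r (y0 s) E1.
    move: E3 E4; set I := Rintegral _ _ _ => E3 E4.
    clearbody I; clear -E3 E4.
    by move: (expR (be t)) (expR (be s)) (be s) (be t) (y t) (y s) I E3 E4 => *; lra.
  have etai := integrable_addR (integrable_scaleR eta (isub _ aln)) (isub _ ni).
  have yali := integrable_addR (isub _ yal) (isub _ ni).
  have e2 : \int[leb]_(r in `[s, t]) (y r * al r + n r) - y s * \int[leb]_(r in `[s, t]) al r
      <= \int[leb]_(r in `[s, t]) (eta * `|al r| + n r).
    have ysi := integrable_scaleR (y s) (isub _ ali).
    rewrite -RintegralZl//; last exact: isub.
    rewrite -RintegralB//; apply: le_Rintegral => //.
    - exact: integrable_subR.
    - move=> r /=; rewrite in_itv/= => /andP[sr rt].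
      have rab : a <= r <= b by rewrite (le_trans as_)// (le_trans rt).
      have rs : r - s <= r1 by rewrite (le_trans _ ts1)// lerD2r.
      have : `|y r - y s| <= eta by apply: h1 => //; rewrite ger0_norm ?subr_ge0.
      move=> /(ler_wpM2r (normr_ge0 (al r))).
      have := ler_norm ((y r - y s) * al r); rewrite normrM; clear; lra.
  have pt0 : 0 <= psi t by rewrite (le_trans (expR_ge0 _) (hpsi t tab)).
  have e3 : 0 <= \int[leb]_(r in `[s, t]) (eta * `|al r| + n r).
    apply: Rintegral_ge0 => x _; rewrite addr_ge0// mulr_ge0// ltW//.
  apply: (le_trans e1); apply: (le_trans (ler_wpM2l (expR_ge0 _) e2)).
  apply: (le_trans (ler_wpM2r e3 (hpsi t tab))).
  rewrite -RintegralZl// -RintegralZl//; last exact: isub.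
  rewrite -RintegralD//; [|exact: isub|by apply: integrable_scaleR; exact: isub].
  apply: le_Rintegral => //.
  - exact: integrable_scaleR.
  - by apply: integrable_addR; [exact: isub|apply: integrable_scaleR; exact: isub].
  - move=> r /=; rewrite in_itv/= => /andP[sr rt].
    have rab : a <= r <= b by rewrite (le_trans as_)// (le_trans rt).
    have k1 : psi t <= psi r + eta.
      have tr : t - r <= r2 by rewrite (le_trans _ ts2)// lerD2l lerN2.
      have : `|psi t - psi r| <= eta by apply: h2 => //; rewrite ger0_norm ?subr_ge0.
      by move=> /(le_trans (ler_norm _)); clear; lra.
    have k2 : psi t <= M by rewrite (le_trans (ler_norm _))// psiM.
    have k3 := ler_wpM2r (n0 r) k1.
    have k4 : psi t * (eta * `|al r|) <= M * (eta * `|al r|).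
      by rewrite ler_wpM2r// mulr_ge0// ltW.
    clear -k3 k4; lra.
rewrite /z /K Rintegral_itv1 subr0 /be Rintegral_itv1 expR0 mul1r => hz.
have := ler_wpM2r (y0 a) (hpsi a aab); clear -hz; lra.
Qed.

End real_analysis.

(** * Lebesgue integrals over translated windows *)

Section lebesgue_tools.
Context {R : realType}.
Local Notation leb := (@lebesgue_measure R).
Local Open Scope ereal_scope.

Let shift (s : R) : R -> measurableTypeR R := fun x => (x + s)%R.

Let shift_preimage (a b s : R) :
  shift s @^-1` `[(a + s)%R, (b + s)%R] = `[a, b]%classic.
Proof. by apply/seteqP; split => x /=; rewrite !in_itv/= /shift !lerD2r. Qed.

Let measurable_shift (s : R) : measurable_fun setT (shift s).
Proof. exact: measurable_funD. Qed.

Let lebesgue_measure_shift (s : R) (A : set R) : measurable A ->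
  pushforward leb (shift s) A = leb A.
Proof.
move=> mA; apply/esym; apply: lebesgue_measure_unique => //=.
  by move=> _; exact: measurable_shift.
move=> ? _ [[a b]] _ <-; rewrite /pushforward/=.
have -> : shift s @^-1` `]a, b] = `](a - s)%R, (b - s)%R]%classic.
  by apply/seteqP; split => x /=; rewrite !in_itv/= /shift ltrBlDr lerBrDr.
by rewrite !lebesgue_measure_itv/= !lte_fin ltrD2r -!EFinD opprB addrA subrK.
Qed.

Lemma ge0_integral_shift (f : R -> \bar R) (a b s : R) :
  measurable_fun setT f -> (forall x, 0 <= f x) ->
  \int[leb]_(x in `[(a + s)%R, (b + s)%R]) f x = \int[leb]_(x in `[a, b]) f (x + s)%R.
Proof.
move=> mf f0; rewrite -(shift_preimage a b s).
rewrite (_ : (fun x => f (x + s)%R) = f \o shift s)// -ge0_integral_pushforward//; last 2 first.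
- exact: measurable_shift.
- exact: measurable_funTS.
apply: eq_measure_integral => //=; first exact: measurable_shift.
by move=> ? A mA _; rewrite lebesgue_measure_shift.
Qed.

Lemma tonelli_on {d1 d2} {T1 : measurableType d1} {T2 : measurableType d2}
    (m1 : {sigma_finite_measure set T1 -> \bar R})
    (m2 : {sigma_finite_measure set T2 -> \bar R}) (D1 : set T1) (D2 : set T2)
    (f : T1 * T2 -> \bar R) : measurable D1 -> measurable D2 ->
  measurable_fun setT f -> (forall x, 0 <= f x) ->
  \int[m1]_(x in D1) \int[m2]_(y in D2) f (x, y) =
  \int[m2]_(y in D2) \int[m1]_(x in D1) f (x, y).
Proof.
move=> mD1 mD2 mf f0.
pose f' := f \_ (D1 `*` D2).
have mf' : measurable_fun setT f'.
  exact: ((measurable_restrictT f (measurableX mD1 mD2)).1 (measurable_funTS mf)).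
have f'0 x : 0 <= f' x by rewrite /f' /patch; case: ifPn.
have := @fubini_tonelli _ _ _ _ R m1 m2 f' mf' f'0.
rewrite (integral_mkcond D1) (integral_mkcond D2).
have -> : (fun x => \int[m2]_y f' (x, y)) = (fun x => \int[m2]_(y in D2) f (x, y)) \_ D1.
  apply/funext => x; rewrite /f' [in RHS]/patch; case: ifPn => xD1.
    rewrite [RHS]integral_mkcond; apply: eq_integral => y _; rewrite /patch.
    by rewrite in_setX/= xD1.
  by rewrite integral0_eq// => y _; rewrite /patch in_setX/= (negbTE xD1).
have -> // : (fun y => \int[m1]_x f' (x, y)) = (fun y => \int[m1]_(x in D1) f (x, y)) \_ D2.
apply/funext => y; rewrite /f' [in RHS]/patch; case: ifPn => yD2.
  rewrite [RHS]integral_mkcond; apply: eq_integral => x _; rewrite /patch.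
  by rewrite in_setX/= yD2 andbT.
by rewrite integral0_eq// => x _; rewrite /patch in_setX/= (negbTE yD2) andbF.
Qed.

Lemma measurable_partial_integral {d1 d2} {T1 : measurableType d1} {T2 : measurableType d2}
    (m2 : {sigma_finite_measure set T2 -> \bar R}) (D2 : set T2)
    (f : T1 * T2 -> \bar R) : measurable D2 ->
  measurable_fun setT f -> (forall x, 0 <= f x) ->
  measurable_fun setT (fun x => \int[m2]_(y in D2) f (x, y)).
Proof.
move=> mD2 mf f0.
pose f' := f \_ (setT `*` D2).
have mf' : measurable_fun setT f'.
  exact: ((measurable_restrictT f (measurableX measurableT mD2)).1 (measurable_funTS mf)).
have f'0 x : 0 <= f' x by rewrite /f' /patch; case: ifPn.
have := @measurable_fun_fubini_tonelli_F _ _ _ _ R m2 f' mf' f'0; rewrite /fubini_F.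
rewrite (_ : (fun x => \int[m2]_y f' (x, y)) = (fun x => \int[m2]_(y in D2) f (x, y)))//.
apply/funext => x; rewrite [RHS]integral_mkcond; apply: eq_integral => y _.
by rewrite /f' /patch in_setX/= in_setT.
Qed.

(** An inequality, so that [c] may lie on either side of [b]; this occurs when an orbit is shifted
    by a time of unknown sign. *)
Lemma ge0_integral_split (f : R -> \bar R) (a b c : R) :
  measurable_fun setT f -> (forall x, 0 <= f x) -> (a <= b)%R ->
  \int[leb]_(x in `[a, c]) f x <= \int[leb]_(x in `[a, b]) f x + \int[leb]_(x in `[b, c]) f x.
Proof.
move=> mf f0 ab.
have mD (D : set R) : measurable_fun D f by exact: measurable_funTS.
apply: (@le_trans _ _ (\int[leb]_(x in `[a, b] `|` `]b, c]) f x)).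
  apply: ge0_subset_integral => //; [exact: measurableU|exact: mD|].
  move=> x /=; rewrite !in_itv/= => /andP[ax xc].
  by case: (lerP x b) => xb; [left|right]; rewrite ?ax ?xb.
rewrite ge0_integral_setU//; [|exact: mD|].
  apply: leeD2l; apply: ge0_subset_integral => //; first exact: mD.
  by apply: subset_itv; rewrite bnd_simp.
apply/disj_set2P; rewrite -subset0 => x [].
rewrite /= !in_itv/= => /andP[_ xb] /andP[bx _].
by move: (le_lt_trans xb bx); rewrite ltxx.
Qed.

(* Each point of [`[a, b]] lies in the windows [`[r, r + m]] for a set of [r]
   of measure [m]. *)
Lemma sliding_window (la : R -> \bar R) (a b m : R) :
  measurable_fun setT la -> (forall x, 0 <= la x) -> (0 <= m)%R ->
  m%:E * \int[leb]_(x in `[a, b]) la x <=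
  \int[leb]_(r in `[(a - m)%R, b]) \int[leb]_(s in `[0%R, m]) la (r + s)%R.
Proof.
move=> mla la0 m0.
have -> : \int[leb]_(r in `[(a - m)%R, b]) \int[leb]_(s in `[0%R, m]) la (r + s)%R =
    \int[leb]_(s in `[0%R, m]) \int[leb]_(r in `[(a - m)%R, b]) la (r + s)%R.
  have T := @tonelli_on _ _ (measurableTypeR R) (measurableTypeR R) lebesgue_measure
    lebesgue_measure `[(a - m)%R, b] `[0%R, m] (fun p => la (p.1 + p.2)%R).
  apply: T => //; apply: (measurableT_comp mla); exact: measurable_funD.
have -> : m%:E * \int[leb]_(x in `[a, b]) la x =
    \int[leb]_(s in `[0%R, m]) (\int[leb]_(x in `[a, b]) la x).
  rewrite integral_cst//= lebesgue_measure_itv/= lte_fin muleC.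
  by case: ltgtP m0 => // [_|<-] _; rewrite ?oppr0 ?adde0 ?sube0.
apply: ge0_le_integral => //.
- by move=> x _; exact: integral_ge0.
- apply: measurable_funTS.
  have := @measurable_partial_integral _ _ (measurableTypeR R) (measurableTypeR R)
    lebesgue_measure `[(a - m)%R, b] (fun p => la (p.2 + p.1)%R) (measurable_itv _).
  by apply => //; apply: (measurableT_comp mla); exact: measurable_funD.
move=> s /=; rewrite in_itv/= => /andP[s0 sm].
(* For each [s] in [[0, m]] the translate [[a - m + s, b + s]] contains [[a, b]]. *)
rewrite -(ge0_integral_shift (a - m)%R b s mla la0).
apply: ge0_subset_integral => //; first exact: measurable_funTS.
by apply: subset_itv; rewrite bnd_simp//; lra.
Qed.

End lebesgue_tools.

(** * An ergodic upper bound *)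

Section maximal_ergodic.
Context {R : realType} {d : measure_display} {T : measurableType d}.
Variables (P : probability T R) (g : T -> T).
Hypotheses (mg : measurable_fun setT g)
  (Pg : forall E, measurable E -> P (g @^-1` E) = P E).

Lemma ge0_integral_preserved (f : T -> \bar R) (A : set T) : measurable A ->
  g @^-1` A = A -> measurable_fun setT f -> (forall x, 0 <= f x)%E ->
  (\int[P]_(w in A) f (g w) = \int[P]_(w in A) f w)%E.
Proof.
move=> mA gA mf f0; rewrite -{1}gA.
rewrite (_ : (fun w => f (g w)) = f \o g)// -ge0_integral_pushforward//; last first.
  exact: measurable_funTS.
by apply: eq_measure_integral => B mB _; exact: Pg.
Qed.

(** The recursive form lets the difference of [max_sum h n.+1] and [max_sum h n \o g] be computed by
    unfolding. *)
Fixpoint max_sum (h : T -> R) (n : nat) (w : T) : R :=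
  if n is n'.+1 then Num.max 0 (h w + max_sum h n' (g w)) else 0.

Let max_sum_ge0 h n w : 0 <= max_sum h n w.
Proof. by case: n => //= n; rewrite le_max lexx. Qed.

Let max_sumS h n w : max_sum h n w <= max_sum h n.+1 w.
Proof.
elim: n w => [|n IH] w; first exact: (max_sum_ge0 h 1).
by rewrite /= ge_max !le_max lexx/= lerD2l IH orbT.
Qed.

Let max_sum_mono h n m w : (n <= m)%N -> max_sum h n w <= max_sum h m w.
Proof.
move=> nm; have /nondecreasing_seqP/(_ _ _ nm) // := fun n => max_sumS h n w.
Qed.

Let max_sum_ge h n w : \sum_(i < n) h (iter i g w) <= max_sum h n w.
Proof.
elim: n w => [|n IH] w; first by rewrite big_ord0.
rewrite big_ord_recl/= le_max; apply/orP; right; rewrite lerD2l.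
by under eq_bigr do rewrite -iterS iterSr; exact: IH.
Qed.

Let max_sum_measurable h n : measurable_fun setT h -> measurable_fun setT (max_sum h n).
Proof.
move=> mh; elim: n => [|n IH]; first exact: measurable_cst.
apply: measurable_maxr; first exact: measurable_cst.
by apply: measurable_funD => //; exact: (measurableT_comp IH).
Qed.

Let max_sum_integrable h n : P.-integrable setT (EFin \o h) ->
  P.-integrable setT (EFin \o max_sum h n) /\
  P.-integrable setT (EFin \o (fun w => max_sum h n (g w))).
Proof.
move=> hi.
have mh : measurable_fun setT h by apply/measurable_EFinP; exact: measurable_int hi.
have comp k : P.-integrable setT (EFin \o max_sum h k) ->
    P.-integrable setT (EFin \o (fun w => max_sum h k (g w))).
  move=> /integrableP[_ fin]; apply/integrableP; split.
    by apply/measurable_EFinP; apply: (measurableT_comp (max_sum_measurable k mh)).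
  have := @ge0_integral_preserved (fun w => `|(max_sum h k w)%:E|%E) setT measurableT.
  rewrite preimage_setT => /(_ erefl) -> //.
  apply: measurableT_comp => //; apply/measurable_EFinP; exact: max_sum_measurable.
have iM : P.-integrable setT (EFin \o max_sum h n).
  elim: n => [|n /comp IH]; first exact: (finite_measure_integrable_cst _ 0 measurableT).
  have iN := integrableD measurableT (integrable_norm hi) IH.
  apply: (le_integrable measurableT _ _ iN).
    by apply/measurable_EFinP; exact: (max_sum_measurable n.+1).
  move=> w _ /=; rewrite lee_fin ger0_norm ?le_max ?lexx// ger0_norm ?addr_ge0//.
  by rewrite ge_max addr_ge0//= lerD2r ler_norm.
by split => //; exact: comp.
Qed.

(* With [M_n] the maximum of [0] and of the first [n] Birkhoff sums,
   [M_(n+1) - M_n \o g = max (- M_n \o g) h] has nonnegative integral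
   over the invariant set [A] and tends to [h] there. *)
Lemma maximal_ergodic (h : T -> R) (A : set T) :
  P.-integrable setT (EFin \o h) -> measurable A -> g @^-1` A = A ->
  (forall w, A w -> forall C, exists n, C <= \sum_(i < n) h (iter i g w)) ->
  (0 <= \int[P]_(w in A) (h w)%:E)%E.
Proof.
move=> hi mA gA hA.
have mh : measurable_fun setT h by apply/measurable_EFinP; exact: measurable_int hi.
pose D n w := max_sum h n.+1 w - max_sum h n (g w).
have DE n w : D n w = Num.max (- max_sum h n (g w)) (h w).
  by rewrite /D/= addr_maxl sub0r addrK.
have mD n : measurable_fun setT (D n).
  apply: measurable_funB; first exact: max_sum_measurable.
  exact: (measurableT_comp (max_sum_measurable n mh)).
have iA f : P.-integrable setT f -> P.-integrable A f.
  by apply: integrableS.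
(* Invariance of [A] and of [P] removes [g] from the second integral; monotonicity in [n] does the
   rest. *)
have D0 n : (0 <= \int[P]_(w in A) (D n w)%:E)%E.
  have [iM iMg] := max_sum_integrable n hi; have [iM1 _] := max_sum_integrable n.+1 hi.
  have -> : (\int[P]_(w in A) (D n w)%:E =
     \int[P]_(w in A) (max_sum h n.+1 w)%:E - \int[P]_(w in A) (max_sum h n (g w))%:E)%E.
    by have <- := integralB mA (iA _ iM1) (iA _ iMg).
  have -> : (\int[P]_(w in A) (max_sum h n (g w))%:E = \int[P]_(w in A) (max_sum h n w)%:E)%E.
    apply: (@ge0_integral_preserved (fun w => (max_sum h n w)%:E)) => //.
      by apply/measurable_EFinP; exact: max_sum_measurable.
    by move=> x; rewrite lee_fin.
  rewrite sube_ge0.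
    apply: ge0_le_integral => //.
    - by move=> x _; rewrite lee_fin.
    - by apply/measurable_funTS/measurable_EFinP; exact: max_sum_measurable.
    - by apply/measurable_funTS/measurable_EFinP; exact: (max_sum_measurable n.+1).
    - by move=> x _; rewrite lee_fin.
  by apply/orP; left; apply: integrable_fin_num => //; exact: iA.
have mD' n : measurable_fun A (fun w => (D n w)%:E).
  by apply/measurable_funTS/measurable_EFinP.
have mh' : measurable_fun A (fun w => (h w)%:E).
  by apply/measurable_funTS/measurable_EFinP.
have cD : {ae P, forall w, A w -> (D n w)%:E @[n --> \oo] --> (h w)%:E}.
  apply: aeW => w Aw.
  have Agw : A (g w) by rewrite -gA in Aw.
  (* Some Birkhoff sum started at [g w] exceeds [- h w]; from that index on, the maximum in [DE]
     equals [h w]. *)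
  have [n hn] := hA _ Agw (- h w).
  apply: cvg_near_cst; exists n => // k /= nk; rewrite DE; congr (_%:E); apply/max_idPr.
  rewrite lerNl (le_trans hn)// (le_trans (max_sum_ge _ _ _))//.
  exact: max_sum_mono.
have bD : {ae P, forall w n, A w -> (`|(D n w)%:E| <= `|h w|%:E)%E}.
  apply: aeW => w n Aw; rewrite DE lee_fin ler_norml; apply/andP; split.
    by rewrite le_max; apply/orP; right; rewrite lerNl -normrN ler_norm.
  by rewrite ge_max ler_norm andbT (le_trans _ (normr_ge0 _))// oppr_le0.
have [_ _ cv] := dominated_convergence mA mD' mh' cD (iA _ (integrable_norm hi)) bD.
have <- := cvg_lim _ cv => //.
by apply: lime_ge; [apply/cvg_ex; eexists; exact: cv|exact: nearW].
Qed.

End maximal_ergodic.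

(** * Integrals along the orbits of the flow *)

Section flow.
Context {R : realType} {d : measure_display} {Omega : measurableType d}.
Context {P : probability Omega R} {theta : R -> Omega -> Omega}.
Hypothesis hmds : ergodic_mds P theta.
Local Notation leb := (@lebesgue_measure R).

Lemma measurable_flow t : measurable_fun setT (theta t).
Proof.
have := measurableT_comp (mds_measurable hmds) (measurable_fun_pair (measurable_cst t) (@measurable_id _ Omega setT)).
exact.
Qed.

Lemma measurable_orbit {d'} {T : measurableType d'} (f : Omega -> T) w :
  measurable_fun setT f -> measurable_fun setT (fun r => f (theta r w)).
Proof.
move=> mf; apply: (measurableT_comp mf).
exact: (measurableT_comp (mds_measurable hmds) (measurable_fun_pair (@measurable_id _ R setT) (measurable_cst w))).
Qed.

Lemma integral_flow (f : Omega -> \bar R) t : measurable_fun setT f ->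
  (forall x, 0 <= f x)%E -> (\int[P]_w f (theta t w) = \int[P]_w f w)%E.
Proof.
move=> mf f0; apply: (ge0_integral_preserved (measurable_flow t)) => //.
exact: (mds_invariant hmds t).
Qed.

Definition orbit_integral (f : Omega -> \bar R) (a b : R) (w : Omega) : \bar R :=
  (\int[leb]_(r in `[a, b]) f (theta r w))%E.

Lemma measurable_joint_flow (f : Omega -> \bar R) : measurable_fun setT f ->
  measurable_fun setT (fun p : Omega * R => f (theta p.2 p.1)).
Proof.
move=> mf; apply: (measurableT_comp mf).
exact: (measurableT_comp (mds_measurable hmds) (measurable_fun_pair measurable_snd measurable_fst)).
Qed.

Section orbit_integral.
Variable f : Omega -> \bar R.
Hypotheses (mf : measurable_fun setT f) (f0 : forall w, (0 <= f w)%E).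
Local Notation I := (orbit_integral f).
Local Open Scope ereal_scope.

Lemma orbit_integral_ge0 a b w : 0 <= I a b w.
Proof. exact: integral_ge0. Qed.

Lemma measurable_orbit_integral a b : measurable_fun setT (I a b).
Proof.
have := @measurable_partial_integral R _ _ Omega (measurableTypeR R) lebesgue_measure
  `[a, b] (fun p => f (theta p.2 p.1)) (measurable_itv _) (measurable_joint_flow mf).
exact.
Qed.

Lemma orbit_integral_shift a b s w : I a b (theta s w) = I (a + s)%R (b + s)%R w.
Proof.
rewrite /orbit_integral (ge0_integral_shift _ _ _ (measurable_orbit w mf))//.
by apply: eq_integral => r _; rewrite (mds_add hmds).
Qed.

Lemma orbit_integral_mono a b a' b' w : (a' <= a)%R -> (b <= b')%R -> I a b w <= I a' b' w.
Proof.
move=> aa bb; apply: ge0_subset_integral => //.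
  by apply: measurable_funTS; exact: measurable_orbit.
by apply: subset_itv; rewrite bnd_simp.
Qed.

Lemma orbit_integral_split a b c w : (a <= b)%R -> I a c w <= I a b w + I b c w.
Proof. by move=> ab; apply: ge0_integral_split => //; exact: measurable_orbit. Qed.

Lemma mean_orbit_integral a b : (a <= b)%R ->
  \int[P]_w I a b w = (b - a)%:E * \int[P]_w f w.
Proof.
move=> ab.
have T := @tonelli_on R _ _ Omega (measurableTypeR R) P
    lebesgue_measure setT `[a, b] (fun p => f (theta p.2 p.1)).
rewrite [LHS]T//; last exact: measurable_joint_flow.
under eq_integral do rewrite integral_flow//.
rewrite integral_cst//= lebesgue_measure_itv/= lte_fin muleC.
by move: ab; rewrite le_eqVlt => /orP[/eqP->|->]//; rewrite ltxx subrr.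
Qed.

End orbit_integral.

(* Off the null set where some orbit integral is infinite, the set [A] where
   the averages exceed [kappa] by an unbounded amount is invariant under the
   whole flow, so by ergodicity and the maximal theorem it is null. *)
Lemma ergodic_upper_bound (f : Omega -> \bar R) (kappa : R) :
  measurable_fun setT f -> (forall w, 0 <= f w)%E -> (\int[P]_w f w < kappa%:E)%E ->
  forall eps, 0 < eps -> exists2 C : R,
    measurable [set w | forall n : nat, (orbit_integral f (- n%:R) 0 w <= (kappa * n%:R + C)%:E)%E] &
    (P (~` [set w | forall n : nat, (orbit_integral f (- n%:R) 0 w <= (kappa * n%:R + C)%:E)%E])
      <= eps%:E)%E.
Proof.
move=> mf f0 fk eps eps0.
set I := orbit_integral f.
have mI a b : measurable_fun setT (I a b) by exact: measurable_orbit_integral.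
have I0 a b w : (0 <= I a b w)%E by exact: orbit_integral_ge0.
have fin_f : (\int[P]_w f w)%E \is a fin_num.
  by rewrite ge0_fin_numE ?integral_ge0// (lt_trans fk) ?ltry.
have Iint a b : a <= b -> P.-integrable setT (I a b).
  move=> ab; apply/integrableP; split => //.
  under eq_integral do rewrite gee0_abs//.
  by rewrite (mean_orbit_integral mf f0 ab) -(fineK fin_f) -EFinM ltry.
pose fin w := forall n : nat, I (- n%:R) n%:R w \is a fin_num.
have finI w a b : fin w -> I a b w \is a fin_num.
  move=> hw; have [n [na nb]] : exists n : nat, - n%:R <= a /\ b <= n%:R.
    have [n _ hn] := nbhs_infty_ger (`|a| + `|b|).
    have := hn n (leqnn n) => /= h; exists n.
    have := ler_norm b; have := ler_norm (- a); rewrite normrN.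
    by have := normr_ge0 a; have := normr_ge0 b; split; lra.
  rewrite ge0_fin_numE//; apply: (le_lt_trans (orbit_integral_mono mf f0 w na nb)).
  by rewrite -ge0_fin_numE//; exact: hw.
(* The excess of a unit backward window: its Birkhoff sums under [theta (-1)] dominate [s' n], and
   its mean is negative. *)
pose h w := fine (I (-1) 0 w) - kappa.
have hint : P.-integrable setT (EFin \o h).
  have N1 : -1 <= 0 :> R by rewrite lerN10.
  have i1 : P.-integrable setT (EFin \o (fine \o I (-1) 0)).
    apply: (le_integrable measurableT _ _ (Iint _ _ N1)).
      by apply/measurable_EFinP; apply: measurableT_comp.
    move=> w _ /=; rewrite ger0_norm ?fine_ge0// gee0_abs//.
    by case: (I _ _ w) (I0 (-1) 0 w) => //= *; rewrite ?leey.
  by have := integrableB measurableT i1 (finite_measure_integrable_cst P kappa measurableT).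
have hneg : (\int[P]_w (h w)%:E < 0)%E.
  have N1 : -1 <= 0 :> R by rewrite lerN10.
  have i1 : P.-integrable setT (EFin \o (fine \o I (-1) 0)).
    apply: (le_integrable measurableT _ _ (Iint _ _ N1)).
      by apply/measurable_EFinP; apply: measurableT_comp.
    move=> w _ /=; rewrite ger0_norm ?fine_ge0// gee0_abs//.
    by case: (I _ _ w) (I0 (-1) 0 w) => //= *; rewrite ?leey.
  have -> := integralB measurableT i1 (finite_measure_integrable_cst P kappa measurableT).
  rewrite [X in (_ - X)%E](_ : _ = kappa%:E); last first.
    by apply: (etrans (integral_cst P measurableT kappa%:E)); rewrite [X in (_ * X)%E](_ : _ = 1%E) ?mule1//; exact: probability_setT.
  rewrite sube_lt0; last by rewrite orbT.
  apply: le_lt_trans fk; have := mean_orbit_integral mf f0 N1.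
  rewrite sub0r opprK mul1e => <-; apply: ge0_le_integral => //.
  - by move=> w _ /=; rewrite lee_fin fine_ge0.
  - by apply/measurable_EFinP; apply: measurableT_comp.
  - move=> w _ /=; rewrite -/I.
    by case: (I _ _ w) (I0 (-1) 0 w) => //= *; rewrite ?leey ?lexx.
pose s' n w := fine (I (- n%:R) 0 w) - kappa * n%:R.
pose A := [set w | fin w /\ forall C : nat, exists n, C%:R <= s' n w].
have ms' n : measurable_fun setT (s' n).
  by apply: measurable_funB => //; apply: measurableT_comp.
have mA : measurable A.
  rewrite (_ : A = (\bigcap_n [set w | I (- n%:R) n%:R w \is a fin_num]) `&`
      \bigcap_C \bigcup_n [set w | C%:R <= s' n w]).
    apply: measurableI.
      apply: bigcapT_measurable => n; rewrite -[X in measurable X]setTI.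
      exact: emeasurable_fin_num.
    apply: bigcapT_measurable => C; apply: bigcupT_measurable => n.
    by rewrite -preimage_itvcy -[X in measurable X]setTI; exact: ms'.
  apply/seteqP; split => w /=.
    by move=> [hf hC]; split => [n _|C _]; [exact: hf|have [n hn] := hC C; exists n].
  move=> [hf hC]; split => [n|C]; first exact: hf.
  by have [n _ hn] := hC C Logic.I; exists n.
have Ainv s w : A w -> A (theta s w).
  move=> [hf hC].
  have hfs : fin (theta s w).
    by move=> n; rewrite /I (orbit_integral_shift mf f0); exact: finI.
  split=> // C.
  have [j hj] : exists j : nat, `|s| <= j%:R.
    by have [j _ hj] := nbhs_infty_ger `|s|; exists j; exact: (hj j (leqnn j)).
  (* The shift by [s] moves the window by at most [j]; [C'] pays in advance for the additional
     [kappa * j] and for the integral over [[-j, j]]. *)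
  have [C' hC'] : exists C' : nat, C%:R + kappa * j%:R + fine (I (- j%:R) j%:R w) <= C'%:R.
    have [C' _ hC'] := nbhs_infty_ger (C%:R + kappa * j%:R + fine (I (- j%:R) j%:R w)).
    by exists C'; exact: (hC' C' (leqnn C')).
  have [n hn] := hC C'; exists (n + j)%N; rewrite /s'.
  have sj := ler_norm s; have sNj := ler_norm (- s); rewrite normrN in sNj.
  have n0 : 0 <= n%:R :> R by [].
  have key : (I (- n%:R)%R 0%R w <= I (- (n + j)%:R)%R 0%R (theta s w) + I (- j%:R)%R j%:R%R w)%E.
    rewrite /I (orbit_integral_shift mf f0) add0r natrD.
    apply: (@le_trans _ _ (I (- (n%:R + j%:R) + s)%R 0%R w)).
      by apply: orbit_integral_mono => //; lra.
    apply: (le_trans (orbit_integral_split mf f0 (b := s) _ _ _)); first by lra.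
    by apply: leeD2l; apply: orbit_integral_mono => //; lra.
  have f1 := fineK (finI w (- n%:R) 0 hf).
  have f2 := fineK (finI w (- j%:R) j%:R hf).
  have f3 := fineK (finI (theta s w) (- (n + j)%:R) 0 hfs).
  move: key; rewrite -f1 -f2 -f3 -EFinD lee_fin.
  have Enj : kappa * (n + j)%:R = kappa * n%:R + kappa * j%:R by rewrite natrD mulrDr.
  move: hC' hn; rewrite /s' Enj.
  set p := fine _; set q := fine _; set r := fine _; clear -hmds; rewrite /=; lra.
have Aflow s : theta s @^-1` A = A.
  apply/seteqP; split => w; last exact: Ainv.
  move=> /(Ainv (- s)); rewrite -(mds_add hmds) addNr (mds_0 hmds); exact.
have iterE i w : iter i (theta (-1)) w = theta (- i%:R) w.
  elim: i => [|i IH]; first by rewrite oppr0 (mds_0 hmds).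
  by rewrite iterS IH -(mds_add hmds) -opprD -natr1 addrC.
have sum_ge n w : fin w -> s' n w <= \sum_(i < n) h (iter i (theta (-1)) w).
  move=> hw; elim: n => [|n IH].
    rewrite big_ord0 /s' mulr0 subr0 oppr0 /I /orbit_integral set_itv1 integral_set1//.
  rewrite big_ord_recr/=; apply: le_trans (lerD IH (lexx _)).
  rewrite /h iterE /I (orbit_integral_shift mf f0) add0r.
  have key := orbit_integral_split mf f0 (a := - n.+1%:R) (b := - n%:R) 0 w _.
  have : - n.+1%:R <= - n%:R :> R by rewrite lerN2 ler_nat.
  move=> {}/key; rewrite -/I.
  have f1 := fineK (finI w (- n.+1%:R) 0 hw).
  have f2 := fineK (finI w (- n.+1%:R) (- n%:R) hw).
  have f3 := fineK (finI w (- n%:R) 0 hw).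
  rewrite -f1 -f2 -f3 -EFinD lee_fin /s'.
  rewrite (_ : -1 - n%:R = - n.+1%:R :> R); last by rewrite -natr1; ring.
  have Enj : kappa * n.+1%:R = kappa * n%:R + kappa by rewrite -natr1 mulrDr mulr1.
  rewrite Enj; set p := fine _; set q := fine _; set r := fine _.
  rewrite /=; clear -hmds; lra.
(* If [A] had measure [1], the maximal theorem would make the mean of [h] nonnegative, against
   [hneg]. *)
have PA0 : P A = 0%E.
  have [//|PA1] := mds_ergodic hmds mA Aflow.
  have PAC : P (~` A) = 0%E by rewrite probability_setC// PA1 subee.
  have : (0 <= \int[P]_(w in A) (h w)%:E)%E.
    apply: (maximal_ergodic (measurable_flow (-1)) (mds_invariant hmds (-1)) hint mA (Aflow _)).
    move=> w [hf hC] C.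
    have [C' _ hC'] := nbhs_infty_ger C.
    have [n hn] := hC C'; exists n; apply: le_trans (sum_ge n w hf).
    by apply: le_trans hn; exact: (hC' C' (leqnn C')).
  have := negligible_integral (measurableC mA) measurableT hint PAC.
  by rewrite setTD setCK => <-; rewrite leNgt hneg.
pose G C := [set w | forall n : nat, (I (- n%:R)%R 0%R w <= (kappa * n%:R + C)%:E)%E].
have mG C : measurable (G C).
  rewrite (_ : G C = \bigcap_n [set w | (I (- n%:R)%R 0%R w <= (kappa * n%:R + C)%:E)%E]).
    apply: bigcapT_measurable => n; rewrite -[X in measurable X]setTI.
    exact: emeasurable_fun_infty_c.
  by apply/seteqP; split => [w hw n _|w hw n]; [exact: hw|exact: (hw n Logic.I)].
have finae : {ae P, forall w, fin w}.
  apply: ae_foralln => n.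
  have n0 : - n%:R <= n%:R :> R by rewrite ge0_cp.
  by have := integrable_ae measurableT (Iint _ _ n0); apply: filterS => w; exact.
(* A point outside every [G C] has an infinite orbit integral or lies in [A]; continuity from above
   then provides [C]. *)
have P0 : P (\bigcap_(C : nat) ~` G C%:R) = 0%E.
  apply/negligibleP; first by apply: bigcapT_measurable => C; exact: measurableC.
  have : P.-negligible (~` fin `|` A).
    by apply: negligibleU => //; apply/negligibleP.
  apply: negligibleS => w hw; have [hf|] := pselect (fin w); [right|by left].
  split => // C; have /existsNP[n /negP] := hw C Logic.I.
  rewrite -ltNge => hn; exists n; rewrite /s' lerBrDl ltW//.
  by rewrite -lte_fin fineK//; exact: finI.
have : P (~` G C%:R) @[C --> \oo] --> 0%E.
  rewrite -P0; apply: nonincreasing_cvg_mu.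
  - by rewrite (le_lt_trans (probability_le1 _ _))// ?ltry//; exact: measurableC.
  - by move=> C; exact: measurableC.
  - by apply: bigcapT_measurable => C; exact: measurableC.
  - move=> n k nk; apply/subsetPset/subsetC => w hw i; apply: (le_trans (hw i)).
    by rewrite lee_fin lerD2l ler_nat.
move=> /fine_cvgP[_ /cvgrPdist_le/(_ _ eps0)[C _ hC]].
exists C%:R; first exact: mG.
have := hC C (leqnn C) => /=; rewrite sub0r normrN ger0_norm ?fine_ge0//.
rewrite -lee_fin fineK//; apply: fin_num_measure; apply: measurableC; exact: mG.
Qed.

End flow.

(** * The energy inequality *)

Section Rintegral_ae.
Context {R : realType}.
Local Notation leb := (@lebesgue_measure R).

Lemma within_continuous_comp {X Y Z : topologicalType} (D : set X) (f : Y -> Z)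
    (u : X -> Y) : continuous f -> {within D, continuous u} ->
  {within D, continuous (fun t => f (u t))}.
Proof.
move=> fc /subspace_continuousP uc; apply/subspace_continuousP => x Dx.
exact: (cvg_comp _ _ (uc x Dx) (fc (u x))).
Qed.

Lemma measurable_sqrt {d} {T : measurableType d} (D : set T) (f : T -> R) :
  measurable_fun D f -> measurable_fun D (fun t => Num.sqrt (f t)).
Proof.
move=> mf; apply: (measurableT_comp _ mf).
by apply: continuous_measurable_fun; exact: sqrt_continuous.
Qed.

Lemma ae_le_Rintegral (f1 f2 : R -> R) a b :
  leb.-integrable `[a, b] (EFin \o f1) -> leb.-integrable `[a, b] (EFin \o f2) ->
  {ae leb, forall x, a <= x <= b -> f1 x <= f2 x} ->
  \int[leb]_(x in `[a, b]) f1 x <= \int[leb]_(x in `[a, b]) f2 x.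
Proof.
move=> i1 i2 [N [mN N0 hN]].
have E f : leb.-integrable `[a, b] (EFin \o f) ->
    \int[leb]_(x in `[a, b]) f x = \int[leb]_(x in `[a, b] `\` N) f x.
  by move=> fi; rewrite /Rintegral; congr fine; apply: negligible_integral.
rewrite !E//; apply: le_Rintegral => //.
- exact: measurableD.
- by apply: integrableS i1 => //; exact: measurableD.
- by apply: integrableS i2 => //; exact: measurableD.
move=> x [/= xab Nx]; apply: contrapT => h; apply: Nx; apply: hN => /= /(_ _)h'.
by apply: h; apply: h'; move: xab; rewrite in_itv.
Qed.

End Rintegral_ae.

Section energy.
Context {R : realType} {H V : completeNormedModType R}.
Context {dot : {dot H for idfun}} {emb : {linear V -> H}} {A S : operator H}.
Hypothesis hr : rigged dot emb A S.
Local Notation J := (resolvent dot emb S).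
Local Notation leb := (@lebesgue_measure R).

(** [resolvent_dist] in the limit of the larger index. *)
Lemma resolvent_defect n x : `|x - J n (emb x)| ^+ 2 <= `|x| ^+ 2 - `|J n (emb x)| ^+ 2.
Proof.
have cv := resolvent_cvgV hr (x := x).
apply: (ler_cvg_to (a := \oo) (f := fun m => `|J m (emb x) - J n (emb x)| ^+ 2)
  (g := fun m => `|J m (emb x)| ^+ 2 - `|J n (emb x)| ^+ 2)).
- rewrite !expr2; apply: cvgM; apply: cvg_norm; apply: cvgB => //; exact: cvg_cst.
- apply: cvgB; last exact: cvg_cst.
  by rewrite !expr2; apply: cvgM; apply: cvg_norm.
- by exists n => // m /= nm; exact: (resolvent_dist hr).
Qed.

(* The chain rule for [|u|^2] is approximated by the one for [(u, J_n u)]: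
   as [J_n u] is continuous with values in [V], the increments of [u] can be
   tested against it. *)
Lemma energy_inequality (u : R -> H) (v : R -> V) (g : R -> V -> R)
    (dn kr : R -> R) a b : a <= b ->
  {within `[a, b], continuous u} ->
  (forall t, a <= t <= b -> emb (v t) = u t) ->
  leb.-integrable `[a, b] (EFin \o (fun t => `|v t| ^+ 2)) ->
  (forall x, leb.-integrable `[a, b] (EFin \o (fun t => g t x))) ->
  (forall x s t, a <= s -> s <= t -> t <= b ->
     dot (u t) (emb x) - dot (u s) (emb x) = \int[leb]_(r in `[s, t]) g r x) ->
  measurable_fun `[a, b] dn -> (forall t, 0 <= dn t) ->
  leb.-integrable `[a, b] (EFin \o (fun t => dn t ^+ 2)) ->
  leb.-integrable `[a, b] (EFin \o kr) ->
  {ae leb, forall t, a <= t <= b -> forall x, g t x <= kr t + dn t * `|x - v t|} ->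
  `|u b| ^+ 2 - `|u a| ^+ 2 <= \int[leb]_(t in `[a, b]) (2 * kr t).
Proof.
move=> ab uc vu vi gi ug mdn dn0 dni kri hg.
have aab : a <= a <= b by rewrite lexx.
have bab : a <= b <= b by rewrite lexx ab.
have Juc n : {within `[a, b], continuous (fun t => J n (u t))}.
  by apply: within_continuous_comp => //; exact: (resolvent_continuous hr).
have mJu n : measurable_fun `[a, b] (fun t => `|J n (u t)| ^+ 2).
  apply: measurable_funX; apply: subspace_continuous_measurable_fun => //.
  by apply: (@within_continuous_comp R V R `[a, b] (fun x => `|x|) (fun t => J n (u t))) => // x;
    exact: norm_continuous.
have mv : measurable_fun `[a, b] (fun t => `|v t| ^+ 2).
  by apply/measurable_EFinP; exact: measurable_int vi.
(* Dominates the V-distance from [v t] to [J n (u t)] by [resolvent_defect], and tends to [0] with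
   [n]; its measurability reduces to that of two real functions. *)
pose e n t := Num.sqrt (`|v t| ^+ 2 - `|J n (u t)| ^+ 2).
have me n : measurable_fun `[a, b] (e n).
  by apply: measurable_sqrt; exact: measurable_funB.
have ev n t : e n t <= `|v t|.
  rewrite -[leRHS]ger0_norm// -sqrtr_sqr ler_wsqrtr// gerBl sqr_ge0//.
have bi : leb.-integrable `[a, b] (EFin \o (fun t => dn t ^+ 2 + `|v t| ^+ 2)).
  exact: integrable_addR.
have dnb t y : 0 <= y -> y <= `|v t| -> `|dn t * y| <= `|dn t ^+ 2 + `|v t| ^+ 2|.
  move=> y0 yv; rewrite !ger0_norm ?mulr_ge0 ?addr_ge0 ?sqr_ge0//.
  have h1 := sqr_ge0 (dn t - y).
  have h2 : y ^+ 2 <= `|v t| ^+ 2 by rewrite ler_pXn2r ?nnegrE.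
  have := sqr_ge0 (dn t); have := sqr_ge0 y; have := dn0 t; clear -hr h1 h2; nra.
have dei n : leb.-integrable `[a, b] (EFin \o (fun t => dn t * e n t)).
  apply: (le_integrable _ _ _ bi) => //.
    by apply/measurable_EFinP; exact: (measurable_funM mdn (me n)).
  by move=> t _ /=; rewrite lee_fin dnb// sqrtr_ge0.
have dni1 : leb.-integrable `[a, b] (EFin \o dn).
  have ci : leb.-integrable `[a, b] (EFin \o (fun t => dn t ^+ 2 + 1)).
    apply: integrable_addR => //.
    by apply: continuous_compact_integrable; [exact: segment_compact|apply: continuous_subspaceT => ?; exact: cst_continuous].
  apply: (le_integrable _ _ _ ci) => //; first exact/measurable_EFinP.
  move=> t _ /=; rewrite lee_fin !ger0_norm ?addr_ge0 ?sqr_ge0//.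
  have := sqr_ge0 (dn t - 1); have := dn0 t; clear -hr; nra.
pose z n t := dot (u t) (emb (J n (u t))).
have step n : z n b - z n a <=
    \int[leb]_(t in `[a, b]) (2 * kr t + 2 * (dn t * e n t)).
  pose K t := \int[leb]_(r in `[a, t]) (2 * kr r + 2 * (dn r * e n r)).
  pose M t := \int[leb]_(r in `[a, t]) (2 * dn r).
  have Ki : leb.-integrable `[a, b] (EFin \o (fun r => 2 * kr r + 2 * (dn r * e n r))).
    by apply: integrable_addR; exact: integrable_scaleR.
  have Mi : leb.-integrable `[a, b] (EFin \o (fun r => 2 * dn r)).
    exact: integrable_scaleR.
  rewrite [leRHS](_ : _ = K b - K a); last by rewrite /K Rintegral_itv1 subr0.
  apply: (increment_le (z := z n) (K := K) (M := M)) => // eta eta0.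
  have [rho rho0 hrho] := within_uniform (Juc n) eta0.
  exists rho => // s t as_ st tb tsrho.
  have sab : a <= s <= b by rewrite as_ (le_trans st).
  have tab : a <= t <= b by rewrite tb (le_trans as_).
  rewrite (Rintegral_increment as_ st tb Ki) (Rintegral_increment as_ st tb Mi).
  have isub f : leb.-integrable `[a, b] (EFin \o f) -> leb.-integrable `[s, t] (EFin \o f).
    exact: integrable_sub.
  (* By symmetry of [J n], the right side exceeds the left by [dot h (emb (J n h))] with
     [h = u t - u s], which is nonnegative. *)
  have h1 : z n t - z n s <= 2 * (dot (u t) (emb (J n (u t))) - dot (u s) (emb (J n (u t)))).
    have := resolvent_pos hr n (u t - u s).
    rewrite (resolventB hr) linearB.
    rewrite dotBl !dotBr /z (resolvent_sym hr n (u t) (u s)); clear -hr; lra.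
  apply: (le_trans h1); rewrite (ug _ _ _ as_ st tb).
  rewrite -RintegralZl//; last exact: isub.
  rewrite -RintegralZl//; last exact: isub.
  rewrite -RintegralD//; [|exact: isub|by apply: integrable_scaleR; exact: isub].
  apply: ae_le_Rintegral.
  - by apply: integrable_scaleR; exact: isub.
  - by apply: integrable_addR; [exact: isub|apply: integrable_scaleR; exact: isub].
  move: hg; apply: (@filterS _ _ (ae_filter_ringOfSetsType lebesgue_measure)) => r hgr /andP[sr rt].
  have rab : a <= r <= b by rewrite (le_trans as_)// (le_trans rt).
  have h2 := hgr rab (J n (u t)).
  have h3 : `|J n (u t) - J n (u r)| <= eta.
    apply: hrho => //; rewrite ger0_norm ?subr_ge0//.
    by rewrite (le_trans _ tsrho)// lerD2l lerN2.
  have h4 : `|J n (u r) - v r| <= e n r.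
    rewrite -[leLHS]ger0_norm// -sqrtr_sqr ler_wsqrtr// -(vu _ rab) distrC.
    exact: resolvent_defect.
  (* Uniform continuity moves the test vector from time [t] to time [r], and the defect moves it
     from [J n (u r)] to [v r]. *)
  have h5 : `|J n (u t) - v r| <= eta + e n r.
    by rewrite -(subrKA (J n (u r))) (le_trans (ler_normD _ _))// lerD.
  have h6 := ler_wpM2l (dn0 r) h5.
  by move: h2 h6; set x := dn r * _; clear -hr; lra.
have zb : forall n, z n b - z n a <= \int[leb]_(t in `[a, b]) (2 * kr t) +
    2 * \int[leb]_(t in `[a, b]) (dn t * e n t).
  move=> n; apply: (le_trans (step n)).
  rewrite RintegralD//; [|exact: integrable_scaleR|exact: integrable_scaleR].
  by rewrite [X in _ + X <= _]RintegralZl.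
have zc t : a <= t <= b -> z n t @[n --> \oo] --> `|u t| ^+ 2.
  move=> tab; rewrite -(dotxx hr); apply/cvgrPdist_le => eps eps0.
  have d0 : 0 < eps / (`|u t| + 1) by rewrite divr_gt0// ltr_wpDl.
  have /cvgrPdist_le/(_ _ d0)[N _ hN] := resolvent_cvgH hr (h := u t).
  exists N => // n Nn; rewrite /z.
  have -> : dot (u t) (u t) - dot (u t) (emb (J n (u t))) = dot (u t) (u t - emb (J n (u t))).
    by rewrite dotBr.
  apply: (le_trans (dot_schwarz hr _ _)).
  have := hN n Nn; rewrite /= ler_pdivlMr ?ltr_wpDl// => h.
  apply: le_trans h; rewrite mulrC ler_wpM2l// lerDl//.
have ec : \int[leb]_(t in `[a, b]) (dn t * e n t) @[n --> \oo] --> (0 : R).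
  have m1 n : measurable_fun `[a, b] (fun t => (dn t * e n t)%:E).
    by apply/measurable_EFinP; exact: (measurable_funM mdn (me n)).
  have m0 : measurable_fun (`[a, b] : set R) (fun=> 0%E : \bar R) by exact: measurable_cst.
  have c1 : {ae leb, forall t, `[a, b]%classic t -> (dn t * e n t)%:E @[n --> \oo] --> 0%E}.
    apply: aeW => t tab; have tab' : a <= t <= b by move: tab; rewrite /= in_itv.
    apply/cvg_EFin; first exact: nearW.
    rewrite -(mulr0 (dn t)); apply: cvgM; first exact: cvg_cst.
    rewrite /e -[X in _ --> X](sqrtr0 R).
    apply: (cvg_comp _ Num.sqrt); last exact: sqrt_continuous.
    rewrite -(subrr (`|v t| ^+ 2)); apply: cvgB; first exact: cvg_cst.
    by rewrite -(vu _ tab') !expr2; apply: cvgM; apply: cvg_norm; exact: (resolvent_cvgV hr).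
  have b1 : {ae leb, forall t n, `[a, b]%classic t ->
      (`|(dn t * e n t)%:E| <= (dn t ^+ 2 + `|v t| ^+ 2)%:E)%E}.
    apply: aeW => t n tab /=; rewrite lee_fin (le_trans (dnb _ _ _ (ev n t)))// ?sqrtr_ge0//.
    by rewrite ger0_norm// addr_ge0// sqr_ge0.
  have [_ _] := @dominated_convergence _ _ R lebesgue_measure `[a, b] (measurable_itv _) _ _ _
    m1 m0 c1 bi b1.
  by rewrite integral0 => /fine_cvgP[_].
apply: (ler_cvg_to (a := \oo) (f := fun n => z n b - z n a)
  (g := fun n => \int[leb]_(t in `[a, b]) (2 * kr t) + 2 * \int[leb]_(t in `[a, b]) (dn t * e n t))).
- by apply: cvgB; exact: zc.
- rewrite -[X in _ --> X]addr0; apply: cvgD; first exact: cvg_cst.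
  by rewrite -(mulr0 2); apply: cvgM => //; exact: cvg_cst.
- exact: nearW.
Qed.

End energy.

(** * Local integrability and dual norms *)

Section local_integrability.
Context {R : realType}.
Local Notation leb := (@lebesgue_measure R).

Lemma sqrD_le (p q : R) : (p + q) ^+ 2 <= 2 * (p ^+ 2 + q ^+ 2).
Proof. by have := sqr_ge0 (p - q); lra. Qed.

Lemma mulr_le_sqrD (p q : R) : p * q <= p ^+ 2 + q ^+ 2.
Proof. by have := sqr_ge0 (p - q); have := sqr_ge0 (p + q); lra. Qed.

Lemma locally_integrable_itv (f : R -> R) a b : 0 < a ->
  locally_integrable `]0, +oo[ f -> leb.-integrable `[a, b] (EFin \o f).
Proof.
move=> a0 [mf _ fi].
have sub : `[a, b] `<=` `]0, +oo[ by apply: subset_itv; rewrite bnd_simp.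
apply/integrableP; split.
  by apply/measurable_EFinP; apply: measurable_funS mf.
by apply: fi => //; exact: segment_compact.
Qed.

Lemma integrable_ae_bounded (f h : R -> R) (a b : R) :
  measurable_fun `[a, b] f -> leb.-integrable `[a, b] (EFin \o h) ->
  {ae leb, forall t, a <= t <= b -> `|f t| <= h t} ->
  leb.-integrable `[a, b] (EFin \o f).
Proof.
move=> mf hi hf; apply/integrableP; split; first exact/measurable_EFinP.
apply: le_lt_trans (integrable_lty _ (integrable_norm hi)) => //.
apply: ae_ge0_le_integral => //.
- by apply: measurableT_comp => //; exact/measurable_EFinP.
- by move=> x _; rewrite lee_fin /=.
- exact: (measurable_int _ (integrable_norm hi)).
move: hf; apply: (@filterS _ _ (ae_filter_ringOfSetsType lebesgue_measure)) => t ht.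
rewrite /= in_itv/= => tab; rewrite lee_fin (le_trans (ht tab))// ler_norm//.
Qed.

End local_integrability.

Lemma measurable_pair_on {d d1 d2} {T : measurableType d} {T1 : measurableType d1}
    {T2 : measurableType d2} (D : set T) (f : T -> T1) (g : T -> T2) : measurable D ->
  measurable_fun D f -> measurable_fun D g -> measurable_fun D (fun x => (f x, g x)).
Proof.
move=> mD mf mg.
have h := measurable_fun_pair ((measurable_restrictT f mD).1 mf) ((measurable_restrictT g mD).1 mg).
apply: (eq_measurable_fun (fun x => ((f \_ D) x, (g \_ D) x))); last exact: measurable_funTS.
by move=> x xD; rewrite /patch xD.
Qed.

Section dual_norm.
Context {R : realType} {V : completeNormedModType R}.

(** The rough bound [M] serves to make the set under the supremum bounded, without which [sup]
    carries no information. *)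
Lemma dual_normP (f : V -> R) M : (forall t x, f (t *: x) = t * f x) ->
  (forall x, `|f x| <= M * `|x|) -> forall x, `|f x| <= dual_norm f * `|x|.
Proof.
move=> fZ fM x.
have f0 : f 0 = 0 by rewrite -(scale0r (0 : V)) fZ mul0r.
have [->|x0] := eqVneq x 0; first by rewrite f0 !normr0 mulr0.
have xp : 0 < `|x| by rewrite normr_gt0.
rewrite -ler_pdivrMr//; apply: sup_ubound.
  exists `|M| => _ [v v1 <-]; apply: (le_trans (fM v)).
  apply: (le_trans (ler_norm _)); rewrite normrM normr_id ler_piMr//.
exists (`|x|^-1 *: x).
  by rewrite /= normrZ ger0_norm ?invr_ge0// mulVf ?gt_eqF.
by rewrite fZ normrM ger0_norm ?invr_ge0// mulrC.
Qed.

End dual_norm.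

(** * Energy balance of two trajectories inside [B] *)

Section trajectories.
Context {R : realType} {H V : completeNormedModType R} {dot : {dot H for idfun}}
  {emb : {linear V -> H}} {A S : operator H} {d : measure_display}
  {Omega : measurableType d} {P : probability Omega R} {theta : R -> Omega -> Omega}
  {F : V -> Omega -> H} {phi : R -> Omega -> H -> H} {B : Omega -> set V}.
Hypotheses (hr : rigged dot emb A S) (hmds : ergodic_mds P theta)
  (hrds : continuous_rds theta phi)
  (hgen : generated_by_equation dot emb S theta F phi)
  (hinv : forward_invariant theta phi (fun w => emb @` B w)).
Variable l : V -> V -> Omega -> R.
Hypotheses (hl0 : forall x1 x2 w, 0 <= l x1 x2 w)
  (hlmeas : measurable_fun setT (fun p : borel V * borel V * Omega => l p.1.1 p.1.2 p.2)).
Variable c : R.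
Hypothesis hineq : forall w x1 x2, B w x1 -> B w x2 ->
     - dualA dot emb S (x1 - x2) (x1 - x2)
     + dualH dot emb (F x1 w - F x2 w) (x1 - x2)
     <= - c * `|x1 - x2| ^+ 2 + l x1 x2 w * `|emb (x1 - x2)| ^+ 2.
Local Notation leb := (@lebesgue_measure R).

Lemma measurable_trajectory_joint x :
  measurable_fun [set p : Omega * R | 0 <= p.2] ((fun p => phi p.2 p.1 x) : _ -> borel H).
Proof.
have m0 : measurable [set p : R * Omega * borel H | 0 <= p.1.1].
  rewrite (_ : [set p | _] = setT `&` (fun p : R * Omega * borel H => p.1.1) @^-1` `[0, +oo[).
    by apply: (measurableT_comp measurable_fst measurable_fst).
  by rewrite setTI; apply/seteqP; split => p /=; rewrite in_itv/= andbT.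
apply: (measurable_comp m0 _ (rds_measurable hrds) (g := fun p : Omega * R => (p.2, p.1, x : borel H))).
  by move=> _ [p /= p0 <-].
apply: measurable_funTS; apply: measurable_fun_pair; last exact: measurable_cst.
exact: (measurable_fun_pair measurable_snd measurable_fst).
Qed.

Lemma measurable_trajectory w x :
  measurable_fun (`[0, +oo[ : set R) ((fun t => phi t w x) : R -> borel H).
Proof.
have m0 : measurable [set p : Omega * R | 0 <= p.2].
  rewrite (_ : [set p | _] = setT `&` snd @^-1` `[0, +oo[).
    exact: measurable_snd.
  by rewrite setTI; apply/seteqP; split => p /=; rewrite in_itv/= andbT.
apply: (measurable_comp m0 _ (measurable_trajectory_joint x) (g := fun t => (w, t))).
  by move=> _ [t /= t0 <-]; move: t0; rewrite in_itv/= andbT.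
by apply: measurable_funTS; exact: (measurable_fun_pair (measurable_cst w) (@measurable_id _ R setT)).
Qed.

Lemma measurable_trajectory_at t x : 0 <= t ->
  measurable_fun setT ((fun w => phi t w x) : Omega -> borel H).
Proof.
move=> t0.
have m0 : measurable [set p : Omega * R | 0 <= p.2].
  rewrite (_ : [set p | _] = setT `&` snd @^-1` `[0, +oo[).
    exact: measurable_snd.
  by rewrite setTI; apply/seteqP; split => p /=; rewrite in_itv/= andbT.
apply: (measurable_comp m0 _ (measurable_trajectory_joint x) (g := fun w => (w, t))).
  by move=> _ [w /= _ <-].
exact: (measurable_fun_pair (@measurable_id _ Omega setT) (measurable_cst t)).
Qed.

Section pair.
Variables (w : Omega) (x1 x2 : H) (s0 : R).
Hypotheses (s00 : 0 < s0) (hB1 : (emb @` B (theta s0 w)) (phi s0 w x1))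
  (hB2 : (emb @` B (theta s0 w)) (phi s0 w x2)).

Let v (x : H) (t : R) : V := toV emb (phi t w x).

Definition trajectory_rate (t : R) : R :=
  l (toV emb (phi t w x1)) (toV emb (phi t w x2)) (theta t w).

(** The cocycle property restarts the trajectory at [s0], and invariance keeps it in [B]; the time
    [s0] itself is separate, as invariance concerns positive times. *)
Lemma absorbed x t : (emb @` B (theta s0 w)) (phi s0 w x) -> s0 <= t ->
  B (theta t w) (v x t) /\ emb (v x t) = phi t w x.
Proof.
move=> hB st; have : (emb @` B (theta t w)) (phi t w x).
  move: st; rewrite le_eqVlt => /orP[/eqP<-//|st].
  have tE : theta t w = theta (t - s0) (theta s0 w) by rewrite -(mds_add hmds) subrK.
  have pE : phi t w x = phi (t - s0) (theta s0 w) (phi s0 w x).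
    by rewrite -(rds_cocycle hrds) ?subrK ?subr_ge0// ltW.
  rewrite tE pE; apply: (hinv (t := t - s0) (w := theta s0 w)); first by rewrite subr_gt0.
  by exists (phi s0 w x).
by move=> [z Bz zE]; rewrite /v -zE (toV_emb hr).
Qed.

Lemma toV_trajectoryB t : s0 <= t ->
  toV emb (phi t w x1 - phi t w x2) = v x1 t - v x2 t.
Proof.
move=> st; have [_ <-] := absorbed hB1 st; have [_ <-] := absorbed hB2 st.
by rewrite -linearB (toV_emb hr).
Qed.

Lemma measurable_toV_trajectory x (D : set R) : measurable D -> D `<=` `[0, +oo[ ->
  measurable_fun D (v x : R -> borel V).
Proof.
move=> mD D0; apply: (measurableT_comp (measurable_toV hr)).
exact: measurable_funS (measurable_trajectory w x).
Qed.

Lemma measurable_trajectory_rate : measurable_fun (`[0, +oo[ : set R) trajectory_rate.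
Proof.
have mv x := @measurable_toV_trajectory x (`[0, +oo[ : set R) (measurable_itv _) (@subset_refl _ _).
have mth : measurable_fun (`[0, +oo[ : set R) (fun t => theta t w).
  by apply: measurable_funTS; exact: (measurable_orbit hmds w (@measurable_id _ Omega setT)).
have mD : measurable (`[0, +oo[ : set R) by exact: measurable_itv.
exact: (measurableT_comp hlmeas (measurable_pair_on mD (measurable_pair_on mD (mv x1) (mv x2)) mth)).
Qed.

(** [energy_inequality] for the difference of the two equations, with [hineq] as the bound along the
    solution. Integrability of the rate is left to [trajectory_decay], which gets it from the window
    bounds. *)
Lemma trajectory_energy a b : s0 <= a -> a <= b ->
  leb.-integrable `[a, b] (EFin \o trajectory_rate) ->
  leb.-integrable `[a, b] (EFin \o (fun t => `|v x1 t - v x2 t| ^+ 2)) /\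
  `|phi b w x1 - phi b w x2| ^+ 2 - `|phi a w x1 - phi a w x2| ^+ 2 <=
  \int[leb]_(t in `[a, b]) (2 * (- c * `|v x1 t - v x2 t| ^+ 2
     + trajectory_rate t * `|phi t w x1 - phi t w x2| ^+ 2)).
Proof.
move=> sa ab li; have a0 : 0 < a by exact: lt_le_trans sa.
have D0 : (`[a, b] : set R) `<=` `[0, +oo[ by apply: subset_itv; rewrite bnd_simp// ltW.
have h1 := gen_solution hgen w x1; have h2 := gen_solution hgen w x2.
have [g1 [mg1 dg1 eg1 ag1]] := sol_eq h1; have [g2 [mg2 dg2 eg2 ag2]] := sol_eq h2.
have tb t : a <= t <= b -> s0 <= t by move=> /andP[ta _]; exact: le_trans ta.
have mu x : measurable_fun `[a, b] ((fun t => phi t w x) : R -> borel H).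
  by apply: measurable_funS (measurable_trajectory w x).
(* The difference is formed in H, which is separable by assumption, and only then sent to V. *)
have mv2 : measurable_fun `[a, b] (fun t => `|v x1 t - v x2 t| ^+ 2).
  apply: measurable_funX.
  apply: (eq_measurable_fun (fun t => `|toV emb (phi t w x1 - phi t w x2)|)).
    move=> t; rewrite inE/= in_itv/= => /tb; exact: (fun st => congr1 _ (toV_trajectoryB st)).
  apply: (measurableT_comp (@measurable_norm R V)).
  apply: (measurableT_comp (measurable_toV hr)).
  by apply: measurable_borelB; [exact: rigged_separable hr| | |].
have vi : leb.-integrable `[a, b] (EFin \o (fun t => `|v x1 t - v x2 t| ^+ 2)).
  have i1 := locally_integrable_itv b a0 (sol_V_L2loc h1).
  have i2 := locally_integrable_itv b a0 (sol_V_L2loc h2).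
  apply: (integrable_ae_bounded mv2 (integrable_scaleR 2 (integrable_addR i1 i2))).
  apply: aeW => t _; rewrite ger0_norm ?sqr_ge0//.
  have h3 : `|v x1 t - v x2 t| ^+ 2 <= (`|v x1 t| + `|v x2 t|) ^+ 2.
    by rewrite ler_pXn2r ?nnegrE ?addr_ge0// ler_normB.
  by apply: (le_trans h3); exact: sqrD_le.
split=> //.
pose g t x := g1 t x - g2 t x.
(* Only the squares of the dual norms are known to be measurable; their roots are these absolute
   values. *)
pose dn t := `|dual_norm (g1 t)| + `|dual_norm (g2 t)|.
have [M M0 hM] := emb_bounded hr.
have rhs_bound t h x : `|rhs dot emb S theta F w t h x| <=
    dual_norm (rhs dot emb S theta F w t h) * `|x|.
  apply: (dual_normP (M := `|F (toV emb h) (theta t w)| * M + `|toV emb h|)).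
    move=> r y; rewrite /rhs /dualH linearZ.
    have -> : dualA dot emb S (toV emb h) (r *: y) = r * dualA dot emb S (toV emb h) y.
      have := ipVPr hr r y 0 (toV emb h); rewrite addr0.
      have := ipVPr hr 0 0 0 (toV emb h); rewrite scale0r addr0 mul0r add0r => e1 ->.
      by have := ipV_schwarz hr (toV emb h) 0; rewrite normr0 mulr0 normr_le0 => /eqP ->; rewrite addr0.
    have -> : dot (F (toV emb h) (theta t w)) (r *: emb y) = r * dot (F (toV emb h) (theta t w)) (emb y).
      by rewrite dotC linearZl_LR dotC.
    by rewrite mulrBr.
  move=> y; apply: (le_trans (ler_normB _ _)); rewrite mulrDl lerD//.
    by apply: (le_trans (dot_schwarz hr _ _)); rewrite -mulrA ler_wpM2l.
  exact: (ipV_schwarz hr).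
have ag : {ae leb, forall t, a <= t <= b ->
   g1 t = rhs dot emb S theta F w t (phi t w x1) /\ g2 t = rhs dot emb S theta F w t (phi t w x2)}.
  have := @filterI _ _ (ae_filter_ringOfSetsType lebesgue_measure) _ _ ag1 ag2.
  apply: (@filterS _ _ (ae_filter_ringOfSetsType lebesgue_measure)) => t [e1 e2] /andP[ta _].
  by have t0 := lt_le_trans a0 ta; split; [exact: e1|exact: e2].
have mdn gi : locally_integrable `]0, +oo[ (fun t => dual_norm (gi t : V -> R) ^+ 2) ->
    measurable_fun `[a, b] (fun t => `|dual_norm (gi t)|).
  move=> [md _ _].
  rewrite (_ : (fun t => _) = (fun t => Num.sqrt (dual_norm (gi t) ^+ 2))); last first.
    by apply/funext => t; rewrite sqrtr_sqr.
  apply: measurable_sqrt; apply: measurable_funS md => //.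
  by apply: subset_itv; rewrite bnd_simp.
have md1 := mdn _ dg1; have md2 := mdn _ dg2.
have di1 := locally_integrable_itv b a0 dg1; have di2 := locally_integrable_itv b a0 dg2.
have gint gi h : (forall x, measurable_fun (`]0, +oo[ : set R) (fun t => gi t x)) ->
    leb.-integrable `[a, b] (EFin \o (fun t => dual_norm (gi t : V -> R) ^+ 2)) ->
    {ae leb, forall t, a <= t <= b -> gi t = rhs dot emb S theta F w t (h t)} ->
    forall x, leb.-integrable `[a, b] (EFin \o (fun t => gi t x)).
  move=> mg dgi agi x.
  have oi : leb.-integrable `[a, b] (EFin \o (fun=> `|x| ^+ 2)).
    by apply: continuous_compact_integrable; [exact: segment_compact|
      apply: continuous_subspaceT => ?; exact: cst_continuous].
  apply: (integrable_ae_bounded _ (integrable_addR dgi oi)).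
    apply: measurable_funS (mg x) => //.
    by apply: subset_itv; rewrite bnd_simp.
  move: agi; apply: (@filterS _ _ (ae_filter_ringOfSetsType lebesgue_measure)) => t et tab.
  have := rhs_bound t (h t) x; rewrite -(et tab) => /le_trans; apply.
  exact: mulr_le_sqrD.
have gi1 : forall x, leb.-integrable `[a, b] (EFin \o (fun t => g1 t x)).
  apply: (gint g1 (fun t => phi t w x1)) => //.
  by move: ag; apply: (@filterS _ _ (ae_filter_ringOfSetsType lebesgue_measure)) => t h /h[].
have gi2 : forall x, leb.-integrable `[a, b] (EFin \o (fun t => g2 t x)).
  apply: (gint g2 (fun t => phi t w x2)) => //.
  by move: ag; apply: (@filterS _ _ (ae_filter_ringOfSetsType lebesgue_measure)) => t h /h[].
have uc x : {within `[a, b], continuous (fun t => phi t w x)}.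
  exact: continuous_subspaceW (sol_continuous (gen_solution hgen w x)).
have uc12 : {within `[a, b], continuous (fun t => phi t w x1 - phi t w x2)}.
  by move=> t; apply: cvgB; exact: uc.
have uc2 : {within `[a, b], continuous (fun t => `|phi t w x1 - phi t w x2| ^+ 2)}.
  apply: (@within_continuous_comp R H R `[a, b] (fun x => `|x| ^+ 2)
    (fun t => phi t w x1 - phi t w x2)) => // x.
  apply: (continuous_comp (f := fun x : H => `|x|) (g := fun y : R => y ^+ 2)).
    exact: norm_continuous.
  exact: exprn_continuous.
pose kr t := - c * `|v x1 t - v x2 t| ^+ 2 + trajectory_rate t * `|phi t w x1 - phi t w x2| ^+ 2.
have kri : leb.-integrable `[a, b] (EFin \o kr).
  apply: integrable_addR; first exact: integrable_scaleR.
  have [Y hY] : exists Y, forall t, a <= t <= b -> `| `|phi t w x1 - phi t w x2| ^+ 2 | <= Y.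
    have /compact_bounded[Y [_ hY]] := continuous_compact uc2 (@segment_compact R a b).
    exists (`|Y| + 1) => s sab; apply: (hY (`|Y| + 1)); last by exists s.
    by rewrite (le_lt_trans (ler_norm _))// ltrDl.
  have := integrable_bounded_mul li (subspace_continuous_measurable_fun (measurable_itv _) uc2) hY.
  by apply: eq_integrable => // t _ /=; rewrite mulrC.
apply: (energy_inequality hr (u := fun t => phi t w x1 - phi t w x2)
  (v := fun t => v x1 t - v x2 t) (g := g) (dn := dn)) => //.
- move=> t /tb st; rewrite linearB; have [_ ->] := absorbed hB1 st.
  by have [_ ->] := absorbed hB2 st.
- by move=> x; exact: integrable_subR.
- move=> x s t as_ st tb'; rewrite !dotBl.
  have s_0 : 0 < s by exact: lt_le_trans as_.
  rewrite RintegralB//; [|exact: integrable_sub (gi1 x)|exact: integrable_sub (gi2 x)].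
  by rewrite -(eg1 _ _ _ s_0 st) -(eg2 _ _ _ s_0 st); ring.
- exact: measurable_funD.
- by move=> t; rewrite addr_ge0.
- apply: (integrable_ae_bounded _ (integrable_scaleR 2 (integrable_addR di1 di2))).
    by apply: measurable_funX; exact: measurable_funD.
  apply: aeW => t _; rewrite ger0_norm ?sqr_ge0// /dn.
  by apply: (le_trans (sqrD_le _ _)); rewrite !real_normK ?num_real.
move: ag; apply: (@filterS _ _ (ae_filter_ringOfSetsType lebesgue_measure)) => t et tab x.
have [e1 e2] := et tab; have st := tb _ tab.
have [B1 E1] := absorbed hB1 st; have [B2 E2] := absorbed hB2 st.
set y := v x1 t - v x2 t.
(* At [y] the one-sided inequality [hineq] applies; the remainder at [x - y] is bounded by the dual
   norms. *)
have key : g t x = g t y + g t (x - y).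
  rewrite /g e1 e2 /rhs /dualH [emb (x - y)]linearB.
  have dB h : dualA dot emb S h (x - y) = dualA dot emb S h x - dualA dot emb S h y.
    by rewrite addrC -scaleN1r (ipVPr hr); ring.
  by rewrite !dB !dotBr; ring.
rewrite key lerD//.
  have := hineq B1 B2; rewrite -/y /kr -/y.
  have -> : - dualA dot emb S y y + dualH dot emb (F (v x1 t) (theta t w) - F (v x2 t) (theta t w)) y = g t y.
    rewrite /g e1 e2 /rhs /dualH -/(v x1 t) -/(v x2 t).
    have -> : dualA dot emb S y y = dualA dot emb S (v x1 t) y - dualA dot emb S (v x2 t) y.
      by rewrite {1}/y addrC -scaleN1r (ipVPl hr); ring.
    by rewrite dotBl; ring.
  by rewrite {2}/y linearB E1 E2.
apply: (le_trans (ler_norm _)); apply: (le_trans (ler_normB _ _)).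
rewrite /dn mulrDl lerD//.
  rewrite e1; apply: (le_trans (rhs_bound _ _ _)); rewrite ler_wpM2r// ler_norm//.
by rewrite e2; apply: (le_trans (rhs_bound _ _ _)); rewrite ler_wpM2r// ler_norm.
Qed.

End pair.
End trajectories.

(** * Exponential weights for the difference of two trajectories *)

Lemma rate_comparison (R : realType) (q p n lr e e' C : R) : e' * p <= e * q + C * n ->
  2 * (- e * q + lr * p) <= 2 * (lr - e') * p + 2 * C * n.
Proof. by lra. Qed.

Section decay.
Context {R : realType} {H V : completeNormedModType R} {dot : {dot H for idfun}}
  {emb : {linear V -> H}} {A S : operator H} {d : measure_display}
  {Omega : measurableType d} {P : probability Omega R} {theta : R -> Omega -> Omega}
  {F : V -> Omega -> H} {phi : R -> Omega -> H -> H} {B : Omega -> set V}.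
Hypotheses (hr : rigged dot emb A S) (hmds : ergodic_mds P theta)
  (hrds : continuous_rds theta phi)
  (hgen : generated_by_equation dot emb S theta F phi)
  (hinv : forward_invariant theta phi (fun w => emb @` B w)).
Variable l : V -> V -> Omega -> R.
Hypotheses (hl0 : forall x1 x2 w, 0 <= l x1 x2 w)
  (hlmeas : measurable_fun setT (fun p : borel V * borel V * Omega => l p.1.1 p.1.2 p.2)).
Variable c : R.
Hypothesis hineq : forall w x1 x2, B w x1 -> B w x2 ->
     - dualA dot emb S (x1 - x2) (x1 - x2)
     + dualH dot emb (F x1 w - F x2 w) (x1 - x2)
     <= - c * `|x1 - x2| ^+ 2 + l x1 x2 w * `|emb (x1 - x2)| ^+ 2.
Variables (m : R) (Y : Omega -> \bar R).
Hypotheses (hm : 0 < m) (mY : measurable_fun setT Y) (Y0 : forall w, (0 <= Y w)%E)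
  (hY : forall w, (sup_integral emb theta phi B l m w <= Y w)%E).
Local Notation leb := (@lebesgue_measure R).

Section pair.
Variables (w : Omega) (x1 x2 : H) (s0 : R).
Hypotheses (s00 : 0 < s0) (hB1 : (emb @` B (theta s0 w)) (phi s0 w x1))
  (hB2 : (emb @` B (theta s0 w)) (phi s0 w x2)).
Let la := trajectory_rate (emb := emb) (theta := theta) (phi := phi) l w x1 x2.

Let mla : measurable_fun (`[0, +oo[ : set R) la.
Proof. exact: (measurable_trajectory_rate hr hmds hrds hlmeas). Qed.

(** The windows start up to [m] before [a], so [s0 + m <= a] ensures that both trajectories are in
    [B] at each start, where they compete in the supremum bounded by [Y]. *)
Lemma rate_window a b : s0 + m <= a ->
  (m%:E * \int[leb]_(t in `[a, b]) (la t)%:E <= orbit_integral (theta := theta) Y (a - m) b w)%E.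
Proof.
move=> sa.
(* Extended by [0], since the rate is known to be measurable at nonnegative times only. *)
pose la' : R -> \bar R := (fun t => (la t)%:E) \_ `[0, +oo[.
have mla' : measurable_fun setT la'.
  apply: (measurable_restrictT _ _).1; first exact: measurable_itv.
  exact/measurable_EFinP.
have la'0 t : (0 <= la' t)%E.
  by rewrite /la' /patch; case: ifPn => // _; rewrite lee_fin hl0.
have la'E t : 0 <= t -> la' t = (la t)%:E.
  by move=> t0; rewrite /la' /patch mem_set//= in_itv/= t0.
have -> : (\int[leb]_(t in `[a, b]) (la t)%:E = \int[leb]_(t in `[a, b]) la' t)%E.
  apply: eq_integral => t; rewrite inE/= in_itv/= => /andP[ta _].
  by rewrite la'E// (le_trans _ ta)// (le_trans _ sa)// addr_ge0 ?ltW.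
apply: (le_trans (sliding_window _ _ mla' la'0 (ltW hm))).
rewrite /orbit_integral; apply: ge0_le_integral => //.
- by move=> r _; exact: integral_ge0.
- apply: measurable_funTS.
  have := @measurable_partial_integral _ _ _ (measurableTypeR R) (measurableTypeR R)
    lebesgue_measure `[0, m] (fun p => la' (p.1 + p.2)%R) (measurable_itv _).
  by apply => //; apply: (measurableT_comp mla'); exact: measurable_funD.
- by apply: measurable_funTS; exact: (measurable_orbit hmds w mY).
move=> r /=; rewrite in_itv/= => /andP[ar _].
have sr : s0 <= r by rewrite (le_trans _ ar)// lerBrDr.
have r0 : 0 <= r by rewrite (le_trans _ sr)// ltW.
have [B1 E1] := absorbed hr hmds hrds hinv s00 hB1 sr.
have [B2 E2] := absorbed hr hmds hrds hinv s00 hB2 sr.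
apply: le_trans (hY _); apply: ereal_sup_ubound.
exists (toV emb (phi r w x1), toV emb (phi r w x2)) => //.
apply: eq_integral => t; rewrite inE/= in_itv/= => /andP[t0 _].
rewrite la'E ?addr_ge0// /la /trajectory_rate E1 E2 (addrC r).
by rewrite !(rds_cocycle hrds)// (mds_add hmds).
Qed.

Variables (c' C0 kappa Cw CL : R) (N : V -> R).
Hypotheses (hc' : 0 <= c') (hC0 : 0 <= C0) (hk0 : 0 <= kappa) (hk : kappa <= c' * m)
  (N0 : forall v, 0 <= N v) (mN : measurable_fun setT (N : borel V -> R))
  (NL : forall v, N v <= CL * `|v| ^+ 2)
  (hN : forall v, c' * `|emb v| ^+ 2 <= c * `|v| ^+ 2 + C0 * N v).

(* A bound of [expR (\int_r^t 2 (la - c'))], as the integral of [la] over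
   [`[r, t]] is at most [(kappa (t - r + m + 1) + Cw) / m]. *)
Definition decay_weight (t r : R) : R :=
  expR (2 * (kappa * (m + 1) + Cw) / m) * expR (- (2 * (c' - kappa / m)) * (t - r)).

(** The bound on [Y] seen from [theta t w] controls the integral of the rate over [[s, t]] for every
    [s] at once, which is the majorant that [gronwall] asks for. *)
Lemma trajectory_decay t : s0 + m <= t ->
  (forall n : nat, (orbit_integral (theta := theta) Y (- n%:R) 0 (theta t w) <= (kappa * n%:R + Cw)%:E)%E) ->
  `|phi t w x1 - phi t w x2| ^+ 2 <=
   decay_weight t (s0 + m) * `|phi (s0 + m) w x1 - phi (s0 + m) w x2| ^+ 2 +
   \int[leb]_(r in `[s0 + m, t]) (decay_weight t r *
     (2 * C0 * N (toV emb (phi r w x1 - phi r w x2)))).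
Proof.
set a0 := s0 + m => at_ hK.
have sa : s0 <= a0 by rewrite lerDl ltW.
have a00 : 0 < a0 by rewrite (lt_le_trans s00).
have tB r : a0 <= r -> s0 <= r by move=> h; exact: le_trans h.
(* Here [n] rounds the length [t - s + m] up, at the cost of at most one unit; hence the [m + 1] in
   [decay_weight]. *)
have win s : a0 <= s -> s <= t -> exists2 n : nat, t - s + m <= n%:R <= t - s + m + 1 &
    (m%:E * \int[leb]_(r in `[s, t]) (la r)%:E <= (kappa * n%:R + Cw)%:E)%E.
  move=> as_ st; set x := t - s + m.
  have x0 : 0 <= x by rewrite addr_ge0 ?subr_ge0// ltW.
  have /andP[h1 h2] := truncn_itv x0.
  exists (Num.truncn x).+1; first by rewrite ltW//= -natr1 lerD2r.
  apply: (le_trans (rate_window t as_)).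
  apply: le_trans (hK (Num.truncn x).+1).
  rewrite (orbit_integral_shift hmds mY Y0) add0r.
  apply: (orbit_integral_mono hmds mY Y0) => //.
  by move: h2; rewrite /x; lra.
have la0 r : 0 <= la r by exact: hl0.
have msub s b : a0 <= s -> measurable_fun (`[s, b] : set R) la.
  move=> as_; apply: measurable_funS mla => //.
  by apply: subset_itv; rewrite bnd_simp// (le_trans _ as_)// ltW.
have lai : leb.-integrable `[a0, t] (EFin \o la).
  apply/integrableP; split; first by apply/measurable_EFinP; exact: msub.
  (* As [m > 0], the finite bound excludes an infinite integral of the rate. *)
  have [n _] := win _ (lexx _) at_.
  have -> : (\int[leb]_(r in `[a0, t]) `|(EFin \o la) r| = \int[leb]_(r in `[a0, t]) (la r)%:E)%E.
    by apply: eq_integral => r _; rewrite gee0_abs// lee_fin.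
  rewrite ltNge => hn; apply/negP; rewrite leye_eq => /eqP E2; move: hn.
  by rewrite E2 gt0_muley ?lte_fin// leye_eq.
have [vi _] := trajectory_energy hr hmds hrds hgen hinv hineq s00 hB1 hB2 sa at_ lai.
set u := fun r => phi r w x1 - phi r w x2.
set v := fun r => toV emb (phi r w x1) - toV emb (phi r w x2).
have uv r : a0 <= r -> toV emb (u r) = v r.
  by move=> ar; exact: (toV_trajectoryB hr hmds hrds hinv s00 hB1 hB2 (tB _ ar)).
have embv r : a0 <= r -> emb (v r) = u r.
  move=> ar; rewrite linearB; have [_ ->] := absorbed hr hmds hrds hinv s00 hB1 (tB _ ar).
  by have [_ ->] := absorbed hr hmds hrds hinv s00 hB2 (tB _ ar).
have uc x : {within `[a0, t], continuous (fun t => phi t w x)}.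
  apply: continuous_subspaceW (sol_continuous (gen_solution hgen w x)).
  by apply: subset_itv; rewrite bnd_simp// ltW.
have uc2 : {within `[a0, t], continuous (fun r => `|u r| ^+ 2)}.
  have uc12 : {within `[a0, t], continuous u} by move=> r; apply: cvgB; exact: uc.
  apply: (@within_continuous_comp R H R `[a0, t] (fun x => `|x| ^+ 2) u) => // x.
  apply: (continuous_comp (f := fun x : H => `|x|) (g := fun y : R => y ^+ 2)).
    exact: norm_continuous.
  exact: exprn_continuous.
have mu x : measurable_fun `[a0, t] ((fun t => phi t w x) : R -> borel H).
  apply: measurable_funS (measurable_trajectory hrds w x) => //.
  by apply: subset_itv; rewrite bnd_simp// ltW.
have Ni : leb.-integrable `[a0, t] (EFin \o (fun r => 2 * C0 * N (toV emb (u r)))).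
  apply: integrable_scaleR.
  apply: (integrable_ae_bounded _ (integrable_scaleR CL vi)).
    apply: (measurableT_comp mN); apply: (measurableT_comp (measurable_toV hr)).
    by apply: measurable_borelB; [exact: rigged_separable hr| | |].
  by apply: aeW => r /andP[ar _]; rewrite ger0_norm// uv.
pose al r := 2 * (la r - c').
have ci : leb.-integrable `[a0, t] (EFin \o (fun=> c')).
  by apply: continuous_compact_integrable; [exact: segment_compact|
    apply: continuous_subspaceT => ?; exact: cst_continuous].
have ali : leb.-integrable `[a0, t] (EFin \o al).
  by apply: integrable_scaleR; exact: integrable_subR.
have [U hU] : exists U, forall r, a0 <= r <= t -> `| `|u r| ^+ 2 | <= U.
  have /compact_bounded[U [_ hU]] := continuous_compact uc2 (@segment_compact R a0 t).
  exists (`|U| + 1) => s sab; apply: (hU (`|U| + 1)); last by exists s.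
  by rewrite (le_lt_trans (ler_norm _))// ltrDl.
have mu2 := subspace_continuous_measurable_fun (measurable_itv `[a0, t]) uc2.
have alui : leb.-integrable `[a0, t] (EFin \o (fun r => `|u r| ^+ 2 * al r)).
  exact: (integrable_bounded_mul ali mu2 hU).
have laui : leb.-integrable `[a0, t] (EFin \o (fun r => `|u r| ^+ 2 * la r)).
  exact: (integrable_bounded_mul lai mu2 hU).
apply: (gronwall (y := fun r => `|u r| ^+ 2) (al := al)
  (n := fun r => 2 * C0 * N (toV emb (u r))) (psi := decay_weight t)) => //.
- by move=> r; rewrite !mulr_ge0.
- apply: continuous_subspaceT => r; apply: cvgM; first exact: cvg_cst.
  apply: (cvg_comp _ expR); last exact: continuous_expR.
  by apply: cvgM; [exact: cvg_cst|apply: cvgB; [exact: cvg_cst|exact: cvg_id]].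
- move=> s /andP[as_ st].
  have lai' := integrable_sub as_ (lexx t) lai.
  have ci' := integrable_sub as_ (lexx t) ci.
  rewrite /decay_weight -expRD ler_expR /al RintegralZl//; last exact: integrable_subR.
  rewrite RintegralB// Rintegral_cst//= lebesgue_measure_itv/=.
  have [n /andP[n1 n2] hn] := win s as_ st.
  have fin : (\int[leb]_(r in `[s, t]) (la r)%:E)%E \is a fin_num.
    exact: integrable_fin_num.
  move: hn; rewrite -(fineK fin) -EFinM lee_fin -/(Rintegral _ _ _) => hn.
  have -> : fine (if s%:E < t%:E then t%:E - s%:E else 0)%E = t - s.
    by move: st; rewrite lte_fin le_eqVlt => /orP[/eqP->|->]//; rewrite ltxx subrr.
  move: hn; set I := Rintegral _ _ _ => hn.
  have hI : I <= (kappa * n%:R + Cw) / m by rewrite ler_pdivlMr// mulrC.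
  have hn3 : kappa * n%:R <= kappa * (t - s + m + 1) by rewrite ler_wpM2l.
  have hI2 : I <= (kappa * (t - s + m + 1) + Cw) / m.
    by apply: (le_trans hI); rewrite ler_pM2r ?invr_gt0// lerD2r.
  have -> : 2 * (kappa * (m + 1) + Cw) / m + - (2 * (c' - kappa / m)) * (t - s) =
     2 * ((kappa * (t - s + m + 1) + Cw) / m - c' * (t - s)).
    by field; rewrite gt_eqF.
  by rewrite ler_pM2l// lerD2r.
- move=> s t' as_ st' t't.
  have sub f : leb.-integrable `[a0, t] (EFin \o f) -> leb.-integrable `[s, t'] (EFin \o f).
    exact: integrable_sub.
  have s0s : s0 <= s by exact: tB.
  have [_ h] := trajectory_energy hr hmds hrds hgen hinv hineq s00 hB1 hB2 s0s st' (sub _ lai).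
  apply: (le_trans h); apply: le_Rintegral => //.
  + apply: integrable_scaleR; apply: integrable_addR.
      by apply: integrable_scaleR; exact: sub.
    by apply: eq_integrable (sub _ laui) => // r _ /=; rewrite mulrC.
  + apply: integrable_addR; last exact: sub.
    by apply: eq_integrable (sub _ alui) => // r _ /=; rewrite mulrC.
  + move=> r /=; rewrite in_itv/= => /andP[sr _].
    have ar : a0 <= r by exact: le_trans sr.
    rewrite (uv r ar) /al -/(la r) -/(v r) -/(u r) -(embv r ar).
    by apply: rate_comparison; exact: hN.
Qed.

End pair.
End decay.

(** * Convergence in probability and tempered tails *)

Section probability_tools.
Context {R : realType} {d : measure_display} {T : measurableType d}.
Variable P : probability T R.

(** The integral of a nonnegative function is a supremum over simple functions below it, so
    monotonicity extends to [sup_integral], which is measurable only up to a null set. *)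
Lemma le_integral_ge0 (f g : T -> \bar R) : (forall x, 0 <= f x)%E ->
  (forall x, f x <= g x)%E -> (\int[P]_x f x <= \int[P]_x g x)%E.
Proof.
move=> f0 fg; have g0 x : (0 <= g x)%E by exact: le_trans (fg x).
rewrite !ge0_integralTE//; apply: le_ereal_sup => _ [h hf <-].
by exists h => // x; exact: le_trans (fg x).
Qed.

Lemma increasing_sets_prob (G : nat -> set T) : (forall n, measurable (G n)) ->
  (forall n k, (n <= k)%N -> G n `<=` G k) -> {ae P, forall w, exists n, G n w} ->
  forall e, 0 < e -> exists n, (P (~` G n) <= e%:E)%E.
Proof.
move=> mG incG aeG e e0.
have P0 : P (\bigcap_n ~` G n) = 0%E.
  apply/negligibleP; first by apply: bigcapT_measurable => n; exact: measurableC.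
  apply: negligibleS aeG => w hw [n Gn]; exact: (hw n Logic.I).
have : P (~` G n) @[n --> \oo] --> 0%E.
  rewrite -P0; apply: nonincreasing_cvg_mu.
  - by rewrite (le_lt_trans (probability_le1 _ _))// ?ltry//; exact: measurableC.
  - by move=> n; exact: measurableC.
  - by apply: bigcapT_measurable => n; exact: measurableC.
  - by move=> n k nk; apply/subsetPset/subsetC; exact: incG.
move=> /fine_cvgP[_ /cvgrPdist_le/(_ _ e0)[n _ hn]]; exists n.
have := hn n (leqnn n) => /=; rewrite sub0r normrN ger0_norm ?fine_ge0//.
by rewrite -lee_fin fineK//; apply: fin_num_measure; exact: measurableC.
Qed.

Lemma bounded_in_probability (f : T -> R) : measurable_fun setT f ->
  forall e, 0 < e -> exists2 r : R, 0 <= r & (P (~` [set w | (f w <= r)%R]) <= e%:E)%E.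
Proof.
move=> mf e e0.
pose G n : set T := [set w | f w <= n%:R].
have [|||n hn] := @increasing_sets_prob G _ _ _ _ e0.
- by move=> n; rewrite /G -[X in measurable X]setTI -preimage_itvNyc; exact: mf.
- by move=> n k nk w /= /le_trans; apply; rewrite ler_nat.
- by apply: aeW => w; have [n _ hn] := nbhs_infty_ger (f w); exists n; exact: (hn n (leqnn n)).
by exists n%:R.
Qed.

Lemma cvg_prob0 (S : R -> set T) :
  (forall e, 0 < e -> exists t0, forall t, t0 <= t -> (P (S t) <= e%:E)%E) ->
  P (S t) @[t --> +oo] --> 0%E.
Proof.
move=> h.
have fin t (e : R) : (P (S t) <= e%:E)%E -> P (S t) \is a fin_num.
  by move=> he; rewrite ge0_fin_numE// (le_lt_trans he)// ltry.
apply/fine_cvgP; split.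
  have [t0 ht0] := h 1 ltr01; exists t0; split; first exact: num_real.
  by move=> t /ltW /ht0; exact: fin.
apply/cvgrPdist_le => e e0; have [t0 ht0] := h e e0.
exists t0; split; first exact: num_real.
move=> t /ltW /ht0 he /=; rewrite sub0r normrN ger0_norm ?fine_ge0//.
by rewrite -lee_fin fineK//; exact: fin he.
Qed.

Lemma prob0_cvg (S : R -> set T) : P (S t) @[t --> +oo] --> 0%E ->
  forall e, 0 < e -> exists t0, forall t, t0 <= t -> (P (S t) <= e%:E)%E.
Proof.
move=> /fine_cvgP[[t1 [_ h1]] /cvgrPdist_le h2] e e0.
have [t2 [_ ht2]] := h2 _ e0.
exists (Num.max t1 t2 + 1) => t ht.
have tt1 : t1 < t by rewrite (lt_le_trans _ ht)// ltr_pwDr// le_max lexx.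
have tt2 : t2 < t by rewrite (lt_le_trans _ ht)// ltr_pwDr// le_max lexx orbT.
have := ht2 t tt2 => /=; rewrite sub0r normrN ger0_norm ?fine_ge0// => he.
by rewrite -(fineK (h1 t tt1)) lee_fin.
Qed.

Lemma prob_bigU_le (A : nat -> set T) (n : nat) (x : R) : (forall i, measurable (A i)) ->
  (forall i, (i < n)%N -> (P (A i) <= x%:E)%E) ->
  (P (\big[setU/set0]_(i < n) A i) <= (n%:R * x)%:E)%E.
Proof.
move=> mA; elim: n => [|n IH] h; first by rewrite big_ord0 measure0 mul0r.
rewrite big_ord_recr/=; apply: (le_trans (measureU2 _ _ _)) => //.
  by apply: bigsetU_measurable.
rewrite -natr1 mulrDl mul1r EFinD; apply: leeD; last exact: h.
by apply: IH => i /ltnW/h.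
Qed.

(* An almost everywhere measurable function is dominated by a measurable one
   with the same integral, namely its version outside a null set, put to
   [+oo] on that set. *)
Lemma measurable_majorant (f : T -> \bar R) : (forall x, 0 <= f x)%E ->
  ae_measurable P f -> exists Y : T -> \bar R, [/\ measurable_fun setT Y,
    forall x, (0 <= Y x)%E, forall x, (f x <= Y x)%E &
    (\int[P]_x Y x <= \int[P]_x f x)%E].
Proof.
move=> f0 [Y0 mY0 [N [mN N0 hN]]].
pose Y1 := (fun x => maxe 0 (Y0 x))%E \_ (~` N).
have mY1 : measurable_fun setT Y1.
  apply: (measurable_restrictT _ _).1; first exact: measurableC.
  by apply: measurable_funTS; apply: measurable_maxe => //; exact: measurable_cst.
have mYN : measurable_fun setT ((cst +oo : T -> \bar R) \_ N)%E.
  by apply: (measurable_restrictT _ _).1 => //; exact: measurable_cst.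
have Y10 x : (0 <= Y1 x)%E by rewrite /Y1 /patch; case: ifPn => // _; rewrite le_max lexx.
have YN0 x : (0 <= ((cst +oo : T -> \bar R) \_ N) x)%E.
  by rewrite /patch; case: ifPn => // _; exact: leey.
have E x : ~ N x -> Y1 x = f x.
  move=> Nx; have fY : f x = Y0 x by apply: contrapT => h; exact/Nx/hN.
  by rewrite /Y1 /patch mem_set// -fY; apply/max_idPr.
exists (Y1 \+ ((cst +oo : T -> \bar R) \_ N))%E; split.
- exact: emeasurable_funD.
- by move=> x; exact: adde_ge0.
- move=> x; have [Nx|Nx] := pselect (N x).
    by rewrite /= [X in (_ + X)%E]/patch mem_set// addey ?leey// gt_eqF// (lt_le_trans _ (Y10 x))// ltNy0.
  by rewrite /= E// leeDl.
have -> : (\int[P]_x (Y1 \+ ((cst +oo : T -> \bar R) \_ N)) x = \int[P]_x Y1 x)%E.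
  apply: ge0_ae_eq_integral => //; first exact: emeasurable_funD.
    by move=> x _; exact: adde_ge0.
  exists N; split=> // x /=; apply: contra_notP => Nx _.
  by rewrite [X in (_ + X)%E]/patch memNset// adde0.
apply: le_integral_ge0 => // x; have [Nx|Nx] := pselect (N x); last by rewrite E.
by rewrite /Y1 /patch memNset//; exact: f0.
Qed.

End probability_tools.

(** * Exponentially weighted tails of tempered variables *)

Section exponential_tail.
Context {R : realType}.
Local Notation leb := (@lebesgue_measure R).

Lemma integral_exp_le (g a b : R) : 0 < g -> a <= b ->
  \int[leb]_(s in `[a, b]) expR (g * s) <= expR (g * b) / g.
Proof.
move=> g0 ab.
have ec : continuous (fun s : R => expR (g * s)).
  move=> s; apply: (cvg_comp _ expR); last exact: continuous_expR.
  by apply: cvgM; [exact: cvg_cst|exact: cvg_id].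
have ei : leb.-integrable `[a, b] (EFin \o (fun s => expR (g * s))).
  by apply: continuous_compact_integrable; [exact: segment_compact|exact: continuous_subspaceT].
pose z t := \int[leb]_(s in `[a, t]) expR (g * s).
have : z b - z a <= expR (g * b) / g - expR (g * a) / g.
  apply: (increment_le (K := fun t => expR (g * t) / g) (M := id)) => // eta eta0.
  have [rho rho0 hrho] := within_uniform (@continuous_subspaceT _ _ `[a, b] _ ec) eta0.
  exists rho => // s t as_ st tb tsrho; rewrite (Rintegral_increment as_ st tb ei).
  have h1 : \int[leb]_(r in `[s, t]) expR (g * r) <= expR (g * t) * (t - s).
    have -> : expR (g * t) * (t - s) = \int[leb]_(r in `[s, t]) expR (g * t).
      rewrite Rintegral_cst//= lebesgue_measure_itv/=; congr (_ * _).
      by move: st; rewrite lte_fin le_eqVlt => /orP[/eqP->|->]//; rewrite ltxx subrr.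
    apply: le_Rintegral => //; first exact: integrable_sub ei.
      by apply: continuous_compact_integrable; [exact: segment_compact|
        apply: continuous_subspaceT => ?; exact: cst_continuous].
    by move=> r /=; rewrite in_itv/= => /andP[_ rt]; rewrite ler_expR ler_pM2l.
  have h2 : expR (g * s) * (g * (t - s)) <= expR (g * t) - expR (g * s).
    have -> : expR (g * t) = expR (g * s) * expR (g * (t - s)).
      by rewrite -expRD; congr expR; ring.
    have := ler_wpM2l (expR_ge0 (g * s)) (expR_ge1Dx (g * (t - s))); lra.
  have h3 : expR (g * t) - expR (g * s) <= eta.
    apply: (le_trans (ler_norm _)); apply: hrho; rewrite ?tb ?(le_trans as_)// ?as_ ?(le_trans st)//.
    by rewrite ger0_norm ?subr_ge0.
  have h4 : expR (g * s) * (t - s) <= expR (g * t) / g - expR (g * s) / g.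
    by rewrite -mulrBl ler_pdivlMr// -mulrA (mulrC _ g).
  have h5 : (expR (g * t) - expR (g * s)) * (t - s) <= eta * (t - s).
    by rewrite ler_wpM2r// subr_ge0.
  move: h1 h4 h5; clear; lra.
rewrite /z Rintegral_itv1 subr0 => /le_trans; apply.
by rewrite gerBl divr_ge0 ?expR_ge0// ltW.
Qed.

End exponential_tail.

Section tempered_tail.
Context {R : realType} {d : measure_display} {Omega : measurableType d}.
Context {P : probability Omega R} {theta : R -> Omega -> Omega}.
Hypothesis hmds : ergodic_mds P theta.
Local Notation leb := (@lebesgue_measure R).

(** With [s] the time relative to [t], the weight is the decaying factor of [decay_weight] seen from
    [theta t w]. *)
Definition tail_integral (r : Omega -> R) (g a b : R) (w : Omega) : \bar R :=
  (\int[leb]_(s in `[a, b]) (expR (2 * g * s) * r (theta s w))%:E)%E.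

Lemma measurable_tail_integral (r : Omega -> R) (g a b : R) : measurable_fun setT r -> (forall w, 0 <= r w) ->
  measurable_fun setT (tail_integral r g a b).
Proof.
move=> mr r0.
have := @measurable_partial_integral R _ _ Omega (measurableTypeR R) lebesgue_measure
  `[a, b] (fun p => (expR (2 * g * p.2) * r (theta p.2 p.1))%:E) (measurable_itv _).
apply.
  apply/measurable_EFinP; apply: measurable_funM.
    apply: (measurableT_comp (@measurable_expR R)); apply: measurable_funM => //.
  apply: (measurableT_comp mr).
  exact: (measurableT_comp (mds_measurable hmds) (measurable_fun_pair measurable_snd measurable_fst)).
by move=> p; rewrite lee_fin mulr_ge0 ?expR_ge0.
Qed.

(** Temperedness gives [r (theta s w) <= e^(- g s)] for very negative [s], at the cost of half the
    exponent; what remains is at most [e^(- g M) / g]. The events grow with [M], so a single [M]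
    serves up to probability [e]. *)
Lemma tempered_tail (r : Omega -> R) (g : R) : tempered P theta r -> 0 < g ->
  forall eta e : R, 0 < eta -> 0 < e -> exists M : nat,
  let G := [set w | forall n : nat,
    (tail_integral r g (- M%:R - n%:R) (- M%:R) w <= eta%:E)%E] in
  measurable G /\ (P (~` G) <= e%:E)%E.
Proof.
move=> [mr r0 hr] g0 eta e eta0 e0.
pose G (M : nat) := [set w | forall n : nat,
    (tail_integral r g (- M%:R - n%:R) (- M%:R) w <= eta%:E)%E].
have mth w : measurable_fun setT (fun s => (expR (2 * g * s) * r (theta s w))%:E).
  apply/measurable_EFinP; apply: measurable_funM; last exact: (measurable_orbit hmds w mr).
  apply: (measurableT_comp (@measurable_expR R)); apply: measurable_funM => //.
have mG M : measurable (G M).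
  rewrite (_ : G M = \bigcap_n [set w | (tail_integral r g (- M%:R - n%:R) (- M%:R) w <= eta%:E)%E]).
    apply: bigcapT_measurable => n; rewrite -[X in measurable X]setTI.
    by apply: emeasurable_fun_infty_c => //; exact: measurable_tail_integral.
  by apply/seteqP; split => [w hw n _|w hw n]; [exact: hw|exact: (hw n Logic.I)].
have incG M M' : (M <= M')%N -> G M `<=` G M'.
  move=> MM' w hw n.
  apply: le_trans (hw (n + (M' - M))%N); rewrite /tail_integral.
  apply: ge0_subset_integral => //; first exact: (measurable_funTS (mth w)).
    by move=> s _; rewrite lee_fin mulr_ge0 ?expR_ge0.
  have : M%:R <= M'%:R :> R by rewrite ler_nat.
  by move=> h; apply: subset_itv; rewrite bnd_simp; [rewrite natrD natrB//; lra|lra].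
suff aeG : {ae P, forall w, exists M, G M w}.
  by have [M hM] := increasing_sets_prob mG incG aeG e0; exists M; split => //; exact: mG.
move: hr; apply: filterS => w [_ hw].
have /cvgrPdist_le/(_ _ g0)[T0 [_ hT0]] := hw.
(* Puts all times up to [- M] strictly before both [T0] and [0]. *)
have [M1 hM1] : exists M1 : nat, Num.max 1 (1 - T0) <= M1%:R.
  by have [M1 _ h] := nbhs_infty_ger (Num.max 1 (1 - T0)); exists M1; exact: (h M1 (leqnn M1)).
(* With [1 + g M <= e^(g M)] this yields [e^(- g M) <= eta * g]. *)
have [M2 hM2] : exists M2 : nat, (eta * g)^-1 / g <= M2%:R.
  by have [M2 _ h] := nbhs_infty_ger ((eta * g)^-1 / g); exists M2; exact: (h M2 (leqnn M2)).
exists (maxn M1 M2) => n; set M := maxn M1 M2.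
have hMa : Num.max 1 (1 - T0) <= M%:R by rewrite (le_trans hM1)// ler_nat leq_maxl.
have hMb : (eta * g)^-1 / g <= M%:R by rewrite (le_trans hM2)// ler_nat leq_maxr.
move: hMa; rewrite ge_max => /andP[hMa hMc].
have rbound s : s <= - M%:R -> r (theta s w) <= expR (- g * s).
  move=> sM; have sT : s < T0 by lra.
  have s0 : s < 0 by lra.
  have := hT0 s sT => /=; rewrite sub0r normrN (ltr0_norm s0).
  have lp0 : 0 <= log_plus (r (theta s w)) by rewrite /log_plus le_max lexx.
  rewrite ger0_norm ?divr_ge0 ?oppr_ge0 ?(ltW s0)// ler_pdivrMr ?oppr_gt0//.
  rewrite mulrN -mulNr => hl.
  (* A vanishing value is treated apart, as [lnK] requires a positive argument. *)
  have [r1|r1] := lerP (r (theta s w)) 0.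
    by rewrite (le_trans r1)// expR_ge0.
  rewrite -[leLHS](lnK r1) ler_expR (le_trans _ hl)// /log_plus le_max lexx orbT//.
have expi a b : leb.-integrable `[a, b] (EFin \o (fun s => expR (g * s))).
  apply: continuous_compact_integrable; first exact: segment_compact.
  apply: continuous_subspaceT => s; apply: (cvg_comp _ expR); last exact: continuous_expR.
  by apply: cvgM; [exact: cvg_cst|exact: cvg_id].
have MnM : - M%:R - n%:R <= - M%:R :> R by rewrite gerBl.
apply: (@le_trans _ _ (\int[leb]_(s in `[(- M%:R - n%:R)%R, (- M%:R)%R]) (expR (g * s))%:E)%E).
  apply: ge0_le_integral => //.
  - by move=> s _; rewrite lee_fin mulr_ge0 ?expR_ge0.
  - exact: (measurable_funTS (mth w)).
  - exact: (measurable_int _ (expi _ _)).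
  - move=> s /=; rewrite in_itv/= => /andP[_ sM]; rewrite lee_fin.
    have -> : g * s = 2 * g * s + (- g * s) by ring.
    by rewrite expRD ler_wpM2l ?expR_ge0// rbound.
have fin : (\int[leb]_(s in `[(- M%:R - n%:R)%R, (- M%:R)%R]) (expR (g * s))%:E)%E \is a fin_num.
  exact: (integrable_fin_num _ (expi _ _)).
rewrite -(fineK fin) lee_fin; apply: (le_trans (integral_exp_le g0 MnM)).
rewrite mulrN expRN ler_pdivrMr//.
have p1 : 0 < eta * g by rewrite mulr_gt0.
rewrite invf_ple ?posrE ?expR_gt0//.
apply: le_trans (expR_ge1Dx _) => /=.
rewrite ler_pdivrMr// in hMb; rewrite mulrC; lra.
Qed.

End tempered_tail.

Section unit_split.
Context {R : realType}.
Local Notation leb := (@lebesgue_measure R).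
Local Open Scope ereal_scope.

Lemma ge0_integral_unit_split (f : R -> \bar R) (a : R) (n : nat) :
  measurable_fun setT f -> (forall x, 0 <= f x) ->
  \int[leb]_(x in `[a, (a + n%:R)%R]) f x <=
  \sum_(i < n) \int[leb]_(x in `[(a + i%:R)%R, (a + i%:R + 1)%R]) f x.
Proof.
move=> mf f0; elim: n => [|n IH].
  by rewrite big_ord0 addr0 set_itv1 integral_set1.
rewrite big_ord_recr/=; apply: le_trans (leeD IH (lexx _)).
rewrite -natr1 addrA; apply: ge0_integral_split => //.
by rewrite lerDl.
Qed.

End unit_split.

(** * The pathwise estimate and the theorem *)

Section path_bound.
Context {R : realType} {H V : completeNormedModType R} {dot : {dot H for idfun}}
  {emb : {linear V -> H}} {A S : operator H} {d : measure_display}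
  {Omega : measurableType d} {P : probability Omega R} {theta : R -> Omega -> Omega}
  {F : V -> Omega -> H} {phi : R -> Omega -> H -> H} {B : Omega -> set V}.
Hypotheses (hr : rigged dot emb A S) (hmds : ergodic_mds P theta)
  (hrds : continuous_rds theta phi)
  (hgen : generated_by_equation dot emb S theta F phi)
  (hinv : forward_invariant theta phi (fun w => emb @` B w)).
Variable l : V -> V -> Omega -> R.
Hypotheses (hl0 : forall x1 x2 w, 0 <= l x1 x2 w)
  (hlmeas : measurable_fun setT (fun p : borel V * borel V * Omega => l p.1.1 p.1.2 p.2)).
Variable c : R.
Hypothesis hineq : forall w x1 x2, B w x1 -> B w x2 ->
     - dualA dot emb S (x1 - x2) (x1 - x2)
     + dualH dot emb (F x1 w - F x2 w) (x1 - x2)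
     <= - c * `|x1 - x2| ^+ 2 + l x1 x2 w * `|emb (x1 - x2)| ^+ 2.
Variables (m : R) (Y : Omega -> \bar R).
Hypotheses (hm : 0 < m) (mY : measurable_fun setT Y) (Y0 : forall w, (0 <= Y w)%E)
  (hY : forall w, (sup_integral emb theta phi B l m w <= Y w)%E).
Local Notation leb := (@lebesgue_measure R).
Variable N : V -> R.
Hypotheses (N0 : forall v, 0 <= N v) (mN : measurable_fun setT (N : borel V -> R)).

Section observation.
Variables (x1 x2 : H).

(* Put to [0] at negative times, where [phi] need not be measurable. *)
Definition observation (w : Omega) (t : R) : \bar R :=
  ((fun p => (N (toV emb (phi p.2 p.1 x1 - phi p.2 p.1 x2)))%:E) \_
     [set p : Omega * R | 0 <= p.2]) (w, t).

Lemma observation_ge0 w t : (0 <= observation w t)%E.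
Proof. by rewrite /observation /patch; case: ifPn => // _; rewrite lee_fin. Qed.

Lemma observationE w t : 0 <= t ->
  observation w t = (N (toV emb (phi t w x1 - phi t w x2)))%:E.
Proof. by move=> t0; rewrite /observation /patch mem_set. Qed.

Lemma measurable_observation : measurable_fun setT (fun p => observation p.1 p.2).
Proof.
have m0 : measurable [set p : Omega * R | 0 <= p.2].
  rewrite (_ : [set p | _] = setT `&` snd @^-1` `[0, +oo[).
    exact: measurable_snd.
  by rewrite setTI; apply/seteqP; split => p /=; rewrite in_itv/= andbT.
have h : measurable_fun [set p : Omega * R | 0 <= p.2]
    (fun p => (N (toV emb (phi p.2 p.1 x1 - phi p.2 p.1 x2)))%:E).
  apply/measurable_EFinP; apply: (measurableT_comp mN).
  apply: (measurableT_comp (measurable_toV hr)).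
  by apply: measurable_borelB; [exact: rigged_separable hr| |
    exact: (measurable_trajectory_joint hrds x1)|exact: (measurable_trajectory_joint hrds x2)].
have h' := (measurable_restrictT _ m0).1 h.
by apply: eq_measurable_fun h' => -[].
Qed.

Lemma measurable_observation_at w : measurable_fun setT (observation w).
Proof.
exact: (measurableT_comp measurable_observation
  (measurable_fun_pair (measurable_cst w) (@measurable_id _ R setT))).
Qed.

Lemma measurable_observed_integral a b :
  measurable_fun setT (fun w => (\int[leb]_(t in `[a, b]) observation w t)%E).
Proof.
have := @measurable_partial_integral R _ _ Omega (measurableTypeR R) lebesgue_measure
  `[a, b] (fun p => observation p.1 p.2) (measurable_itv _) measurable_observation.
by apply => p; exact: observation_ge0.
Qed.

End observation.

Section pair.
Variables (w : Omega) (x1 x2 : H) (s0 : R).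
Hypotheses (s00 : 0 < s0) (hB1 : (emb @` B (theta s0 w)) (phi s0 w x1))
  (hB2 : (emb @` B (theta s0 w)) (phi s0 w x2)).
Variables (c' C0 kappa Cw CL : R).
Hypotheses (hc' : 0 <= c') (hC0 : 0 <= C0) (hk0 : 0 <= kappa) (hk : kappa <= c' * m)
  (CL0 : 0 <= CL) (NL : forall v, N v <= CL * `|v| ^+ 2)
  (hN : forall v, c' * `|emb v| ^+ 2 <= c * `|v| ^+ 2 + C0 * N v).
Variable rr : Omega -> R.
Hypotheses (mrr : measurable_fun setT rr) (rr0 : forall w, 0 <= rr w)
  (hrr : forall w x, B w x -> `|x| ^+ 2 <= rr w).

Let g := c' - kappa / m.
Let K := expR (2 * (kappa * (m + 1) + Cw) / m).
Local Notation u := (fun t => phi t w x1 - phi t w x2).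

(** The Gronwall integral is split at [t - M]. On the recent part the exponential is at most [1] and
    each unit interval contributes at most [zeta]; on the older part [N v <= CL |v|^2] and
    [|p - q|^2 <= 4 rr] reduce to the tempered tail. *)
Lemma path_bound (t eta zeta : R) (M : nat) : s0 + m + M%:R <= t ->
  (forall n : nat, (orbit_integral (theta := theta) Y (- n%:R) 0 (theta t w) <= (kappa * n%:R + Cw)%:E)%E) ->
  (forall n : nat, (tail_integral (theta := theta) rr g (- M%:R - n%:R) (- M%:R) (theta t w) <= eta%:E)%E) ->
  (forall i, (i < M)%N -> (\int[leb]_(r in `[(t - M%:R + i%:R)%R, (t - M%:R + i%:R + 1)%R])
      observation x1 x2 w r <= zeta%:E)%E) ->
  `|u t| ^+ 2 <= K * expR (- (2 * g) * (t - (s0 + m))) * `|u (s0 + m)| ^+ 2 +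
    2 * C0 * K * (M%:R * zeta) + 2 * C0 * K * (CL * 4 * eta).
Proof.
set a0 := s0 + m => hMt hK hG hZ.
have M0 : 0 <= M%:R :> R by [].
have a0t : a0 <= t by rewrite (le_trans _ hMt)// lerDl.
have a00 : 0 < a0 by rewrite addr_gt0.
have sa : s0 <= a0 by rewrite lerDl ltW.
have aM : a0 <= t - M%:R by rewrite lerBrDr.
have Mt : t - M%:R <= t by rewrite gerBl.
have g0 : 0 <= g by rewrite subr_ge0 ler_pdivrMr.
have K0 : 0 <= K by exact: expR_ge0.
have CK0 : 0 <= 2 * C0 * K by rewrite !mulr_ge0.
have := trajectory_decay hr hmds hrds hgen hinv hl0 hlmeas hineq hm mY Y0 hY s00 hB1 hB2
  hC0 hk0 N0 mN NL hN a0t hK.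
rewrite -/a0 {1}/decay_weight -/K -/g => hdec; apply: (le_trans hdec).
rewrite -addrA lerD2l.
pose ob := observation x1 x2 w.
have ob0 r : (0 <= ob r)%E by exact: observation_ge0.
have mob : measurable_fun setT ob by exact: measurable_observation_at.
have wt r : decay_weight m c' kappa Cw t r = K * expR (- (2 * g) * (t - r)) by [].
pose I (a b : R) : \bar R := (\int[leb]_(r in `[a, b]) ((expR (- (2 * g) * (t - r)))%:E * ob r))%E.
have mexp : measurable_fun setT (fun r : R => (expR (- (2 * g) * (t - r)))%:E).
  apply/measurable_EFinP; apply: (measurableT_comp (@measurable_expR R)).
  by apply: measurable_funM => //; exact: measurable_funB.
have mI : measurable_fun setT (fun r : R => ((expR (- (2 * g) * (t - r)))%:E * ob r)%E).
  exact: emeasurable_funM.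
have I0 r : (0 <= (expR (- (2 * g) * (t - r)))%:E * ob r)%E.
  by rewrite mule_ge0// lee_fin expR_ge0.
have h1 : ((\int[leb]_(r in `[a0, t]) (decay_weight m c' kappa Cw t r *
     (2 * C0 * N (toV emb (phi r w x1 - phi r w x2)))))%:E <= (2 * C0 * K)%:E * I a0 t)%E.
  rewrite /I -ge0_integralZl//; last exact: measurable_funTS.
  have -> : (\int[leb]_(r in `[a0, t]) ((2 * C0 * K)%:E * ((expR (- (2 * g) * (t - r)))%:E * ob r)) =
     \int[leb]_(r in `[a0, t]) (decay_weight m c' kappa Cw t r *
     (2 * C0 * N (toV emb (phi r w x1 - phi r w x2))))%:E)%E.
    apply: eq_integral => r; rewrite inE/= in_itv/= => /andP[ar _].
    rewrite /ob observationE ?(le_trans _ ar)// ?ltW// wt -!EFinM; congr (_%:E); ring.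
  (* [Rintegral] is [fine] of [J], so an infinite [J] has to be considered; the bound is then
     infinite as well. *)
  rewrite /Rintegral; set J := (\int[_]_(_ in _) _)%E.
  have : (0 <= J)%E.
    apply: integral_ge0 => r _; rewrite lee_fin wt !mulr_ge0 ?expR_ge0//.
  by case: J => //= _; rewrite leey.
rewrite -lee_fin; apply: (le_trans h1).
have h2 : (I a0 t <= I a0 (t - M%:R)%R + I (t - M%:R)%R t)%E.
  exact: ge0_integral_split.
have h3 : (I (t - M%:R)%R t <= (M%:R * zeta)%:E)%E.
  apply: (@le_trans _ _ (\int[leb]_(r in `[(t - M%:R)%R, t]) ob r)%E).
    apply: ge0_le_integral => //; [exact: measurable_funTS|exact: measurable_funTS|].
    move=> r /=; rewrite in_itv/= => /andP[_ rt].
    rewrite -[leRHS]mul1e lee_wpmul2r// lee_fin -expR0 ler_expR.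
    by rewrite mulNr oppr_le0 !mulr_ge0// subr_ge0.
  have {2}-> : t = t - M%:R + M%:R by rewrite subrK.
  apply: (le_trans (ge0_integral_unit_split _ _ mob ob0)).
  apply: (@le_trans _ _ (\sum_(i < M) zeta%:E)%E).
    by apply: lee_sum => i _; exact: hZ.
  by rewrite sumEFin lee_fin sumr_const card_ord mulr_natl lexx.
have h4 : (I a0 (t - M%:R)%R <= (CL * 4 * eta)%:E)%E.
  apply: (@le_trans _ _ (\int[leb]_(r in `[a0, (t - M%:R)%R])
     ((CL * 4)%:E * (expR (2 * g * (r - t)) * rr (theta r w))%:E))%E).
    apply: ge0_le_integral => //; first exact: measurable_funTS.
      apply: measurable_funTS; apply: measurable_funeM; apply/measurable_EFinP.
      apply: measurable_funM; last exact: (measurable_orbit hmds w mrr).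
      apply: (measurableT_comp (@measurable_expR R)); apply: measurable_funM => //.
      exact: measurable_funB.
    move=> r /=; rewrite in_itv/= => /andP[ar _].
    have sr : s0 <= r by exact: le_trans ar.
    have r_0 : 0 <= r by rewrite (le_trans _ ar)// ltW.
    rewrite /ob (observationE _ _ _ r_0) -!EFinM lee_fin.
    have -> : - (2 * g) * (t - r) = 2 * g * (r - t) by ring.
    rewrite mulrCA ler_wpM2l ?expR_ge0//; apply: (le_trans (NL _)).
    rewrite -mulrA ler_wpM2l//.
    rewrite (toV_trajectoryB hr hmds hrds hinv s00 hB1 hB2 sr).
    have [b1 _] := absorbed hr hmds hrds hinv s00 hB1 sr.
    have [b2 _] := absorbed hr hmds hrds hinv s00 hB2 sr.
    have r1 := hrr b1; have r2 := hrr b2.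
    set p := toV emb (phi r w x1) in r1 *; set q := toV emb (phi r w x2) in r2 *.
    have h5 : `|p - q| ^+ 2 <= (`|p| + `|q|) ^+ 2.
      by rewrite ler_pXn2r ?nnegrE ?addr_ge0// ler_normB.
    apply: (le_trans h5); apply: (le_trans (sqrD_le _ _)).
    have -> : 4 * rr (theta r w) = 2 * (rr (theta r w) + rr (theta r w)) by ring.
    by rewrite ler_wpM2l// lerD.
  have CL4 : 0 <= CL * 4 by rewrite mulr_ge0.
  rewrite ge0_integralZl//; last 2 first.
  - apply: measurable_funTS; apply/measurable_EFinP.
    apply: measurable_funM; last exact: (measurable_orbit hmds w mrr).
    apply: (measurableT_comp (@measurable_expR R)); apply: measurable_funM => //.
    exact: measurable_funB.
  - by move=> r _; rewrite lee_fin mulr_ge0 ?expR_ge0.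
  rewrite [X in (_ <= X)%E]EFinM lee_wpmul2l//.
  (* As [a0 > 0], [n >= t] suffices for [[a0 - t, - M]] to lie in [[- M - n, - M]]. *)
  have [n _ hn] := nbhs_infty_ger t.
  apply: le_trans (hG n); rewrite /tail_integral.
  have {1}-> : a0 = a0 - t + t by rewrite subrK.
  have -> : t - M%:R = - M%:R + t by rewrite addrC.
  rewrite (ge0_integral_shift (f := fun r => (expR (2 * g * (r - t)) * rr (theta r w))%:E)); last 2 first.
  - apply/measurable_EFinP; apply: measurable_funM; last exact: (measurable_orbit hmds w mrr).
    apply: (measurableT_comp (@measurable_expR R)); apply: measurable_funM => //.
    exact: measurable_funB.
  - by move=> r; rewrite lee_fin mulr_ge0 ?expR_ge0.
  under eq_integral do rewrite addrK (mds_add hmds).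
  apply: ge0_subset_integral => //.
  - apply: measurable_funTS; apply/measurable_EFinP.
    apply: measurable_funM; last exact: (measurable_orbit hmds _ mrr).
    by apply: (measurableT_comp (@measurable_expR R)); apply: measurable_funM.
  - by move=> r _; rewrite lee_fin mulr_ge0 ?expR_ge0.
  - have hnn : t <= n%:R by exact: (hn n (leqnn n)).
    by apply: subset_itv; rewrite bnd_simp//; lra.
rewrite -mulrDr [X in (_ <= X)%E]EFinM lee_wpmul2l // addrC EFinD.
by apply: (le_trans h2); exact: leeD.
Qed.

End pair.
End path_bound.

(** * Choice of the constants *)

Lemma functionals_bound {R : realType} {V : completeNormedModType R} (k : nat)
    (L : 'I_k -> {linear V -> R^o}) : (forall j, continuous (L j)) ->
  exists2 C : R, 0 <= C & forall v,
    \big[Num.max/0]_(j < k) `|L j v| ^+ 2 <= C * `|v| ^+ 2.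
Proof.
move=> Lc.
have /choice[M hM] : forall j, exists M : R, forall v, `|L j v| <= M * `|v|.
  by move=> j; have [M _ hM] := linear_bounded (Lc j); exists M.
exists (\sum_(j < k) M j ^+ 2); first by apply: sumr_ge0 => j _; exact: sqr_ge0.
move=> v; apply/bigmax_leP; split.
  by rewrite mulr_ge0 ?sqr_ge0//; apply: sumr_ge0 => j _; exact: sqr_ge0.
move=> j _; apply: (@le_trans _ _ ((M j * `|v|) ^+ 2)).
  have h := hM j v; have h0 := normr_ge0 (L j v).
  by rewrite ler_pXn2r ?nnegrE// (le_trans h0).
rewrite exprMn ler_wpM2r ?sqr_ge0// (bigD1 j)//= lerDl.
by apply: sumr_ge0 => i _; exact: sqr_ge0.
Qed.

(** For [e > 0], [c'] is midway between [s / m] and [c / e^2], and [kappa] midway between [s] and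
    [c' m]. For [e = 0] nothing bounds [c'] from above, and it is chosen from [s] alone. *)
Lemma rate_constants {R : realType} (m c e : R) (s : \bar R) : 0 < m -> 0 < c -> 0 <= e ->
  (0 <= s)%E -> (m^-1%:E * s < c%:E * (e%:E ^+ 2)^-1)%E ->
  exists kappa c' : R, [/\ (s < kappa%:E)%E, 0 <= kappa, kappa < c' * m, 0 < c' &
    c' * e ^+ 2 < c].
Proof.
move=> m0 c0 e0 s0 h.
have sfin : s \is a fin_num.
  rewrite ge0_fin_numE// ltNge; apply/negP; rewrite leye_eq => /eqP sE; move: h.
  by rewrite sE gt0_muley ?lte_fin ?invr_gt0// ltNge leey.
move: h; rewrite -(fineK sfin); set x := fine s; move=> h.
have x0 : 0 <= x by rewrite fine_ge0.
have [eE|e1] := eqVneq e 0.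
  exists (x + 1), ((x + 2) / m); split.
  - by rewrite lte_fin ltrDl.
  - by rewrite addr_ge0.
  - by rewrite divfK ?gt_eqF// ltrD2l ltr1n.
  - by rewrite divr_gt0// ltr_wpDl.
  - by rewrite eE expr0n mulr0.
have ep : 0 < e ^+ 2 by rewrite exprn_gt0// lt_neqAle eq_sym e1.
move: h; rewrite -EFin_expe inver gt_eqF// -!EFinM lte_fin => h.
have hx : x < c / e ^+ 2 * m by rewrite -ltr_pdivrMr// mulrC.
pose c' := (x / m + c / e ^+ 2) / 2.
have h1 : x / m < c' /\ c' < c / e ^+ 2.
  by rewrite mulrC in h; rewrite /c'; split; lra.
have xc : x < c' * m by rewrite -ltr_pdivrMr//; case: h1.
exists ((x + c' * m) / 2), c'; split.
- by rewrite lte_fin; lra.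
- by rewrite divr_ge0// addr_ge0// (le_trans x0)// ltW.
- by lra.
- by rewrite (le_lt_trans _ h1.1)// divr_ge0// ltW.
- by rewrite -ltr_pdivlMr//; case: h1.
Qed.

Section small_reals.
Context {R : realType}.

Lemma small_constant (a b : R) : 0 <= a -> 0 < b -> exists2 x, 0 < x & a * x <= b.
Proof.
move=> a0 b0; exists (b / (a + 1)); first by rewrite divr_gt0// ltr_wpDl.
by rewrite mulrCA ger_pMr// ler_pdivrMr ?ltr_wpDl// mul1r lerDl.
Qed.

Lemma exponential_small (a b g : R) : 0 <= a -> 0 < b -> 0 < g ->
  exists t0, forall t, t0 <= t -> a * expR (- g * t) <= b.
Proof.
move=> a0 b0 g0; exists (a / b / g) => t; rewrite !ler_pdivrMr// => h.
rewrite mulNr expRN ler_pdivrMr ?expR_gt0//; apply: (le_trans h).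
rewrite mulrC ler_pM2l// (le_trans _ (expR_ge1Dx _))// mulrC; lra.
Qed.

End small_reals.

Lemma prob_setC_le {R : realType} {d} {T : measurableType d} (P : probability T R)
    (E : set T) (e : R) : measurable E -> ((1 - e)%:E <= P E)%E -> (P (~` E) <= e%:E)%E.
Proof.
move=> mE; rewrite probability_setC//.
have fin : P E \is a fin_num by apply: fin_num_measure.
rewrite -(fineK fin) !lee_fin; lra.
Qed.

Lemma prob_setU_le {R : realType} {d} {T : measurableType d} (P : probability T R)
    (A B : set T) (a b : R) : measurable A -> measurable B ->
  (P A <= a%:E)%E -> (P B <= b%:E)%E -> (P (A `|` B) <= (a + b)%:E)%E.
Proof.
by move=> mA mB hA hB; apply: (le_trans (measureU2 _ mA mB)); rewrite EFinD leeD.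
Qed.

Theorem theorem2p2 (R : realType)
  (H V : completeNormedModType R) (dot : {dot H for idfun})
  (emb : {linear V -> H}) (A sqrtA : operator H)
  (hrigged : rigged dot emb A sqrtA)
  (d : measure_display) (Omega : measurableType d) (P : probability Omega R)
  (theta : R -> Omega -> Omega) (hmds : ergodic_mds P theta)
  (F : V -> Omega -> H) (phi : R -> Omega -> H -> H)
  (hrds : continuous_rds theta phi)
  (hgen : generated_by_equation dot emb sqrtA theta F phi)
  (B : Omega -> set V) (hdiss : dissipative P theta phi emb B)
  (k : nat) (L : 'I_k -> {linear V -> R^o})
  (hLcont : forall j, continuous (L j))
  (hLindep : lin_independent L)
  (hBtempered : exists2 r : Omega -> R, tempered P theta r &
     forall w x, B w x -> `|x| ^+ 2 <= r w)
  (hBint : forall w,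
     locally_integrable setT (fun t => sup [set `|x| ^+ 2 | x in B (theta t w)]))
  (c : R) (hc : 0 < c)
  (l : V -> V -> Omega -> R) (hl0 : forall x1 x2 w, 0 <= l x1 x2 w)
  (hlmeas : measurable_fun setT
     (fun p : borel V * borel V * Omega => l p.1.1 p.1.2 p.2))
  (hineq : forall w x1 x2, B w x1 -> B w x2 ->
     - dualA dot emb sqrtA (x1 - x2) (x1 - x2)
     + dualH dot emb (F x1 w - F x2 w) (x1 - x2)
     <= - c * `|x1 - x2| ^+ 2 + l x1 x2 w * `|emb (x1 - x2)| ^+ 2)
  (m : R) (hm : 0 < m)
  (hsupmeas : ae_measurable P (sup_integral emb theta phi B l m))
  (hmean : (m^-1%:E * \int[P]_w sup_integral emb theta phi B l m w
            < c%:E * (completeness_defect emb L ^+ 2)^-1)%E) :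
  determining_in_probability emb P phi L.
Proof.
pose leb := @lebesgue_measure R.
move=> x1 x2 hobs delta delta0.
pose N v : R := \big[Num.max/0]_(j < k) `|L j v| ^+ 2.
have N0 v : 0 <= N v by exact: bigmax_ge_id.
have mN : measurable_fun setT (N : borel V -> R) by exact: measurable_functionals.
have hinv := diss_invariant hdiss.
have [Bnon Bcomp Bmeas] := diss_random hdiss.
have [rr hrt hrr] := hBtempered; have [mrr rr0 _] := hrt.
have sup0 w : (0 <= sup_integral emb theta phi B l m w)%E.
  have [_ [z Bz _]] := Bnon w.
  apply: (@le_trans _ _ (\int[lebesgue_measure]_(t in `[0%R, m])
      (l (toV emb (phi t w (emb z))) (toV emb (phi t w (emb z))) (theta t w))%:E)%E).
    by apply: integral_ge0 => t _; rewrite lee_fin.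
  by apply: ereal_sup_ubound; exists (z, z).
have [Y [mY Y0 hY IY]] := measurable_majorant sup0 hsupmeas.
have [e [e0 eE he]] := completeness_defect_fin L (rigged_continuous hrigged).
rewrite eE in hmean.
have [|kappa [c' [hkY hk0 hk c'0 hc']]] := rate_constants hm hc e0 _ hmean.
  exact: integral_ge0.
have [C0 hC0 hN] := defect_inequality (rigged_continuous hrigged) hLcont e0 c'0 he hc'.
have [CL CL0 NL] := functionals_bound hLcont.
pose g := c' - kappa / m.
have g0 : 0 < g by rewrite subr_gt0 ltr_pdivrMr.
(* Each of the three terms of [path_bound] will be at most a quarter of [delta^2], so their sum
   stays below it. *)
have D0 : 0 < delta ^+ 2 / 4 by rewrite divr_gt0// exprn_gt0.
set D := delta ^+ 2 / 4 in D0.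
apply: cvg_prob0 => eps eps0.
(* Six bad events cost at most this much each: two failures of absorption, the ergodic bound, the
   size at [a0], the tail, and all observation windows together. *)
pose e8 := eps / 8; have e80 : 0 < e8 by rewrite divr_gt0.
have [t1 t10 ht1] := diss_absorbing hdiss e80 (measurable_cst (x1 : borel H)).
have [t2 t20 ht2] := diss_absorbing hdiss e80 (measurable_cst (x2 : borel H)).
pose s0 := Num.max t1 t2.
have s00 : 0 < s0 by rewrite lt_max t10.
have st1 : t1 <= s0 by rewrite le_max lexx.
have st2 : t2 <= s0 by rewrite le_max lexx orbT.
pose E x := [set w | (emb @` B (theta s0 w)) (phi s0 w x)].
have mE x : measurable (E x).
  apply: (measurable_random_closed (C := fun w => emb @` B (theta s0 w)) (f := fun w => phi s0 w x)).
  - exact: rigged_separable hrigged.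
  - by move=> w; exact: Bnon.
  - by move=> w; apply: compact_closed; [exact: norm_hausdorff|exact: Bcomp].
  - by move=> y; exact: (measurableT_comp (Bmeas y) (measurable_flow hmds s0)).
  - exact: (measurable_trajectory_at hrds x (ltW s00)).
have PE1 : (P (~` E x1) <= e8%:E)%E by exact: (prob_setC_le (mE x1) (ht1 _ st1)).
have PE2 : (P (~` E x2) <= e8%:E)%E by exact: (prob_setC_le (mE x2) (ht2 _ st2)).
have [Cw mGC PGC] := ergodic_upper_bound hmds mY Y0 (le_lt_trans IY hkY) e80.
set GC := [set w | _] in mGC PGC.
pose K := expR (2 * (kappa * (m + 1) + Cw) / m).
have K0 : 0 <= K by exact: expR_ge0.
pose a0 := s0 + m; have a00 : 0 < a0 by rewrite addr_gt0.
pose u t w := phi t w x1 - phi t w x2.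
have mu t : 0 <= t -> measurable_fun setT (fun w => `|u t w|).
  move=> t0; apply: (measurableT_comp (@measurable_norm R H)).
  by apply: measurable_borelB; [exact: rigged_separable hrigged| |
    exact: (measurable_trajectory_at hrds x1 t0)|exact: (measurable_trajectory_at hrds x2 t0)].
have mu2 : measurable_fun setT (fun w => `|u a0 w| ^+ 2).
  by apply: measurable_funX; apply: mu; exact: ltW.
have [rho rho0 Prho] := bounded_in_probability P mu2 e80.
have CK0 : 0 <= 2 * C0 * K by rewrite !mulr_ge0.
(* The order matters: [eta] depends on [K], hence on [Cw]; [M] depends on [eta], and [zeta] on [M].
   None of them depends on [t]. *)
have [|eta eta0 heta] := small_constant (_ : 0 <= 2 * C0 * K * (CL * 4)) D0.
  by rewrite !mulr_ge0.
have [M [mGM PGM]] := tempered_tail hmds hrt g0 eta0 e80.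
set GM := [set w | _] in mGM PGM.
have [|zeta zeta0 hzeta] := small_constant (_ : 0 <= 2 * C0 * K * M%:R) D0.
  by rewrite mulr_ge0.
have [||T1 hT1] := exponential_small (_ : 0 <= K * rho) D0 (_ : 0 < 2 * g).
- by rewrite mulr_ge0.
- by rewrite mulr_gt0.
(* The [M] windows share one [e8]; [M.+1] covers [M = 0]. *)
have eM : 0 < e8 / M.+1%:R by rewrite divr_gt0.
have [T2 hT2] := prob0_cvg (hobs zeta zeta0) eM.
pose ob := observation (emb := emb) (phi := phi) N x1 x2.
pose Z (t : R) (w : Omega) : \bar R := (\int[leb]_(r in `[t, (t + 1)%R]) ob w r)%E.
have mZ t : measurable [set w | (zeta%:E <= Z t w)%E].
  rewrite -[X in measurable X]setTI; apply: emeasurable_fun_c_infty => //.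
  exact: (measurable_observed_integral hrigged hrds N0 mN x1 x2).
have PZ t : 0 <= t -> T2 <= t -> (P [set w | (zeta%:E <= Z t w)%E] <= (e8 / M.+1%:R)%:E)%E.
  move=> t0 /hT2; congr (P _ <= _)%E; apply/funext => w /=.
  have -> : (\int[leb]_(tau in `[t, (t + 1)%R])
      (N (toV emb (phi tau w x1 - phi tau w x2)))%:E)%E = Z t w.
    apply: eq_integral => r; rewrite inE/= in_itv/= => /andP[tr _].
    by rewrite /ob observationE// (le_trans t0).
  by rewrite gee0_abs//; apply: integral_ge0 => r _; exact: observation_ge0.
(* The first bound makes room for the split at [t - M], the second makes the initial term small, and
   the third puts every observation window at nonnegative times beyond [T2]. *)
exists (Num.max (a0 + M%:R) (Num.max (T1 + a0) (Num.max 0 T2 + M%:R))) => t.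
rewrite !ge_max => /and3P[tA tB tC].
have t0 : 0 <= t by rewrite (le_trans _ tA)// addr_ge0// ltW.
pose Zs i := [set w | (zeta%:E <= Z (t - M%:R + i%:R)%R w)%E].
(* The events [GC] and [GM] are pulled back by [theta t], so by invariance their cost does not
   depend on [t]. *)
pose bad := ~` E x1 `|` ~` E x2 `|` theta t @^-1` (~` GC) `|`
  ~` [set w | `|u a0 w| ^+ 2 <= rho] `|` theta t @^-1` (~` GM) `|`
  \big[setU/set0]_(i < M) Zs i.
have mflow X : measurable X -> measurable (theta t @^-1` X).
  by move=> mX; rewrite -[X in measurable X]setTI; exact: (measurable_flow hmds t).
have m1 := measurableC (mE x1). have m2 := measurableC (mE x2).
have m3 := mflow _ (measurableC mGC).
have m4 : measurable (~` [set w | `|u a0 w| ^+ 2 <= rho]).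
  by apply: measurableC; rewrite -[X in measurable X]setTI -preimage_itvNyc; exact: mu2.
have m5 := mflow _ (measurableC mGM).
have m6 : measurable (\big[setU/set0]_(i < M) Zs i).
  by apply: bigsetU_measurable => i _; exact: mZ.
have mbad : measurable bad.
  by do 5 (apply: measurableU => //).
have Pbad : (P bad <= eps%:E)%E.
  have p6 : (P (\big[setU/set0]_(i < M) Zs i) <= (M%:R * (e8 / M.+1%:R))%:E)%E.
    apply: prob_bigU_le => [i|i iM]; first exact: mZ.
    have i0 : 0 <= i%:R :> R by [].
    have tM : Num.max 0 T2 <= t - M%:R by rewrite lerBrDr.
    move: tM; rewrite ge_max => /andP[tM0 tM2].
    by apply: PZ; [rewrite addr_ge0|rewrite (le_trans tM2)// lerDl].
  have p3 : (P (theta t @^-1` (~` GC)) <= e8%:E)%E.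
    by rewrite (mds_invariant hmds)//; exact: measurableC.
  have p5 : (P (theta t @^-1` (~` GM)) <= e8%:E)%E.
    by rewrite (mds_invariant hmds)//; exact: measurableC.
  have q2 := prob_setU_le m1 m2 PE1 PE2.
  have q3 := prob_setU_le (measurableU _ _ m1 m2) m3 q2 p3.
  have q4 := prob_setU_le (measurableU _ _ (measurableU _ _ m1 m2) m3) m4 q3 Prho.
  have q5 := prob_setU_le (measurableU _ _ (measurableU _ _ (measurableU _ _ m1 m2) m3) m4) m5 q4 p5.
  have q6 := prob_setU_le (measurableU _ _ (measurableU _ _ (measurableU _ _ (measurableU _ _ m1 m2) m3) m4) m5) m6 q5 p6.
  apply: (le_trans q6); rewrite lee_fin.
  have : M%:R * (e8 / M.+1%:R) <= e8.
    by rewrite mulrCA ger_pMr// ler_pdivrMr// mul1r ler_nat.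
  have -> : eps = e8 + e8 + e8 + e8 + e8 + e8 + e8 + e8 by rewrite /e8; field.
  by move: (M%:R * _) e80 => y; clearbody e8; lra.
apply: le_trans Pbad; apply: le_measure; rewrite ?inE//.
  rewrite -[X in measurable X]setTI.
  apply: emeasurable_fun_c_infty => //; apply: measurableT_comp => //.
  by apply/measurable_EFinP; exact: mu.
move=> w /= hw; apply: contrapT => hgood.
have good X : X `<=` bad -> ~ X w by move=> Xbad Xw; exact/hgood/Xbad.
have hB1 : E x1 w by apply: contrapT; apply: (good (~` E x1)) => y; do 5 left.
have hB2 : E x2 w by apply: contrapT; apply: (good (~` E x2)) => y; do 4 left; right.
have hK : GC (theta t w).
  by apply: contrapT; apply: (good (theta t @^-1` (~` GC))) => y; do 3 left; right.
have hrho : `|u a0 w| ^+ 2 <= rho.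
  by apply: contrapT; apply: (good (~` [set w | `|u a0 w| ^+ 2 <= rho])) => y; do 2 left; right.
have hG : GM (theta t w).
  by apply: contrapT; apply: (good (theta t @^-1` (~` GM))) => y; left; right.
have hZ i : (i < M)%N -> (Z (t - M%:R + i%:R)%R w <= zeta%:E)%E.
  move=> iM; have : ~ Zs i w.
    apply: good => y hy; right; rewrite -bigcup_mkord; by exists i.
  by move=> /negP; rewrite -ltNge => /ltW.
have := path_bound hrigged hmds hrds hgen hinv hl0 hlmeas hineq hm mY Y0 hY N0 mN s00 hB1 hB2
  hC0 hk0 (ltW hk) CL0 NL hN mrr rr0 hrr tA hK hG hZ.
rewrite -/a0 -/K -/g => hfin.
have d1 : K * expR (- (2 * g) * (t - a0)) * `|u a0 w| ^+ 2 <= D.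
  have h1 := hT1 (t - a0); rewrite lerBrDr in h1; have {}h1 := h1 tB.
  apply: le_trans h1; rewrite mulrAC ler_wpM2r ?expR_ge0// ler_wpM2l//.
have d2 : 2 * C0 * K * (M%:R * zeta) <= D by rewrite mulrA.
have d3 : 2 * C0 * K * (CL * 4 * eta) <= D by rewrite mulrA.
have hd : delta ^+ 2 <= `|u t w| ^+ 2.
  by rewrite ler_pXn2r ?nnegrE ?(ltW delta0)//; move: hw; rewrite lee_fin normr_id.
have : delta ^+ 2 = 4 * D by rewrite /D; field.
move: hfin hd d1 d2 d3 D0; rewrite /u; lra.
Qed.
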